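(* Define the epoch schedule $\tau_0=0$, $(\tau_1,\tau_2):=(3,5)$ and $\tau_m:=m^2$ for $m\ge3$ (this satisfies $\tau_{m+1}\le2\tau_m$). With high probability, the warm-start variant of the algorithm ILOVETOCONBANDITS (defined in the context), run with this schedule, makes $$\tilde O\left(\sqrt{KT/\ln(|\Pi|/\delta)}\right)$$ calls to $\mathsf{AMO}$ over $T$ rounds and $O(\sqrt T)$ calls to the Coordinate Descent Algorithm.
   Context: Setting. $A$ is a finite set of $K$ actions, $X$ a space of contexts, $\Pi\subseteq A^X$ a finite set of policies, $\mathcal D$ a distribution over $X\times[0,1]^A$, $\delta\in(0,1)$ the allowed failure probability given to the algorithm. Pairs $(x_t,r_t)$ are i.i.d. from $\mathcal D$; in round $t$ the agent observes $x_t$, randomly chooses $a_t$ (with probability $p_t(a_t)$), and receives $r_t(a_t)$. $H_t$ is the history of records $(x_i,a_i,r_i(a_i),p_i(a_i))$, $i\le t$; $\widehat{\mathbb E}_{x\sim H_t}$ is expectation over $x$ uniform among the $t$ contexts of $H_t$. $\widehat{\mathcal R}_t(\pi)=\frac1t\sum_{i=1}^t\frac{r_i(a_i)\mathbf 1\{\pi(x_i)=a_i\}}{p_i(a_i)}$; $\pi_t\in\arg\max_{\pi\in\Pi}\widehat{\mathcal R}_t(\pi)$ ($\pi_0$ arbitrary); $\widehat{\mathrm{Reg}}_t(\pi)=\widehat{\mathcal R}_t(\pi_t)-\widehat{\mathcal R}_t(\pi)$. Oracle. $\mathsf{AMO}$ takes a finite sequence of pairs of contexts and non-negative reward vectors $(x_i,r_i)$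 and returns an element of $\arg\max_{\pi\in\Pi}\sum_ir_i(\pi(x_i))$. Weights. $\Delta^\Pi=\{Q\in\mathbb R^\Pi: Q(\pi)\ge 0\ \forall\pi,\ \sum_\pi Q(\pi)\le 1\}$. For non-negative $Q$: $Q(a|x)=\sum_{\pi:\pi(x)=a}Q(\pi)$, $Q^\mu(a|x)=(1-K\mu)Q(a|x)+\mu$. (OP). Given $H_t$ and $\mu$, let $b_\pi=\widehat{\mathrm{Reg}}_t(\pi)/(\psi\mu)$ with $\psi=100$. Find $Q\in\Delta^\Pi$ with $\sum_\pi Q(\pi)b_\pi\le 2K$ and, for all $\pi\in\Pi$, $\widehat{\mathbb E}_{x\sim H_t}[1/Q^{\mu}(\pi(x)|x)]\le 2K+b_\pi$. Algorithm ILOVETOCONBANDITS. Set $\mu_0=1/(2K)$ and $\mu_m=\min\{\frac1{2K},\sqrt{\ln(16\tau_m^2|\Pi|/\delta)/(K\tau_m)}\}$ for $m\ge 1$; $Q_0=\mathbf 0$, $m=1$. In each round $t=1,2,\dots$: observe $x_t$; let $\tilde Q_{m-1}=Q_{m-1}+(1-\sum_\pi Q_{m-1}(\pi))\mathbf 1_{\pi_{\tau_{m-1}}}$, where $\mathbf 1_\pi$ is the unit mass on $\pi$; draw $a_t$ from $\tilde Q_{m-1}^{\mu_{m-1}}(\cdot|x_t)$ and set $p_t(a_t)=\tilde Q_{m-1}^{\mu_{m-1}}(a_t|x_t)$; observe $r_t(a_t)$; if $t=\tau_m$, let $Q_m$ be a solution of (OP) with history $H_t$ and minimum probability $\mu_m$,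 and set $m:=m+1$. Warm-start variant: $Q_m$ is the output of the Coordinate Descent Algorithm on $H_{\tau_m}$, $\mu_m$ with $Q_{\mathrm{init}}:=Q_{m-1}$ (the previously computed weights). Coordinate Descent Algorithm. Input $H_t$, $\mu$, $Q_{\mathrm{init}}\in\Delta^\Pi$. For each $\pi,Q$ define $V_\pi(Q)=\widehat{\mathbb E}_{x\sim H_t}[1/Q^\mu(\pi(x)|x)]$, $S_\pi(Q)=\widehat{\mathbb E}_{x\sim H_t}[1/(Q^\mu(\pi(x)|x))^2]$, $D_\pi(Q)=V_\pi(Q)-(2K+b_\pi)$. Set $Q:=Q_{\mathrm{init}}$. Loop: (i) if $\sum_\pi Q(\pi)(2K+b_\pi)>2K$, replace $Q$ by $cQ$ with $c=2K/\sum_\pi Q(\pi)(2K+b_\pi)$; (ii) if there is a policy $\pi$ with $D_\pi(Q)>0$, add $\alpha_\pi(Q)=\frac{V_\pi(Q)+D_\pi(Q)}{2(1-K\mu)S_\pi(Q)}$ to $Q(\pi)$ and leave all other weights unchanged; otherwise halt and output $Q$. It is implemented with one call to $\mathsf{AMO}$ before the loop is started (to compute $\pi_t$) and one call for each iteration of the loop thereafter (to find a policy maximizing $D_\pi(Q)$). Notation. $\tilde O$ suppresses dependence on logarithmic factors in $T$ and $K$, as well as in $\log(|\Pi|/\delta)$ (i.e. terms which are $O(\log\log(|\Pi|/\delta))$).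
   Formalization: With L=ln(|Π|/δ) and p the suppressed log factors, the AMO bound is proved as C·p^(k+j)·√(KT/L) when L ≤ K·p^j (any j): the ~√T descent calls each cost ≥2 AMO calls, so it fails for larger L. τ_{m+1} ≤ 2τ_m is for m≥1. *)

(* Defs.v *)
From HB Require Import structures.
From mathcomp Require Import all_boot all_order all_algebra.
From mathcomp Require Import all_classical all_reals all_analysis.
Import Order.TTheory GRing.Theory Num.Theory numFieldNormedType.Exports.

Set Implicit Arguments.
Unset Strict Implicit.
Unset Printing Implicit Defensive.

Local Open Scope classical_set_scope.
Local Open Scope ring_scope.

Definition tau (m : nat) : nat :=
  match m with 0 => 0 | 1 => 3 | 2 => 5 | _ => m ^ 2 end.

(* Actions are ['I_K].  The finite policy set is indexed by a finite type
   [Pi] through [pol]; [pol] is meant to be injective, so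
   that [#|Pi|] is the number of policies. *)
Section Algorithm.
Context {R : realType} {K : nat} {X : Type} {Pi : finType}.

Definition reward_vec : Type := (K.-tuple R)%type.
Definition weights : Type := {ffun Pi -> R}.

Definition is_AMO (pol : Pi -> X -> 'I_K) (amo : seq (X * reward_vec) -> Pi) :=
  forall s : seq (X * reward_vec),
    all (fun e => [forall a, 0 <= tnth e.2 a]) s ->
  forall pi : Pi,
    \sum_(e <- s) tnth e.2 (pol pi e.1) <=
    \sum_(e <- s) tnth e.2 (pol (amo s) e.1).

Record obs := Obs {
  obs_ctx : X; obs_act : 'I_K; obs_rew : R; obs_prob : R }.

Context (pol : Pi -> X -> 'I_K) (amo : seq (X * reward_vec) -> Pi).

Definition unit_mass (pi : Pi) : weights := [ffun pi' => (pi' == pi)%:R].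

Definition act_weight (Q : weights) (a : 'I_K) (x : X) : R :=
  \sum_(pi | pol pi x == a) Q pi.

Definition smoothed (Q : weights) (mu : R) (a : 'I_K) (x : X) : R :=
  (1 - K%:R * mu) * act_weight Q a x + mu.

Definition psi : R := 100.

Section FixedHistory.
Context (H : seq obs) (mu : R).
Let t : R := (size H)%:R.

Definition ctx_mean (f : X -> R) : R := t^-1 * \sum_(h <- H) f (obs_ctx h).

Definition ips (h : obs) (a : 'I_K) : R :=
  obs_rew h * (a == obs_act h)%:R / obs_prob h.

Definition emp_reward (pi : Pi) : R :=
  t^-1 * \sum_(h <- H) ips h (pol pi (obs_ctx h)).

Definition best_policy : Pi :=
  amo [seq (obs_ctx h, [tuple ips h a | a < K]) | h <- H].

Definition emp_regret (pi : Pi) : R :=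
  emp_reward best_policy - emp_reward pi.

Definition b_ (pi : Pi) : R := emp_regret pi / (psi * mu).

Definition V_ (pi : Pi) (Q : weights) : R :=
  ctx_mean (fun x => (smoothed Q mu (pol pi x) x)^-1).

Definition S_ (pi : Pi) (Q : weights) : R :=
  ctx_mean (fun x => (smoothed Q mu (pol pi x) x ^+ 2)^-1).

Definition D_ (pi : Pi) (Q : weights) : R :=
  V_ pi Q - (2 * K%:R + b_ pi).

Definition cd_scale (Q : weights) : weights :=
  let s := \sum_pi Q pi * (2 * K%:R + b_ pi) in
  if 2 * K%:R < s then [ffun pi => (2 * K%:R / s) * Q pi] else Q.

(* [\sum_i r~_i(pi(x_i)) = psi * mu * D_pi(Q) + c] with [c] independent of
   [pi], where [r~_i] are the reward vectors below; hence the answer of the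
   oracle maximizes [D_ ^~ Q]. *)
Definition cd_policy (Q : weights) : Pi :=
  amo [seq (obs_ctx h,
            [tuple t^-1 * (psi * mu / smoothed Q mu a (obs_ctx h) + ips h a)
            | a < K]) | h <- H].

Definition cd_stop (Q : weights) : bool := ~~ [exists pi, 0 < D_ pi Q].

Definition cd_alpha (pi : Pi) (Q : weights) : R :=
  (V_ pi Q + D_ pi Q) / (2 * (1 - K%:R * mu) * S_ pi Q).

Definition cd_update (Q : weights) : weights :=
  let pi := cd_policy Q in
  [ffun pi' => Q pi' + (pi' == pi)%:R * cd_alpha pi Q].

(* Weights after step (i) of loop iteration [n.+1], if iterations [1..n] all
   updated a coordinate. *)
Definition cd_weights (Qinit : weights) (n : nat) : weights :=
  cd_scale (iter n (cd_update \o cd_scale) Qinit).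

(* The output weights and the number of oracle calls, or [None] if the loop
   runs forever.  When [n] iterations update a coordinate before the halting
   one, there are [n.+2] oracle calls: one for [best_policy] before the loop,
   [n] for the updating iterations and one for the halting iteration. *)
Definition coord_descent (Qinit : weights) : option (weights * nat) :=
  match pselect (exists n, cd_stop (cd_weights Qinit n)) with
  | left ex => Some (cd_weights Qinit (ex_minn ex), (ex_minn ex).+2)
  | right _ => None
  end.

End FixedHistory.

Context (delta : R) (pi0 : Pi).

Definition mu_ (m : nat) : R :=
  let K' : R := K%:R in
  let tm : R := (tau m)%:R in
  if m is 0 then (2 * K')^-1
  else Num.min (2 * K')^-1
         (Num.sqrt (ln (16 * tm ^+ 2 * #|Pi|%:R / delta) / (K' * tm))).

(* In epoch [m], [st_weights] is Q_(m-1) and [st_leader] is the empirically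
   best policy at time [tau (m - 1)]. *)
Record state := State {
  st_hist : seq obs;
  st_epoch : nat;
  st_weights : weights;
  st_leader : Pi;
  st_amo_calls : nat;
  st_cd_calls : nat }.

Definition init_state : state := State [::] 1 [ffun=> 0] pi0 0 0.

Definition completed (s : state) : weights :=
  [ffun pi => st_weights s pi
              + (1 - \sum_pi' st_weights s pi') * unit_mass (st_leader s) pi].

Definition act_prob (s : state) (x : X) (a : 'I_K) : R :=
  smoothed (completed s) (mu_ (st_epoch s).-1) a x.

(* [best_policy H] is computed by the first oracle call of [coord_descent], so
   storing it as the next leader costs no further call. *)
Definition round (s : state) (xr : X * reward_vec) (a : 'I_K) : option state :=
  let m := st_epoch s in
  let H := rcons (st_hist s) (Obs xr.1 a (tnth xr.2 a) (act_prob s xr.1 a)) in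
  if size H == tau m then
    omap (fun Qn : weights * nat =>
            State H m.+1 Qn.1 (best_policy H)
                  (st_amo_calls s + Qn.2) (st_cd_calls s).+1)
         (coord_descent H (mu_ m) (st_weights s))
  else Some (State H m (st_weights s) (st_leader s)
                   (st_amo_calls s) (st_cd_calls s)).

(* [z t] and [act t] are the context-reward pair and the action of round
   [t.+1]; [run n] is the state after [n] rounds, [None] if some call to the
   coordinate descent did not halt. *)
Fixpoint run (z : nat -> X * reward_vec) (act : nat -> 'I_K) (n : nat) :
    option state :=
  if n is n'.+1 then
    obind (fun s => round s (z n') (act n')) (run z act n')
  else Some init_state.

(* The uniform value only makes the function total: no action is drawn once
   the run has diverged. *)
Definition run_prob (z : nat -> X * reward_vec) (act : nat -> 'I_K) (t : nat)
    (a : 'I_K) : R :=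
  if run z act t is Some s then act_prob s (z t).1 a else K%:R^-1.

End Algorithm.

Section Probability.
Context {R : realType} {K : nat} {dX : measure_display}
  {X : measurableType dX} {Pi : finType}.

(* For each length, the oracle is measurable into the discrete space [Pi]. *)
Definition measurable_AMO (amo : seq (X * K.-tuple R) -> Pi) : Prop :=
  forall (n : nat) (pi : Pi),
    measurable [set s : n.-tuple (X * K.-tuple R)%type | amo s = pi].

Context {dO : measure_display} {Omega : measurableType dO}.

Definition past (z : nat -> Omega -> X * K.-tuple R)
    (act : nat -> Omega -> 'I_K) (t : nat) : set (set Omega) :=
  [set E | exists2 i, (i < t)%N &
     (exists2 B, measurable B & E = z i @^-1` B) \/
     (exists a, E = act i @^-1` [set a])].

Definition past_and_current (z : nat -> Omega -> X * K.-tuple R)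
    (act : nat -> Omega -> 'I_K) (t : nat) : set (set Omega) :=
  past z act t `|` [set E | exists2 B, measurable B & E = z t @^-1` B].

(* [ip_fresh] says that the pairs are i.i.d. with law [D], each being moreover
   independent of the earlier actions.  [ip_draw] says that, conditionally on
   the earlier rounds and on the current pair, action [a] is drawn with the
   probability prescribed by the algorithm (which depends only on the history
   and on the current context). *)
Record interaction (pol : Pi -> X -> 'I_K) (amo : seq (X * K.-tuple R) -> Pi)
    (delta : R) (pi0 : Pi)
    (D : probability (X * K.-tuple R)%type R) (P : probability Omega R)
    (z : nat -> Omega -> X * K.-tuple R) (act : nat -> Omega -> 'I_K) : Prop :=
  Interaction {
    ip_meas_pair : forall t, measurable_fun setT (z t);
    ip_meas_act : forall t a, measurable (act t @^-1` [set a]);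
    ip_fresh : forall t E B, <<s past z act t >> E -> measurable B ->
      P (E `&` z t @^-1` B) = (P E * D B)%E;
    ip_draw : forall t E a, <<s past_and_current z act t >> E ->
      P (E `&` act t @^-1` [set a]) =
      (\int[P]_(w in E)
         (run_prob pol amo delta pi0 (z ^~ w) (act ^~ w) t a)%:E)%E }.

End Probability.

(* The factors suppressed by the soft-O notation, with [v] standing for
   ln (|Pi| / delta); a soft-O bound allows any fixed power of [polylog].  The
   ones keep the factors at least 1 for small arguments. *)
Definition polylog {R : realType} (K T : nat) (v : R) : R :=
  (1 + ln T%:R) * (1 + ln K%:R) * (1 + ln (1 + v)).

(* Main.v *)
(** Put L_m = ln(16 tau_m^2 |Pi| / delta).  A coordinate update lowers by at
    least mu/8 the potential phi(Q), which is the mean over the contexts of the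
    history of the relative entropy of the uniform distribution to Q^mu, divided
    by 1 - K mu, plus sum_pi Q(pi) b_pi / (2K) and a correction sum_pi Q(pi) - 1;
    the rescaling step does not increase phi, and phi >= 0.  Hence each call
    halts, and the updates of all epochs are paid for by the growth of
    Phi = tau mu phi between epochs, every update being worth at least
    tau mu^2 / 8 = L_m / (8K) once mu_m < 1/(2K); before that Q stays 0 and there
    are no updates.  Between epochs the entropy part of Phi grows by
    O(mu ln(T) (tau_(m+1) - tau_m)).  The regret part grows by the
    increase of the best cumulative estimated reward, minus the estimated reward
    collected in the epoch by the weights actually played; summed over epochs
    this telescopes to a regret of the algorithm, up to estimation errors.

    With probability 1 - delta that regret is O(K sum_m mu_m (tau_(m+1) - tau_m))
    up to logarithms: exponential supermartingales bound the deviations of the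
    estimates by their conditional variances E_D[1/Q^mu(pi(x)|x)], and these are at
    most 6 times their empirical counterparts plus 8K, uniformly in Q, by a union
    bound over the empirical distributions of about 1/mu draws from Pi (Maurey's
    sampling argument).  Since mu_m is about sqrt(L_m / (K tau_m)), the
    total number of updates is of order sqrt(K T / ln(|Pi|/delta)) up to
    logarithms, and there are at most sqrt(T) epochs because tau_m >= m^2. *)

(* The factor [tau mu] in Phi undoes the normalisation of [b_pi]: the regret part of Phi becomes a
   difference of cumulative estimated rewards over 200 K, in which neither [mu] nor [tau] appears,
   and this is why it telescopes although both change. The deviation bound is circular: coordinate
   descent controls the variances only through estimated regrets of earlier epochs, which themselves
   deviate. The size of psi breaks the circle: true regret re-enters its own bound with the
   coefficient 6 * 2 / psi = 12/100, small enough for a strong induction over epochs. Every epoch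
   costs two oracle calls even without any update. These at most 2 sqrt T calls fit the bound
   sqrt(KT/v) only up to a factor sqrt(v/K), whence the condition [v <= K polylog^j] in the
   statement. The law of the actions is given by integrals of the algorithm's own probabilities.
   Hence the run, with its a priori unbounded loop, has to be measurable, and the exponential
   processes have to be defined for all outcomes: rewards are clamped, and the processes are killed
   where the state is not valid. *)
Require Import Defs.
From HB Require Import structures.
From mathcomp Require Import all_boot all_order all_algebra.
From mathcomp Require Import all_classical all_reals all_analysis.
From mathcomp Require Import measurable_realfun measurable_fun_approximation simple_functions.
From mathcomp Require Import zify ring lra.
Import Order.TTheory GRing.Theory Num.Theory numFieldNormedType.Exports.

Local Open Scope classical_set_scope.
Local Open Scope ring_scope.

Set Implicit Arguments.
Unset Strict Implicit.
Unset Printing Implicit Defensive.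

(** * Supermartingale bounds for the interaction *)

Section density.
Local Open Scope ereal_scope.
Context d (T : measurableType d) (R : realType).
Variables (m1 m2 : {measure set T -> \bar R}) (h : T -> R).
Hypothesis (h0 : forall x, (0 <= h x)%R) (mh : measurable_fun setT h).
Hypothesis hE : forall E, measurable E -> m1 E = \int[m2]_(x in E) (h x)%:E.

Import HBNNSimple.

(** Monotone convergence from simple functions. The laws of the interaction are given on events
    only; this carries them over to integrands. *)
Lemma ge0_integral_density (f : T -> \bar R) : measurable_fun setT f ->
  (forall x, 0 <= f x) -> \int[m1]_x f x = \int[m2]_x (f x * (h x)%:E).
Proof.
move=> mf f0; pose f_ := nnsfun_approx measurableT mf.
transitivity (limn (fun n => \int[m1]_x (f_ n x)%:E)).
  rewrite -monotone_convergence//.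
  - apply: eq_integral => y _; apply/esym/cvg_lim => //.
    exact: cvg_nnsfun_approx.
  - by move=> n; exact/measurable_EFinP/measurable_funP.
  - by move=> n y _; rewrite lee_fin.
  - by move=> y _ m n mn; rewrite lee_fin; exact/lefP/nd_nnsfun_approx.
rewrite [X in limn X](_ : _ = (fun n => \int[m2]_x ((f_ n x)%:E * (h x)%:E))).
  rewrite -monotone_convergence//; last 3 first.
    - move=> n /=; apply: emeasurable_funM; exact/measurable_EFinP.
    - by move=> n x _ /=; rewrite mule_ge0// lee_fin.
    - move=> x _ m n mn; apply: lee_wpmul2r; rewrite ?lee_fin//.
      exact/lefP/nd_nnsfun_approx.
  apply: eq_integral => x _ /=; apply/cvg_lim => //.
  by apply: cvgeZr => //; exact: cvg_nnsfun_approx.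
apply/funext => n.
transitivity (\sum_(k \in range (f_ n))
    \int[m2]_x ((k * \1_(f_ n @^-1` [set k]) x)%:E * (h x)%:E)).
  under eq_integral do rewrite fimfunE -fsumEFin//.
  rewrite ge0_integral_fsum//; last 2 first.
  - by move=> y; exact/measurable_EFinP/measurable_funM.
  - by move=> y x _; rewrite nnfun_muleindic_ge0.
  apply: eq_fsbigr => r _; rewrite integralZl_indic_nnsfun// integral_indic//=.
  have [r0|r0] := ltP r 0%R.
    by rewrite preimage_nnfun0// set0I measure0 mule0 integral0_eq// => x _; rewrite indic0 mulr0 mul0e.
  under eq_integral do rewrite EFinM -muleA.
  rewrite ge0_integralZl//; last 2 first.
  - by apply: emeasurable_funM; exact/measurable_EFinP.
  - by move=> x _; rewrite mule_ge0// lee_fin.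
  rewrite setIT hE//; congr (_ * _).
  rewrite [LHS]integral_mkcond; apply: eq_integral => x _.
  by rewrite patchE indicE; case: ifPn => _; rewrite ?mul1e ?mul0e.
rewrite -ge0_integral_fsum//.
- apply: eq_integral => x _; rewrite [in RHS]fimfunE -fsumEFin//.
  rewrite ge0_mule_fsuml// => r; exact: nnfun_muleindic_ge0.
- move=> r; apply: emeasurable_funM; last exact/measurable_EFinP.
  exact/measurable_EFinP/measurable_funM.
- move=> r x _; apply: mule_ge0; last by rewrite lee_fin.
  exact: nnfun_muleindic_ge0.
Qed.

End density.

Lemma measurable_boolset d (T : measurableType d) (b : T -> bool) :
  measurable_fun setT b -> measurable [set x | b x].
Proof. by move=> mb; rewrite -[X in measurable X]setTI; exact: (mb _ [set true]). Qed.

Section one_step.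
Context dO (Omega : measurableType dO) dY (Y : measurableType dY) (R : realType).
Variables (K : nat) (P : probability Omega R) (D : probability Y R).
Variables (past : set (set Omega)) (zt : Omega -> Y) (at_ : Omega -> 'I_K).
Variable (q : Omega -> Y -> 'I_K -> R).
Let cur : set (set Omega) :=
  past `|` [set E | exists2 B, measurable B & E = zt @^-1` B].
Hypothesis past_meas : past `<=` measurable.
Hypothesis mz : measurable_fun setT zt.
Hypothesis ma : forall a, measurable (at_ @^-1` [set a]).
Hypothesis fresh : forall E B, <<s past >> E -> measurable B ->
  P (E `&` zt @^-1` B) = (P E * D B)%E.
Hypothesis draw : forall E a, <<s cur >> E ->
  P (E `&` at_ @^-1` [set a]) = (\int[P]_(w in E) (q w (zt w) a)%:E)%E.

Notation OmegaP := (g_sigma_algebraType past).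
Notation OmegaC := (g_sigma_algebraType cur).

Lemma in_preim a w : (w \in at_ @^-1` [set a]) = (at_ w == a).
Proof. by apply/idP/eqP => [|e]; rewrite inE. Qed.

Lemma g_sigma_meas (G : set (set Omega)) : G `<=` measurable ->
  measurable_fun setT (idfun : Omega -> g_sigma_algebraType G).
Proof.
move=> Gm _ E mE; rewrite setTI; suff : <<s G >> `<=` @measurable _ Omega by apply.
apply: smallest_sub => //; exact: sigma_algebra_measurable.
Qed.

Lemma cur_meas : cur `<=` measurable.
Proof.
move=> E [/past_meas//|[B mB ->]]; rewrite -[X in measurable X]setTI; exact: mz.
Qed.

Lemma pair_meas : measurable_fun setT (fun w : OmegaC => ((w : OmegaP), zt w)).
Proof.
apply/measurable_fun_pair => /=.
- move=> _ E mE; rewrite setTI; suff : <<s past >> `<=` <<s cur >> by apply.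
  apply: smallest_sub; first exact: smallest_sigma_algebra.
  by move=> A pA; apply: sub_sigma_algebra; left.
- move=> _ E mE; rewrite setTI; apply: sub_sigma_algebra; right; by exists E.
Qed.

(** The identity onto a coarser sigma-algebra: [distribution P (mid mG)] is [P] restricted to that
    sigma-algebra. *)
Definition mid (G : set (set Omega)) (mG : G `<=` measurable) :
    {mfun Omega >-> g_sigma_algebraType G} :=
  HB.pack (idfun : Omega -> g_sigma_algebraType G)
    (isMeasurableFun.Build _ _ _ _ _ (g_sigma_meas mG)).

(** By [draw], the restriction of [P] to the event that [a] is drawn has density [qa] on the
    sigma-algebra of [cur]. The sign of [qa] is known only where [h] is positive, so the density
    used is its positive part. *)
Lemma draw_step (a : 'I_K) (h qa : Omega -> R) :
  measurable_fun (setT : set OmegaC) h ->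
  measurable_fun (setT : set OmegaC) qa ->
  (forall w, 0 <= h w) -> (forall w, 0 <= h w * qa w) ->
  (forall w, qa w = q w (zt w) a) ->
  (\int[P]_w (h w * (at_ w == a)%:R)%:E = \int[P]_w (h w * qa w)%:E)%E.
Proof.
move=> mh mqa h0 hqa0 qaE.
have mid1 := g_sigma_meas cur_meas.
have mh' : measurable_fun setT (h : Omega -> R) by exact: measurableT_comp mh mid1.
have mqa' : measurable_fun setT (qa : Omega -> R) by exact: measurableT_comp mqa mid1.
unshelve refine (let m1 : {measure set OmegaC -> \bar R} :=
  pushforward (mrestr P (ma a)) (idfun : Omega -> OmegaC) in _); first exact: mid1.
pose m2 := distribution P (mid cur_meas).
have E1 : (\int[m1]_w (h w)%:E = \int[P]_w (h w * (at_ w == a)%:R)%:E)%E.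
  rewrite (@ge0_integral_pushforward _ _ Omega OmegaC R idfun mid1 (mrestr P (ma a)) setT
    (EFin \o h)) //=; last 2 first.
  - exact/measurable_EFinP.
  - by move=> w _ /=; rewrite lee_fin.
  rewrite preimage_setT (@ge0_integral_density _ Omega R _ P (fun w => (at_ w == a)%:R)) //.
  - rewrite (_ : (fun w => _) = \1_(at_ @^-1` [set a])) //.
    by apply/funext => w; rewrite indicE in_preim.
  - move=> E mE; rewrite -[LHS]/(P (E `&` at_ @^-1` [set a])) setIC -integral_indic//.
    by apply: eq_integral => w _; rewrite indicE in_preim.
  - exact/measurable_EFinP.
have mmax : measurable_fun (setT : set OmegaC) (fun w => Num.max 0 (qa w)).
  exact: measurable_maxr.
have meas E : <<s cur >> E -> measurable (E : set Omega).
  by move=> cE; have := mid1 measurableT E cE; rewrite setTI.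
rewrite -E1 (@ge0_integral_density _ OmegaC R m1 m2 (fun w => Num.max 0 (qa w))) //.
- rewrite ge0_integral_distribution; last 2 first.
  + apply: emeasurable_funM; exact/measurable_EFinP.
  + by move=> w; rewrite mule_ge0// lee_fin// le_max lexx.
  apply: eq_integral => w _ /=; rewrite -EFinM; congr (_%:E).
  have [qw|qw] := leP 0 (qa w); first by [].
  have := hqa0 w; have := h0 w; rewrite le_eqVlt => /orP[/eqP <-|hw]; first by rewrite !mul0r.
  by rewrite pmulr_rge0// leNgt qw.
- by move=> w; rewrite le_max lexx.
- move=> E mE; rewrite /m1 /pushforward /= /mrestr.
  rewrite [RHS]ge0_integral_pushforward //; last 2 first.
  + apply/measurable_EFinP; exact: measurable_funTS.
  + by move=> w _; rewrite lee_fin le_max lexx.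
  have mEO := meas _ mE.
  pose N := E `&` [set w | 0 <= qa w]; pose M := E `&` [set w | qa w < 0].
  have mN : <<s cur >> N.
    apply: (@measurableI _ OmegaC) => //.
    by apply: (@measurable_boolset _ OmegaC); exact: measurable_fun_ler.
  have mM : <<s cur >> M.
    apply: (@measurableI _ OmegaC) => //.
    by apply: (@measurable_boolset _ OmegaC); exact: measurable_fun_ltr.
  have EE : E = N `|` M.
    by rewrite -setIUr; apply/seteqP; split=> [w Ew|w []//]; split=> //=; case: (leP 0 (qa w)) => ?; [left|right].
  (* [draw] equates this probability with the integral of a negative function over [M], so both
     vanish. *)
  have PM : P (M `&` at_ @^-1` [set a]) = 0%E.
    apply/eqP; rewrite eq_le measure_ge0 andbT draw//.
    under eq_integral do rewrite -[q _ _ _]opprK EFinN.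
    have q0 w : M w -> (0 <= (- q w (zt w) a)%:E)%E.
      by move=> [_ /= qw]; rewrite lee_fin -qaE; lra.
    by rewrite integral_ge0N// oppe_le0; exact: integral_ge0.
  rewrite -[LHS]/(P (E `&` at_ @^-1` [set a])) {1}EE setIUl measureU //; first last.
  + by apply/seteqP; split=> // w [[[_ /= h1] _] [[_ /= h2] _]]; move: h2; rewrite ltNge h1.
  + apply: measurableI => //; exact: meas.
  + apply: measurableI => //; exact: meas.
  rewrite [X in (_ + X)%E](_ : _ = 0%E); last exact: PM.
  rewrite adde0; transitivity (\int[P]_(w in N) (q w (zt w) a)%:E)%E; first exact: draw.
  rewrite [LHS]integral_mkcond [RHS]integral_mkcond.
  apply: eq_integral => w _ /=; rewrite !patchE; case: ifPn => [|].
    by rewrite inE => -[Ew /= q0]; rewrite mem_set//= max_r ?qaE// -qaE.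
  move=> nN; case: ifPn => // /set_mem Ew; rewrite /= max_l//.
  by case: (leP 0 (qa w)) => [q0|/ltW//]; move: nN; rewrite mem_set.
- exact/measurable_EFinP.
Qed.

(** By [fresh] the joint law of the past and the new pair agrees with the product measure on
    rectangles, hence everywhere; Tonelli does the rest. *)
Lemma fresh_step (F : OmegaP * Y -> R) : measurable_fun setT F ->
  (forall x, 0 <= F x) ->
  (\int[P]_w (F ((w : OmegaP), zt w))%:E = \int[P]_w \int[D]_y (F ((w : OmegaP), y))%:E)%E.
Proof.
move=> mF F0.
have mpair : measurable_fun setT (fun w : Omega => ((w : OmegaP), zt w)).
  by apply/measurable_fun_pair => //=; exact: g_sigma_meas.
pose pr : {mfun Omega >-> (OmegaP * Y)%type} :=
  HB.pack (fun w : Omega => ((w : OmegaP), zt w))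
    (isMeasurableFun.Build _ _ _ _ _ mpair).
pose PP := distribution P (mid past_meas).
have mEF : measurable_fun setT (EFin \o F) by exact/measurable_EFinP.
have EF0 x : (0 <= (EFin \o F) x)%E by rewrite /= lee_fin.
transitivity (\int[distribution P pr]_x (EFin \o F) x)%E.
  by rewrite ge0_integral_distribution.
rewrite (eq_measure_integral (PP \x D)%E); last first.
  move=> A mA _; apply/esym; apply: product_measure_unique mA => B C mB mC.
  by rewrite -[LHS]/(P (B `&` zt @^-1` C)) fresh.
rewrite [LHS](@fubini_tonelli1 _ _ _ _ R PP D (EFin \o F) mEF EF0).
rewrite [LHS]ge0_integral_distribution//.
  exact: (@measurable_fun_fubini_tonelli_F _ _ _ _ R D (EFin \o F) mEF EF0).
by move=> y; apply: integral_ge0.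
Qed.

(** Splitting over the drawn action reduces to [draw_step], which integrates out the action;
    [fresh_step] then integrates out the pair. *)
Lemma one_step (f : Omega -> Y -> 'I_K -> R) :
  (forall a, measurable_fun setT (fun x : OmegaP * Y => f x.1 x.2 a)) ->
  (forall a, measurable_fun setT (fun x : OmegaP * Y => q x.1 x.2 a)) ->
  (forall w y a, 0 <= f w y a) -> (forall w y a, 0 <= f w y a * q w y a) ->
  (\int[P]_w (f w (zt w) (at_ w))%:E =
   \int[P]_w \int[D]_y (\sum_a f w y a * q w y a)%:E)%E.
Proof.
move=> mf mq f0 fq0.
have mc (g : OmegaP * Y -> R) : measurable_fun setT g ->
    measurable_fun (setT : set OmegaC) (fun w => g ((w : OmegaP), zt w)).
  by move=> mg; exact: measurableT_comp mg pair_meas.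
have mid1 := g_sigma_meas cur_meas.
have mcO (g : OmegaP * Y -> R) : measurable_fun setT g ->
    measurable_fun (setT : set Omega) (fun w => g ((w : OmegaP), zt w)).
  by move=> /mc mg; exact: measurableT_comp mg mid1.
transitivity (\int[P]_w (\sum_a (f w (zt w) a * q w (zt w) a))%:E)%E; last first.
  rewrite (fresh_step (F := fun x => \sum_a (f x.1 x.2 a * q x.1 x.2 a)))//.
  - by apply: measurable_sum => a; exact: measurable_funM.
  - by move=> x; apply: sumr_ge0.
transitivity (\int[P]_w (\sum_a (f w (zt w) a * (at_ w == a)%:R)%:E))%E.
  apply: eq_integral => w _; rewrite sumEFin (bigD1 (at_ w))//= eqxx mulr1 big1 ?addr0// => a.
  by rewrite eq_sym => /negbTE ->; rewrite mulr0.
rewrite ge0_integral_sum//; last 2 first.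
- move=> a; apply/measurable_EFinP; apply: measurable_funM; first exact: (mcO _ (mf a)).
  rewrite (_ : (fun w => _) = \1_(at_ @^-1` [set a])) //.
  by apply/funext => w; rewrite indicE in_preim.
- by move=> a w _; rewrite lee_fin mulr_ge0.
under [RHS]eq_integral do rewrite -sumEFin.
rewrite ge0_integral_sum//; last 2 first.
- move=> a; apply/measurable_EFinP; apply: (mcO (fun x => f x.1 x.2 a * q x.1 x.2 a)).
  exact: measurable_funM.
- by move=> a w _; rewrite lee_fin.
apply: eq_bigr => a _; apply: draw_step => //.
- exact: (mc _ (mf a)).
- exact: (mc _ (mq a)).
Qed.

End one_step.

Section supermartingale.
Context dO (Omega : measurableType dO) dX (X : measurableType dX) (R : realType).
Variables (K : nat) (P : probability Omega R).
Notation Y := (X * K.-tuple R)%type.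
Variables (D : probability Y R).
Variables (z : nat -> Omega -> Y) (act : nat -> Omega -> 'I_K).
Variable (q : nat -> Omega -> Y -> 'I_K -> R).
Hypothesis mz : forall t, measurable_fun setT (z t).
Hypothesis ma : forall t a, measurable (act t @^-1` [set a]).
Hypothesis fresh : forall t E B, <<s past z act t >> E -> measurable B ->
  P (E `&` z t @^-1` B) = (P E * D B)%E.
Hypothesis draw : forall t E a, <<s past_and_current z act t >> E ->
  P (E `&` act t @^-1` [set a]) = (\int[P]_(w in E) (q t w (z t w) a)%:E)%E.

Notation OmegaP t := (g_sigma_algebraType (past z act t)).

Lemma past_measurable t : past z act t `<=` measurable.
Proof.
move=> E [i it [[B mB ->]|[a ->]]] //.
by rewrite -[X in measurable X]setTI; exact: mz.
Qed.

Lemma past_id n m : (n <= m)%N ->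
  measurable_fun (setT : set (OmegaP m)) (fun w : OmegaP m => (w : OmegaP n)).
Proof.
move=> nm _ E mE; rewrite setTI; suff : <<s past z act n >> `<=` <<s past z act m >> by apply.
apply: smallest_sub; first exact: smallest_sigma_algebra.
move=> A [i it HA]; apply: sub_sigma_algebra; exists i => //; exact: leq_trans nm.
Qed.

Lemma past_z n m : (n < m)%N -> measurable_fun (setT : set (OmegaP m)) (z n).
Proof.
move=> nm _ E mE; rewrite setTI; apply: sub_sigma_algebra; exists n => //.
by left; exists E.
Qed.

Lemma past_act n m a : (n < m)%N -> measurable (act n @^-1` [set a] : set (OmegaP m)).
Proof. by move=> nm; apply: sub_sigma_algebra; exists n => //; right; exists a. Qed.

Lemma past_adapted n m (g : Omega -> Y -> 'I_K -> R) : (n < m)%N ->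
  (forall a, measurable_fun setT (fun x : OmegaP n * Y => g x.1 x.2 a)) ->
  measurable_fun (setT : set (OmegaP m)) (fun w => g w (z n w) (act n w)).
Proof.
move=> nm mg.
rewrite (_ : (fun w => _) = fun w => \sum_a \1_(act n @^-1` [set a]) w * g w (z n w) a); last first.
  apply/funext => w; rewrite (bigD1 (act n w))//= big1 ?addr0.
    by rewrite indicE in_preim eqxx mul1r.
  by move=> a; rewrite indicE in_preim eq_sym => /negbTE ->; rewrite mul0r.
apply: measurable_sum => a; apply: measurable_funM.
  by apply: measurable_indic; exact: past_act.
have mp : measurable_fun setT (fun w : OmegaP m => ((w : OmegaP n), z n w)).
  apply/measurable_fun_pair => /=; first exact: past_id (ltnW nm).
  exact: past_z.
exact: (measurableT_comp (mg a) mp).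
Qed.

Variables (V : nat -> Omega -> bool) (U : nat -> Omega -> Y -> 'I_K -> R).
Variables (c : nat -> Omega -> R) (N : nat).
Hypothesis mV : forall n, (n < N)%N -> measurable_fun (setT : set (OmegaP n)) (V n).
Hypothesis mc : forall n, (n < N)%N -> measurable_fun (setT : set (OmegaP n)) (c n).
Hypothesis mq : forall n a, (n < N)%N ->
  measurable_fun setT (fun x : OmegaP n * Y => q n x.1 x.2 a).
Hypothesis mU : forall n a, (n < N)%N ->
  measurable_fun setT (fun x : OmegaP n * Y => U n x.1 x.2 a).
Hypothesis q0 : forall n w y a, (n < N)%N -> V n w -> 0 <= q n w y a.
Hypothesis HU : forall n w, (n < N)%N -> V n w ->
  (\int[D]_y (\sum_a q n w y a * expR (U n w y a))%:E <= (expR (c n w))%:E)%E.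

Let g n w y a := (V n w)%:R * expR (U n w y a - c n w).
Let W n w := \prod_(i < n) g i w (z i w) (act i w).

Let g_ge0 n w y a : 0 <= g n w y a.
Proof. by rewrite /g mulr_ge0// expR_ge0. Qed.

Let W_ge0 n w : 0 <= W n w.
Proof. by apply: prodr_ge0 => i _; exact: g_ge0. Qed.

Let mg n a : (n < N)%N -> measurable_fun setT (fun x : OmegaP n * Y => g n x.1 x.2 a).
Proof.
move=> nN; rewrite /g; apply: measurable_funM.
  rewrite (_ : (fun x => _) = \1_[set x : OmegaP n * Y | V n x.1]); last first.
    by apply/funext => x; rewrite indicE; congr (nat_of_bool _)%:R; apply/idP/idP; rewrite inE.
  apply: measurable_indic; apply: measurable_boolset.
  exact: (measurableT_comp (mV nN) measurable_fst).
apply: measurableT_comp => //; apply: measurable_funB; first exact: mU.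
exact: (measurableT_comp (mc nN) measurable_fst).
Qed.

Let mW n : (n <= N)%N -> measurable_fun (setT : set (OmegaP n)) (W n).
Proof.
move=> nN; apply: measurable_prod => i _.
apply: (@past_adapted i n (g i)) => // a; apply: mg; exact: leq_trans nN.
Qed.

(** Where [V n] holds, the conditional mean of the next factor is at most
    [expR (c n w) * expR (- c n w) = 1]; elsewhere the factor is zero. *)
Let EW n : (n <= N)%N -> (\int[P]_w (W n w)%:E <= 1)%E.
Proof.
elim: n => [_|n IH nN].
  under eq_integral do rewrite /W big_ord0.
  by rewrite integral_cst// mul1e probability_le1.
have {}IH := IH (ltnW nN).
have E w : (W n.+1 w)%:E = (W n w * g n w (z n w) (act n w))%:E.
  by rewrite /W big_ord_recr.
under eq_integral do rewrite E.
have F0 w y a : 0 <= W n w * g n w y a * q n w y a.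
  rewrite /g; case Vw : (V n w); last by rewrite !mul0r mulr0 mul0r.
  by rewrite !mulr_ge0// ?expR_ge0// q0.
have mF : measurable_fun setT (fun x : OmegaP n * Y =>
    \sum_a W n x.1 * g n x.1 x.2 a * q n x.1 x.2 a).
  apply: measurable_sum => a; apply: measurable_funM; last exact: mq.
  apply: measurable_funM; last exact: mg.
  exact: (measurableT_comp (mW (ltnW nN)) measurable_fst).
have sec (F : OmegaP n * Y -> R) w : measurable_fun setT F ->
    measurable_fun setT (fun y => F (w, y)).
  move=> mF'; apply: (measurableT_comp mF'); exact/measurable_fun_pair.
rewrite (@one_step _ _ _ _ _ _ P D _ _ _ (q n) (past_measurable (t:=n)) (mz n) (ma n)
  (@fresh n) (@draw n) (fun w y a => W n w * g n w y a)); first last.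
- exact: F0.
- by move=> w y a; rewrite mulr_ge0.
- by move=> a; exact: mq.
- move=> a; apply: measurable_funM; last exact: mg.
  exact: (measurableT_comp (mW (ltnW nN)) measurable_fst).
apply: le_trans IH; apply: ge0_le_integral => //.
- by move=> w _; apply: integral_ge0 => y _; rewrite lee_fin sumr_ge0.
- have H : measurable_fun setT (fun w : OmegaP n =>
      (\int[D]_y (\sum_a W n w * g n w y a * q n w y a)%:E)%E).
    apply: (@measurable_fun_fubini_tonelli_F _ _ (OmegaP n) Y R D
      (fun x => (\sum_a W n x.1 * g n x.1 x.2 a * q n x.1 x.2 a)%:E)).
      exact/measurable_EFinP.
    by move=> x; rewrite lee_fin sumr_ge0.
  exact: (measurableT_comp H (g_sigma_meas (past_measurable (t:=n)))).
- by apply/measurable_EFinP; exact: measurableT_comp (mW (ltnW nN)) (g_sigma_meas (past_measurable (t:=n))).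
- move=> w _; case Vw : (V n w); last first.
    rewrite integral0_eq ?lee_fin// => y _; rewrite big1// => a _.
    by rewrite /g Vw mul0r mulr0 mul0r.
  have -> : (fun y => (\sum_a W n w * g n w y a * q n w y a)%:E) =
      (fun y => (W n w * expR (- c n w))%:E * (\sum_a q n w y a * expR (U n w y a))%:E)%E.
    apply/funext => y; rewrite -EFinM mulr_sumr; congr (_%:E); apply: eq_bigr => a _.
    by rewrite /g Vw mul1r expRD; ring.
  rewrite ge0_integralZl//; last 3 first.
  + apply/measurable_EFinP.
    apply: (sec (fun x => \sum_a q n x.1 x.2 a * expR (U n x.1 x.2 a))).
    apply: measurable_sum => a; apply: measurable_funM; first exact: mq.
    by apply: measurableT_comp => //; exact: mU.
  + by move=> y _; rewrite lee_fin sumr_ge0// => a _; rewrite mulr_ge0 ?expR_ge0 ?q0.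
  + by rewrite lee_fin mulr_ge0 ?expR_ge0.
  apply: (@le_trans _ _ ((W n w * expR (- c n w))%:E * (expR (c n w))%:E)%E).
    by apply: lee_wpmul2l; rewrite ?lee_fin ?mulr_ge0 ?expR_ge0//; exact: HU.
  by rewrite -EFinM lee_fin -mulrA -expRD addNr expR0 mulr1.
Qed.

(** Markov's inequality for [W N]. The event [E] is exactly [expR l < W N], because [W N] vanishes
    as soon as some [V n] fails. *)
Lemma supermartingale_tail (l : R) :
  let E := [set w | (forall n, (n < N)%N -> V n w) /\
    l < \sum_(n < N) (U n w (z n w) (act n w) - c n w)] in
  measurable E /\ (P E <= (expR (- l))%:E)%E.
Proof.
move=> E.
have EE : E = [set w | expR l < W N w].
  apply/seteqP; split=> w /=.
    move=> [Vw lw]; suff -> : W N w = expR (\sum_(n < N) (U n w (z n w) (act n w) - c n w)).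
      by rewrite ltr_expR.
    rewrite expR_sum; apply: eq_bigr => i _.
    by rewrite /g Vw// mul1r.
  move=> lW.
  have Vw n : (n < N)%N -> V n w.
    move=> nN; apply: contraLR lW => /negbTE Vn; rewrite -leNgt.
    by rewrite /W (bigD1 (Ordinal nN))//= /g Vn !mul0r expR_ge0.
  split=> //; rewrite -ltr_expR expR_sum; apply: lt_le_trans lW _.
  rewrite le_eqVlt; apply/orP; left; apply/eqP; apply: eq_bigr => i _.
  by rewrite /g Vw// mul1r.
have mWN : measurable_fun setT (W N).
  exact: measurableT_comp (mW (leqnn N)) (g_sigma_meas (past_measurable (t:=N))).
have mE : measurable E.
  by rewrite EE; apply: measurable_boolset; exact: measurable_fun_ltr.
split=> //; rewrite -[X in (X <= _)%E]mule1 -[1%E](_ : (expR (- l))%:E * (expR l)%:E = 1)%E; last first.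
  by rewrite -EFinM -expRD addNr expR0.
rewrite muleC -muleA -[leRHS]mule1; apply: lee_wpmul2l; first by rewrite lee_fin expR_ge0.
apply: le_trans (EW (leqnn N)).
rewrite -(setIT E) -integral_indic// -ge0_integralZl//; last first.
  by apply/measurable_EFinP; exact: measurable_indic.
apply: ge0_le_integral => //.
- by apply/measurable_EFinP; apply: measurable_funM => //; exact: measurable_indic.
- exact/measurable_EFinP.
- move=> w _; rewrite -EFinM lee_fin indicE; case: (boolP (w \in E)) => [|_]; last by rewrite mulr0.
  by rewrite EE inE mulr1 => /ltW.
Qed.

End supermartingale.

(** * Measurability of the run *)

Section measurable_tools.
Context d (S : measurableType d) (R : realType).

Lemma measurable_finsel (I : finType) (b : S -> I) (F : S -> I -> R) :
  (forall i, measurable (b @^-1` [set i])) ->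
  (forall i, measurable_fun setT (F ^~ i)) ->
  measurable_fun setT (fun s => F s (b s)).
Proof.
move=> mb mF.
rewrite (_ : (fun s => _) = fun s => \sum_i \1_(b @^-1` [set i]) s * F s i); last first.
  apply/funext => s; rewrite (bigD1 (b s))//= big1 ?addr0.
    by rewrite indicE mem_set// mul1r.
  by move=> i ib; rewrite indicE memNset ?mul0r//= => e; rewrite e eqxx in ib.
by apply: measurable_sum => i; apply: measurable_funM; first exact: measurable_indic.
Qed.

Lemma measurable_natsel (b : S -> nat) (F : nat -> S -> R) :
  (forall i, measurable (b @^-1` [set i])) ->
  (forall i, measurable_fun setT (F i)) ->
  measurable_fun setT (fun s => F (b s) s).
Proof.
move=> mb mF _ B mB; rewrite setTI.
rewrite (_ : _ @^-1` B = \bigcup_i (b @^-1` [set i] `&` F i @^-1` B)); last first.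
  apply/seteqP; split=> s /=; first by move=> HB; exists (b s).
  by move=> [i _ [/= <-]].
apply: bigcup_measurable => i _; apply: measurableI => //.
by rewrite -[X in measurable X]setTI; exact: mF.
Qed.

Lemma meas_cst_fin (I : eqType) (a : I) : forall i, measurable ((fun _ : S => a) @^-1` [set i]).
Proof.
move=> b; rewrite (_ : _ @^-1` _ = if a == b then setT else set0); first by case: ifP.
by case: eqP => [->|ab]; apply/seteqP; split.
Qed.

Lemma measurable_if0 (b : S -> bool) (f g : S -> R) :
  measurable [set s | b s] -> measurable_fun setT f -> measurable_fun setT g ->
  measurable_fun setT (fun s => if b s then f s else g s).
Proof.
move=> mb mf mg; apply: measurable_fun_ifT => //.
apply: (measurable_fun_bool true) => //; by rewrite setTI.
Qed.

(** Away from 0 the inverse is the exponential of minus a logarithm, up to sign; the inverse of 0 is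
    0. *)
Lemma measurable_funV (f : S -> R) : measurable_fun setT f ->
  measurable_fun setT (fun s => (f s)^-1).
Proof.
move=> mf.
have mln (g : S -> R) : measurable_fun setT g ->
    measurable_fun setT (fun s => expR (- ln (g s))).
  move=> mg; apply: measurableT_comp => //; apply: measurableT_comp => //.
  exact: (measurableT_comp (@measurable_ln R) mg).
rewrite (_ : (fun s => _) = fun s => if 0 < f s then expR (- ln (f s)) else
    if f s < 0 then - expR (- ln (- f s)) else 0).
  apply: measurable_if0; [| |apply: measurable_if0 => //].
  - by apply: measurable_boolset; exact: measurable_fun_ltr.
  - exact: mln.
  - by apply: measurable_boolset; exact: measurable_fun_ltr.
  - apply: measurableT_comp => //; apply: mln; exact: measurableT_comp.
apply/funext => s; rewrite !expRN.
have [f0|f0|<-] := ltgtP 0 (f s).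
- by rewrite lnK ?posrE.
- by rewrite lnK ?posrE ?oppr_gt0// invrN opprK.
- by rewrite invr0.
Qed.

Lemma measurable_exists (I : finType) (b : I -> S -> bool) :
  (forall i, measurable [set s | b i s]) -> measurable [set s | [exists i, b i s]].
Proof.
move=> mb; rewrite (_ : [set s | _] = \big[setU/set0]_(i <- enum I) [set s | b i s]).
  exact: bigsetU_measurable.
rewrite -bigcup_seq; apply/seteqP; split=> s /=.
  by move=> /existsP[i bi]; exists i => //=; rewrite mem_enum.
by move=> [i _ bi]; apply/existsP; exists i.
Qed.

End measurable_tools.

Section run_measurable.
Context d (S : measurableType d) (R : realType) (K : nat) dX (X : measurableType dX).
Context (Pi : finType).
Notation Y := (X * K.-tuple R)%type.
Variables (pol : Pi -> X -> 'I_K) (amo : seq Y -> Pi).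
Hypothesis mpol : forall pi a, measurable (pol pi @^-1` [set a]).
Hypothesis mamo : measurable_AMO amo.
Variables (z : nat -> S -> Y) (act : nat -> S -> 'I_K).

Notation meas1 f := (measurable_fun setT f).
Notation meas_fin b := (forall i, measurable (b @^-1` [set i])).

(** The recorded probabilities are an arbitrary process [p]: those of the run become known to be
    measurable only in the course of the induction on rounds. *)
Definition mk_hist (p : nat -> S -> R) (n : nat) (s : S) : seq (@obs R K X) :=
  [seq Obs (z i s).1 (act i s) (tnth (z i s).2 (act i s)) (p i s) | i <- iota 0 n].

Lemma mk_histS p n s : mk_hist p n.+1 s =
  rcons (mk_hist p n s) (Obs (z n s).1 (act n s) (tnth (z n s).2 (act n s)) (p n s)).
Proof. by rewrite /mk_hist -cats1 -addn1 iotaD map_cat. Qed.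

Lemma eq_mk_hist p p' n s : (forall i, (i < n)%N -> p i s = p' i s) ->
  mk_hist p n s = mk_hist p' n s.
Proof.
move=> H; apply/eq_in_map => i; rewrite mem_iota add0n => /H -> //.
Qed.

Lemma size_mk_hist p n s : size (mk_hist p n s) = n.
Proof. by rewrite size_map size_iota. Qed.

Lemma measurable_smoothed (w : S -> @weights R Pi) (mu : R) (b : S -> 'I_K) (x : S -> X) :
  (forall pi, meas1 (fun s => w s pi)) -> meas_fin b -> meas1 x ->
  meas1 (fun s => smoothed pol (w s) mu (b s) (x s)).
Proof.
move=> mw mb mx; apply: measurable_funD => //; apply: measurable_funM => //.
apply: (measurable_finsel (F := fun s a => act_weight pol (w s) a (x s))) => // a.
rewrite /act_weight; under eq_fun do rewrite big_mkcond.
apply: measurable_sum => pi; apply: measurable_if0 => //.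
rewrite (_ : [set s | _] = x @^-1` (pol pi @^-1` [set a])).
  by rewrite -[X in measurable X]setTI; exact: mx.
by apply/seteqP; split=> s /eqP.
Qed.

Variables (n : nat) (p : nat -> S -> R).
Hypothesis mz : forall i, (i < n)%N -> meas1 (z i).
Hypothesis mact : forall i, (i < n)%N -> meas_fin (act i).
Hypothesis mp : forall i, (i < n)%N -> meas1 (p i).

Notation H := (mk_hist p n).
Let xx (i : nat) (s : S) := (z i s).1.
Let ob i s := Obs (z i s).1 (act i s) (tnth (z i s).2 (act i s)) (p i s).

Lemma meas_ctx i : (i < n)%N -> meas1 (xx i).
Proof. by move=> /mz mzi; exact: (measurableT_comp measurable_fst mzi). Qed.

Lemma meas_rew i : (i < n)%N -> meas1 (fun s => tnth (z i s).2 (act i s)).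
Proof.
move=> iN; apply: (measurable_finsel (F := fun s a => tnth (z i s).2 a)); first exact: mact.
move=> a; apply: (measurableT_comp (measurable_tnth a)).
exact: (measurableT_comp measurable_snd (mz iN)).
Qed.

Lemma meas_ips i (b : S -> 'I_K) : (i < n)%N -> meas_fin b ->
  meas1 (fun s => ips (ob i s) (b s)).
Proof.
move=> iN mb; rewrite /ips /=; apply: measurable_funM; last first.
  by apply: measurable_funV; exact: mp.
apply: measurable_funM; first exact: meas_rew.
apply: (measurable_finsel (F := fun s a => (a == act i s)%:R)) => // a.
rewrite (_ : (fun s => _) = \1_(act i @^-1` [set a])).
  by apply: measurable_indic; exact: mact.
by apply/funext => s; rewrite indicE eq_sym; congr ((nat_of_bool _)%:R); apply/eqP/idP => [e|]; rewrite inE.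
Qed.

Lemma hist_sum (f : S -> @obs R K X -> R) s :
  \sum_(h <- H s) f s h = \sum_(i < n) f s (ob i s).
Proof. by rewrite big_map -{1}[n]subn0 big_mkord. Qed.

Lemma meas_hist_sum (f : S -> @obs R K X -> R) :
  (forall i, (i < n)%N -> meas1 (fun s => f s (ob i s))) ->
  meas1 (fun s => \sum_(h <- H s) f s h).
Proof.
move=> mf; under eq_fun do rewrite hist_sum.
by apply: measurable_sum => i; exact: mf.
Qed.

Lemma meas_amo (g : S -> @obs R K X -> K.-tuple R) :
  (forall i a, (i < n)%N -> meas1 (fun s => tnth (g s (ob i s)) a)) ->
  meas_fin (fun s => amo [seq (obs_ctx h, g s h) | h <- H s]).
Proof.
move=> mg pi.
pose F s : n.-tuple Y := [tuple (xx i s, g s (ob i s)) | i < n].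
have -> : (fun s => amo [seq (obs_ctx h, g s h) | h <- H s]) = (fun s => amo (F s)).
  apply/funext => s; congr amo; rewrite -map_comp /F /= -val_enum_ord -map_comp.
  by apply: eq_map => i.
have mF : meas1 F.
  apply/measurable_fun_tnthP => i.
  rewrite (_ : _ \o _ = fun s => (xx i s, g s (ob i s))); last first.
    by apply/funext => s /=; rewrite tnth_mktuple.
  apply/measurable_fun_pair => /=; first exact: meas_ctx.
  apply/measurable_fun_tnthP => a; exact: mg.
by have := mF measurableT _ (mamo (n := n) pi); rewrite setTI.
Qed.

Lemma meas_pol pi i : (i < n)%N -> meas_fin (fun s => pol pi (xx i s)).
Proof.
move=> iN a; rewrite -[X in measurable X]setTI.
exact: (meas_ctx iN measurableT (mpol pi a)).
Qed.

Lemma meas_best : meas_fin (fun s => best_policy amo (H s)).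
Proof.
apply: (meas_amo (g := fun s h => [tuple ips h a | a < K])) => i a iN.
under eq_fun do rewrite tnth_mktuple.
apply: meas_ips => //; exact: meas_cst_fin.
Qed.

Lemma meas_emp_reward pi : meas1 (fun s => emp_reward pol (H s) pi).
Proof.
rewrite /emp_reward; under eq_fun do rewrite size_mk_hist.
apply: measurable_funM => //; apply: (meas_hist_sum (f := fun s h => ips h (pol pi (obs_ctx h)))) => i iN.
by apply: (meas_ips (b := fun s => pol pi (xx i s))) => //; exact: meas_pol.
Qed.

Variable (mu : R).

Lemma meas_b pi : meas1 (fun s => b_ pol amo (H s) mu pi).
Proof.
rewrite /b_ /emp_regret; apply: measurable_funM => //; apply: measurable_funB; last exact: meas_emp_reward.
apply: (measurable_finsel (F := fun s pi' => emp_reward pol (H s) pi')); first exact: meas_best.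
by move=> i; exact: meas_emp_reward.
Qed.

Section fixed_weights.
Variable w : S -> @weights R Pi.
Hypothesis mw : forall pi, meas1 (fun s => w s pi).

Lemma meas_smooth_pol pi i : (i < n)%N ->
  meas1 (fun s => smoothed pol (w s) mu (pol pi (xx i s)) (xx i s)).
Proof.
by move=> iN; apply: measurable_smoothed => //; [exact: meas_pol|exact: meas_ctx].
Qed.

Lemma meas_V pi : meas1 (fun s => V_ pol (H s) mu pi (w s)).
Proof.
rewrite /V_ /ctx_mean; under eq_fun do rewrite size_mk_hist.
apply: measurable_funM => //.
apply: (meas_hist_sum (f := fun s h => (smoothed pol (w s) mu (pol pi (obs_ctx h)) (obs_ctx h))^-1)) => i iN.
by apply: measurable_funV; exact: meas_smooth_pol.
Qed.

Lemma meas_S pi : meas1 (fun s => S_ pol (H s) mu pi (w s)).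
Proof.
rewrite /S_ /ctx_mean; under eq_fun do rewrite size_mk_hist.
apply: measurable_funM => //.
apply: (meas_hist_sum (f := fun s h => (smoothed pol (w s) mu (pol pi (obs_ctx h)) (obs_ctx h) ^+ 2)^-1)) => i iN.
by apply: measurable_funV; apply: measurable_funX; exact: meas_smooth_pol.
Qed.

Lemma meas_D pi : meas1 (fun s => D_ pol amo (H s) mu pi (w s)).
Proof.
apply: measurable_funB; first exact: meas_V.
by apply: measurable_funD => //; exact: meas_b.
Qed.

Lemma meas_alpha pi : meas1 (fun s => cd_alpha pol amo (H s) mu pi (w s)).
Proof.
apply: measurable_funM; first by apply: measurable_funD; [exact: meas_V|exact: meas_D].
by apply: measurable_funV; apply: measurable_funM => //; exact: meas_S.
Qed.

Lemma meas_scale pi : meas1 (fun s => cd_scale pol amo (H s) mu (w s) pi).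
Proof.
rewrite /cd_scale.
have ms : meas1 (fun s => \sum_pi0 w s pi0 * (2 * K%:R + b_ pol amo (H s) mu pi0)).
  apply: measurable_sum => pi'; apply: measurable_funM => //.
  by apply: measurable_funD => //; exact: meas_b.
rewrite (_ : (fun s => _) = fun s =>
  if 2 * K%:R < \sum_pi0 w s pi0 * (2 * K%:R + b_ pol amo (H s) mu pi0) then
    2 * K%:R / (\sum_pi0 w s pi0 * (2 * K%:R + b_ pol amo (H s) mu pi0)) * w s pi
  else w s pi); last first.
  by apply/funext => s; case: ifP => // _; rewrite ffunE.
apply: measurable_if0 => //; last 1 first.
  by apply: measurable_funM => //; apply: measurable_funM => //; exact: measurable_funV.
by apply: measurable_boolset; exact: measurable_fun_ltr.
Qed.

Lemma meas_cd_policy : meas_fin (fun s => cd_policy pol amo (H s) mu (w s)).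
Proof.
rewrite /cd_policy.
apply: (meas_amo (g := fun s h => [tuple (size (H s))%:R^-1 * (psi * mu /
  smoothed pol (w s) mu a (obs_ctx h) + ips h a) | a < K])) => i a iN.
under eq_fun do rewrite tnth_mktuple size_mk_hist.
apply: measurable_funM => //; apply: measurable_funD; last first.
  by apply: meas_ips => //; exact: meas_cst_fin.
apply: measurable_funM => //; apply: measurable_funV.
by apply: measurable_smoothed => //; [exact: meas_cst_fin|exact: meas_ctx].
Qed.

Lemma meas_update pi : meas1 (fun s => cd_update pol amo (H s) mu (w s) pi).
Proof.
rewrite /cd_update; under eq_fun do rewrite ffunE.
apply: measurable_funD => //.
apply: (measurable_finsel (F := fun s pi' => (pi == pi')%:R * cd_alpha pol amo (H s) mu pi' (w s))).
  exact: meas_cd_policy.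
by move=> pi'; apply: measurable_funM => //; exact: meas_alpha.
Qed.

Lemma meas_stop : measurable [set s | cd_stop pol amo (H s) mu (w s)].
Proof.
rewrite (_ : [set s | _] = ~` [set s | [exists pi, 0 < D_ pol amo (H s) mu pi (w s)]]).
  apply: measurableC; apply: measurable_exists => pi; apply: measurable_boolset.
  by apply: measurable_fun_ltr => //; exact: meas_D.
by apply/seteqP; split=> s /negP.
Qed.

End fixed_weights.

Variable w : S -> @weights R Pi.
Hypothesis mw : forall pi, meas1 (fun s => w s pi).

Lemma meas_iter j pi :
  meas1 (fun s => iter j (cd_update pol amo (H s) mu \o cd_scale pol amo (H s) mu) (w s) pi).
Proof.
elim: j pi => [|j IH] pi //=.
by apply: meas_update => pi'; exact: meas_scale.
Qed.

Lemma meas_cd_weights j pi : meas1 (fun s => cd_weights pol amo (H s) mu (w s) j pi).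
Proof. by apply: meas_scale => pi'; exact: meas_iter. Qed.

(** The loop halts at iteration [j] when the test succeeds there and fails before, a Boolean
    combination of finitely many measurable events; [A] is the union over all [j]. The output is
    then a measurable family evaluated at a measurable integer. *)
Lemma meas_coord_descent : exists (A : set S) (w' : S -> @weights R Pi) (k : S -> nat),
  [/\ measurable A, forall pi, meas1 (fun s => w' s pi), meas_fin k &
   forall s, coord_descent pol amo (H s) mu (w s) =
     if `[< A s >] then Some (w' s, k s) else None].
Proof.
pose st j s := cd_stop pol amo (H s) mu (cd_weights pol amo (H s) mu (w s) j).
have mst j : measurable [set s | st j s].
  by apply: meas_stop => pi; exact: meas_cd_weights.
(* The counter exceeds the number of updates by two, hence [.-2]. The default 0 off the halting
   event [A] is the second case of [NE]. *)
pose N s := if coord_descent pol amo (H s) mu (w s) is Some r then r.2.-2 else 0%N.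
pose A := \bigcup_j [set s | st j s].
have mA : measurable A by exact: bigcup_measurable.
have cdE s : coord_descent pol amo (H s) mu (w s) =
    if `[< A s >] then Some (cd_weights pol amo (H s) mu (w s) (N s), (N s).+2) else None.
  rewrite /N /coord_descent; case: pselect => [ex|nex] /=.
    by rewrite asboolT//; case: ex => j sj; exists j.
  by rewrite asboolF// => -[j _ sj]; apply: nex; exists j.
have NE j s : N s = j <-> (st j s /\ forall i, (i < j)%N -> ~~ st i s) \/ (j = 0%N /\ ~ A s).
  rewrite /N /coord_descent; case: pselect => [ex|nex] /=.
    case: ex_minnP => i si imin; split=> [<-|[[sj jmin]|[_ nA]]].
    - left; split=> // i' i'i; apply: contraL i'i => /imin; rewrite -leqNgt; exact.
    - apply/eqP; rewrite eqn_leq imin//= leqNgt; by apply/negP => /jmin /negP; apply.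
    - by exfalso; apply: nA; exists i.
  split=> [<-|[[sj _]|[-> //]]]; first by right; split=> // -[j' _ sj]; apply: nex; exists j'.
  by exfalso; apply: nex; exists j.
have mN : meas_fin N.
  move=> j; rewrite (_ : N @^-1` _ = ([set s | st j s] `&` \bigcap_(i in `I_j) ~` [set s | st i s])
      `|` (if j == 0%N then ~` A else set0)).
    apply: measurableU.
      apply: measurableI => //; apply: bigcap_measurableType => // i _; exact: measurableC.
    by case: ifP => // _; exact: measurableC.
  apply/seteqP; split=> s /=.
    move=> /NE [[sj jmin]|[-> nA]]; [left|right] => //; split=> // i /= ij; exact/negP/jmin.
  move=> [[sj jmin]|]; first by apply/NE; left; split=> // i ij; apply/negP/jmin.
  by case: eqP => // -> nA; apply/NE; right.
exists A, (fun s => cd_weights pol amo (H s) mu (w s) (N s)), (fun s => (N s).+2); split=> //.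
- move=> pi; apply: (measurable_natsel (F := fun j s => cd_weights pol amo (H s) mu (w s) j pi)) => // j.
  exact: meas_cd_weights.
- move=> j; rewrite (_ : _ @^-1` _ = if (1 < j)%N then N @^-1` [set j.-2] else set0).
    by case: ifP.
  apply/seteqP; split=> s /=; first by move=> <-.
  by case: j => [|[|j]] //= ->.
Qed.

End run_measurable.

Section run_measurable2.
Context d (S : measurableType d) (R : realType) (K : nat) dX (X : measurableType dX).
Context (Pi : finType).
Notation Y := (X * K.-tuple R)%type.
Variables (pol : Pi -> X -> 'I_K) (amo : seq Y -> Pi).
Hypothesis mpol : forall pi a, measurable (pol pi @^-1` [set a]).
Hypothesis mamo : measurable_AMO amo.
Variables (delta : R) (pi0 : Pi).
Variables (z : nat -> S -> Y) (act : nat -> S -> 'I_K).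
Notation meas1 f := (measurable_fun setT f).
Notation meas_fin b := (forall i, measurable (b @^-1` [set i])).

Lemma meas_completed (w : S -> @weights R Pi) (ldr : S -> Pi) pi :
  (forall pi, meas1 (fun s => w s pi)) -> meas_fin ldr ->
  meas1 (fun s => w s pi + (1 - \sum_pi' w s pi') * @unit_mass R Pi (ldr s) pi).
Proof.
move=> mw ml; apply: measurable_funD => //; apply: measurable_funM.
  by apply: measurable_funB => //; exact: measurable_sum.
by apply: (measurable_finsel (F := fun s i => unit_mass i pi)).
Qed.

Lemma completedE (s : @state R K X Pi) pi :
  completed s pi = st_weights s pi + (1 - \sum_pi' st_weights s pi') * unit_mass (st_leader s) pi.
Proof. by rewrite ffunE. Qed.

(** The epoch [m] and the number [cd] of descents are constants, not functions of the outcome: as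
    long as the run exists they depend on the round only. *)
Lemma run_measurable n :
  (forall i, (i < n)%N -> meas1 (z i)) -> (forall i, (i < n)%N -> meas_fin (act i)) ->
  exists (A : set S) (p : nat -> S -> R) (m cd : nat) (w : S -> @weights R Pi)
    (ldr : S -> Pi) (k : S -> nat),
  [/\ measurable A, forall i, (i < n)%N -> meas1 (p i), forall pi, meas1 (fun s => w s pi),
    meas_fin ldr & meas_fin k] /\
  forall s, run pol amo delta pi0 (z ^~ s) (act ^~ s) n =
    if `[< A s >] then Some (State (mk_hist z act p n s) m (w s) (ldr s) (k s) cd) else None.
Proof.
elim: n => [|n IH] mz mact.
  exists setT, (fun _ _ => 0), 1%N, 0%N, (fun _ => [ffun=> 0]), (fun _ => pi0), (fun _ => 0%N).
  split; first split => //.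
  - exact: meas_cst_fin.
  - exact: meas_cst_fin.
  - by move=> s; rewrite asboolT.
have [A [p [m [cd [w [ldr [k [[mA mp mw ml mk] E]]]]]]]] :=
  IH (fun i iN => mz i (leqW iN)) (fun i iN => mact i (leqW iN)).
pose pn s := act_prob pol delta (State (mk_hist z act p n s) m (w s) (ldr s) (k s) cd)
  (z n s).1 (act n s).
pose p' i := if i == n then pn else p i.
have mp' i : (i < n.+1)%N -> meas1 (p' i).
  rewrite /p' ltnS leq_eqVlt => /orP[/eqP ->|iN]; last first.
    by rewrite (ltn_eqF iN); exact: mp.
  rewrite eqxx /pn /act_prob /=.
  apply: (@measurable_smoothed _ S R K _ X Pi pol mpol
    (fun s => completed (State (mk_hist z act p n s) m (w s) (ldr s) (k s) cd))
    (mu_ delta m.-1) (act n) (fun s => (z n s).1)).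
  - by move=> pi; under eq_fun do rewrite completedE; exact: meas_completed.
  - exact: mact.
  - exact: (measurableT_comp measurable_fst (mz n (ltnSn n))).
have HE s : rcons (mk_hist z act p n s) (Obs (z n s).1 (act n s) (tnth (z n s).2 (act n s)) (pn s))
    = mk_hist z act p' n.+1 s.
  rewrite mk_histS /p' eqxx; congr rcons; apply: eq_mk_hist => i iN.
  by rewrite (ltn_eqF iN).
have [B [w' [k' [mB mw' mk' cdE]]]] :=
  meas_coord_descent mpol mamo mz mact mp' (@mu_ R K Pi delta m) mw.
have [tm|tm] := boolP (n.+1 == tau m).
  exists (A `&` B), p', m.+1, cd.+1, w', (fun s => best_policy amo (mk_hist z act p' n.+1 s)),
    (fun s => (k s + k' s)%N).
  split; first split => //.
  - exact: measurableI.
  - exact: meas_best.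
  - move=> j; rewrite (_ : _ @^-1` _ = \bigcup_(i in `I_j.+1) (k @^-1` [set i] `&` k' @^-1` [set (j - i)%N])).
      by apply: bigcup_measurable => i _; exact: measurableI.
    apply/seteqP; split=> s /=; first by move=> <-; exists (k s) => /=; [rewrite ltnS leq_addr|split=> //=; rewrite addKn].
    by move=> [i /= ij [/= -> ->]]; rewrite subnKC.
  move=> s /=; rewrite E asbool_and; case: asboolP => As //=.
  rewrite /round /= HE size_mk_hist tm cdE; by case: asboolP.
exists A, p', m, cd, w, ldr, k; split=> // s /=.
rewrite E; case: asboolP => As //=.
by rewrite /round /= HE size_mk_hist (negbTE tm).
Qed.

(** The context is a variable of its own, separate from the past, since [one_step] integrates it
    against [D]. *)
Lemma run_prob_measurable n :
  (forall i, (i < n)%N -> meas1 (z i)) -> (forall i, (i < n)%N -> meas_fin (act i)) ->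
  forall a, meas1 (fun x : S * Y => if run pol amo delta pi0 (z ^~ x.1) (act ^~ x.1) n is Some s
    then act_prob pol delta s x.2.1 a else K%:R^-1).
Proof.
move=> mz mact a.
have [A [p [m [cd [w [ldr [k [[mA mp mw ml mk] E]]]]]]]] := run_measurable mz mact.
under eq_fun do rewrite E.
rewrite (_ : (fun x => _) = (fun x : S * Y => if `[< A x.1 >] then smoothed pol
   (completed (State (mk_hist z act p n x.1) m (w x.1) (ldr x.1) (k x.1) cd)) (@mu_ R K Pi delta m.-1) a x.2.1
   else K%:R^-1)); last by apply/funext => x; case: asboolP.
apply: measurable_if0 => //.
  rewrite (_ : [set s | _] = fst @^-1` A); last by apply/seteqP; split=> s /asboolP.
  by rewrite -[X in measurable X]setTI; exact: measurable_fst.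
apply: measurable_smoothed => //.
- move=> pi; under eq_fun do rewrite completedE.
  exact: (measurableT_comp (meas_completed pi mw ml) measurable_fst).
- exact: meas_cst_fin.
- exact: (measurableT_comp measurable_fst measurable_snd).
Qed.

End run_measurable2.

(** * Coordinate descent on a fixed history *)

Section elementary.
Context {R : realType}.
Implicit Types (u w x y : R).

Lemma ln_le_sub1 x : 0 < x -> ln x <= x - 1.
Proof.
by move=> x0; rewrite -ler_expR lnK ?posrE//; have := expR_ge1Dx (x - 1); rewrite addrC subrK.
Qed.

(** Substituting the square root [r] of [1 + w] and using [ln r >= 1 - 1/r] leaves an inequality
    between rational functions with the factor [(r - 1)^3]. Any constant below 1 in place of 3/4
    would still make coordinate updates decrease the potential. *)
Lemma ln1D_ge_quad w : 0 <= w -> w - 3 / 4 * w ^+ 2 <= ln (1 + w).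
Proof.
move=> w0; have w10 : 0 <= 1 + w by lra.
set r := Num.sqrt (1 + w); have rr : r ^+ 2 = 1 + w by rewrite sqr_sqrtr.
have r1 : 1 <= r by rewrite -[leLHS]sqrtr1 ler_sqrt; lra.
have lr : 1 - r^-1 <= ln r.
  have : 0 < r^-1 by rewrite invr_gt0; lra.
  by move=> /ln_le_sub1; rewrite lnV ?posrE; lra.
have -> : ln (1 + w) = 2 * ln r.
  by rewrite -rr expr2 lnM ?posrE; lra.
have -> : w = r ^+ 2 - 1 by rewrite rr; ring.
apply: (@le_trans _ _ (2 * (1 - r^-1))); last by lra.
rewrite -subr_ge0.
have -> : 2 * (1 - r^-1) - (r ^+ 2 - 1 - 3 / 4 * (r ^+ 2 - 1) ^+ 2) =
  (r - 1) ^+ 3 * (3 * r ^+ 2 + 9 * r + 8) / (4 * r).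
  by field; lra.
by rewrite divr_ge0 ?mulr_ge0 ?exprn_ge0 //; nra.
Qed.

Lemma expR_le_quad u : u <= 2^-1 -> expR u <= 1 + u + 2 * u ^+ 2.
Proof.
move=> u2; have h := expR_ge1Dx (- u).
have u1 : 0 < 1 - u by lra.
apply: (@le_trans _ _ (1 - u)^-1).
  by rewrite -[expR u]invrK lef_pV2 ?posrE ?invr_gt0 ?expR_gt0// -expRN.
rewrite -[leLHS]mul1r ler_pdivrMr//; nra.
Qed.

Lemma expRN_le_quad u : 0 <= u -> expR (- u) <= 1 - u + u ^+ 2.
Proof.
move=> u0; have h := expR_ge1Dx u.
rewrite expRN; apply: (@le_trans _ _ (1 + u)^-1).
  by rewrite lef_pV2 ?posrE ?expR_gt0//; lra.
rewrite -[leLHS]mul1r ler_pdivrMr; last lra.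
nra.
Qed.

(** The left side is concave in [u] and the right side is its tangent at 1. It is applied with
    [u = K Q(a|x)], whose mean over the actions is the mass of [Q]. *)
Lemma ratio_tangent (k u : R) : 0 < k -> k <= 1 -> 0 <= u ->
  u / ((1 - k) * u + k) <= 1 + k * (u - 1).
Proof.
move=> k0 k1 u0; have d0 : 0 < (1 - k) * u + k.
  have : 0 <= (1 - k) * u by rewrite mulr_ge0//; lra.
  by lra.
rewrite ler_pdivrMr// -subr_ge0.
have -> : (1 + k * (u - 1)) * ((1 - k) * u + k) - u = k * (1 - k) * (u - 1) ^+ 2 by ring.
apply: mulr_ge0; [apply: mulr_ge0; lra|exact: sqr_ge0].
Qed.

End elementary.

Section coordinate_descent.
Context {R : realType} {K : nat} {X : Type} {Pi : finType}.
Variables (pol : Pi -> X -> 'I_K) (amo : seq (X * K.-tuple R) -> Pi).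
Hypothesis K0 : (0 < K)%N.
Hypothesis amoP : is_AMO pol amo.
Notation kappa mu := (K%:R * mu : R).
Implicit Types (Q : @weights R Pi) (x : X) (mu : R).

Let K0R : 0 < K%:R :> R. Proof. by rewrite ltr0n. Qed.

Lemma act_weight_ge0 Q a x : (forall pi, 0 <= Q pi) -> 0 <= act_weight pol Q a x.
Proof. by move=> Q0; apply: sumr_ge0. Qed.

Lemma sum_act_weight Q x : \sum_a act_weight pol Q a x = \sum_pi Q pi.
Proof. by rewrite [RHS](partition_big (fun pi => pol pi x) xpredT). Qed.

Lemma smoothed_ge Q mu a x : (forall pi, 0 <= Q pi) -> kappa mu <= 1 ->
  mu <= smoothed pol Q mu a x.
Proof.
by move=> Q0 k1; rewrite /smoothed lerDr mulr_ge0 ?act_weight_ge0// subr_ge0.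
Qed.

Lemma sum_smoothed Q mu x :
  \sum_a smoothed pol Q mu a x = (1 - kappa mu) * (\sum_pi Q pi) + kappa mu.
Proof.
by rewrite big_split/= -mulr_sumr sum_act_weight sumr_const card_ord mulr_natl.
Qed.

Lemma act_weightZ c Q a x :
  act_weight pol [ffun pi => c * Q pi] a x = c * act_weight pol Q a x.
Proof. by rewrite /act_weight mulr_sumr; apply: eq_bigr => pi _; rewrite ffunE. Qed.

(* For [Q] of total mass [1], this is the relative entropy of the uniform
   distribution to the smoothed weights, divided by [1 - K mu]. *)
Definition ent Q mu x : R :=
  \sum_pi Q pi - 1 - (K%:R * (1 - kappa mu))^-1 * \sum_a ln (K%:R * smoothed pol Q mu a x).

(** By [ln y <= y - 1] the logarithms sum to at most [K (1 - K mu) (s - 1)], where [s] is the mass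
    of [Q]; the summand [s - 1] of [ent] compensates exactly this. *)
Lemma ent_ge0 Q mu x : (forall pi, 0 <= Q pi) -> 0 < mu -> kappa mu < 1 -> 0 <= ent Q mu x.
Proof.
move=> Q0 mu0 k1; rewrite /ent subr_ge0 mulrC ler_pdivrMr; last by rewrite mulr_gt0// subr_gt0.
apply: (@le_trans _ _ (\sum_a (K%:R * smoothed pol Q mu a x - 1))).
  apply: ler_sum => a _; apply: ln_le_sub1; rewrite mulr_gt0//.
  by apply: (lt_le_trans mu0); apply: smoothed_ge => //; exact: ltW.
rewrite big_split/= -mulr_sumr sum_smoothed sumr_const card_ord.
rewrite -mulr_natr; set s := \sum_pi Q pi; nra.
Qed.

Section ctx_mean.
Variable H : seq (@obs R K X).
Hypothesis H0 : (0 < size H)%N.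

Lemma ctx_meanD (f g : X -> R) : ctx_mean H (fun x => f x + g x) = ctx_mean H f + ctx_mean H g.
Proof. by rewrite /ctx_mean big_split/= mulrDr. Qed.

Lemma ctx_meanZ (c : R) (f : X -> R) : ctx_mean H (fun x => c * f x) = c * ctx_mean H f.
Proof. by rewrite /ctx_mean -mulr_sumr mulrCA. Qed.

Lemma ctx_mean_cst (c : R) : ctx_mean H (fun _ => c) = c.
Proof.
rewrite /ctx_mean big_const_seq count_predT iter_addr_0 -[c *+ _]mulr_natl mulrA mulVf ?mul1r//.
by rewrite pnatr_eq0 -lt0n.
Qed.

Lemma ctx_mean_le (f g : X -> R) : (forall x, f x <= g x) -> ctx_mean H f <= ctx_mean H g.
Proof. by move=> fg; rewrite /ctx_mean ler_wpM2l ?invr_ge0// ler_sum. Qed.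

End ctx_mean.

Section fixed_history.
Variables (H : seq (@obs R K X)) (mu : R).
Hypothesis H0 : (0 < size H)%N.
Hypothesis mu0 : 0 < mu.
Hypothesis mu2 : kappa mu <= 2^-1.
Hypothesis Hpos : all (fun h => (0 <= obs_rew h) && (0 < obs_prob h)) H.

Let k1 : kappa mu < 1. Proof. by apply: le_lt_trans mu2 _; lra. Qed.
Let k0 : 0 < kappa mu. Proof. by rewrite mulr_gt0. Qed.

Notation b pi := (b_ pol amo H mu pi).
Notation V pi Q := (V_ pol H mu pi Q).
Notation S pi Q := (S_ pol H mu pi Q).
Notation D pi Q := (D_ pol amo H mu pi Q).
Notation nonneg Q := (forall pi, 0 <= Q pi).

Let smooth_gt0 Q a x : nonneg Q -> 0 < smoothed pol Q mu a x.
Proof. by move=> Q0; apply: (lt_le_trans mu0); apply: smoothed_ge => //; exact: ltW. Qed.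

Let n0 : 0 <= (size H)%:R^-1 :> R. Proof. by rewrite invr_ge0. Qed.

Lemma best_policyP pi : emp_reward pol H pi <= emp_reward pol H (best_policy amo H).
Proof.
rewrite /emp_reward ler_wpM2l//.
have := amoP (s := [seq (obs_ctx h, [tuple ips h a | a < K]) | h <- H]) _ pi.
rewrite !big_map /=; under eq_bigr do rewrite tnth_mktuple.
under [leRHS]eq_bigr do rewrite tnth_mktuple; apply.
rewrite all_map; apply: sub_all Hpos => h /andP[r0 p0] /=.
by apply/forallP => a; rewrite tnth_mktuple /ips !mulr_ge0// invr_ge0 ltW.
Qed.

Lemma emp_regret_ge0 pi : 0 <= emp_regret pol amo H pi.
Proof. by rewrite subr_ge0 best_policyP. Qed.

Lemma psi_mu_gt0 : 0 < @psi R * mu. Proof. by rewrite mulr_gt0// /psi; lra. Qed.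

Lemma b_ge0 pi : 0 <= b pi.
Proof. by rewrite /b_ divr_ge0 ?emp_regret_ge0// ltW// psi_mu_gt0. Qed.

Lemma cd_policyP Q pi : nonneg Q -> D pi Q <= D (cd_policy pol amo H mu Q) Q.
Proof.
move=> Q0; set s := [seq (obs_ctx h, [tuple
  (size H)%:R^-1 * (psi * mu / smoothed pol Q mu a (obs_ctx h) + ips h a) | a < K]) | h <- H].
have amoE pi' : \sum_(e <- s) tnth e.2 (pol pi' e.1) =
    psi * mu * D pi' Q + (psi * mu * (2 * K%:R) + emp_reward pol H (best_policy amo H)).
  rewrite /s big_map /=; under eq_bigr do rewrite tnth_mktuple mulrDr mulrCA.
  rewrite big_split/= -!mulr_sumr /D_ /b_ /emp_regret /V_ /ctx_mean /emp_reward.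
  field.
  by rewrite pnatr_eq0 -lt0n H0 gt_eqF.
rewrite -(ler_pM2l psi_mu_gt0).
have := amoP (s := s) _ pi; rewrite !amoE lerD2r; apply.
rewrite all_map; apply: sub_all Hpos => h /andP[r0 p0] /=.
apply/forallP => a; rewrite tnth_mktuple /ips mulr_ge0// addr_ge0//.
  by rewrite divr_ge0 ?ltW ?psi_mu_gt0// smooth_gt0.
by rewrite !mulr_ge0// invr_ge0 ltW.
Qed.

Definition phi Q : R := ctx_mean H (ent Q mu) + (\sum_pi Q pi * b pi) / (2 * K%:R).

Lemma phi_ge0 Q : nonneg Q -> 0 <= phi Q.
Proof.
move=> Q0; rewrite addr_ge0//.
  rewrite -[leLHS](ctx_mean_cst H0); apply: ctx_mean_le => x; exact: ent_ge0.
by rewrite divr_ge0 ?mulr_ge0// sumr_ge0// => pi _; rewrite mulr_ge0// b_ge0.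
Qed.

Let cost Q := \sum_pi Q pi * (2 * K%:R + b pi).

Lemma costE Q : cost Q = 2 * K%:R * \sum_pi Q pi + \sum_pi Q pi * b pi.
Proof.
by rewrite mulr_sumr -big_split/=; apply: eq_bigr => pi _; ring.
Qed.

Lemma cd_scale_ge0 Q : nonneg Q -> nonneg (cd_scale pol amo H mu Q).
Proof.
move=> Q0 pi; rewrite /cd_scale; case: ifP => // s0; rewrite ffunE mulr_ge0//.
by rewrite divr_ge0 ?mulr_ge0//; apply: le_trans (ltW s0); rewrite mulr_ge0.
Qed.

Lemma cd_scale_cost Q : nonneg Q -> cost (cd_scale pol amo H mu Q) <= 2 * K%:R.
Proof.
move=> Q0; rewrite /cd_scale -/(cost Q); case: ltP => // s0.
have -> : cost [ffun pi => 2 * K%:R / cost Q * Q pi] = 2 * K%:R / cost Q * cost Q.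
  by rewrite {1}/cost [in RHS]/cost mulr_sumr; apply: eq_bigr => pi _; rewrite ffunE mulrA.
rewrite divfK// gt_eqF//; apply: lt_trans s0; by rewrite mulr_gt0.
Qed.

Lemma cost_mass Q : nonneg Q -> cost Q <= 2 * K%:R -> \sum_pi Q pi <= 1.
Proof.
move=> Q0; rewrite costE => h; rewrite -(ler_pM2l (_ : 0 < 2 * K%:R :> R)) ?mulr1 ?mulr_gt0//.
have : 0 <= \sum_pi Q pi * b pi by apply: sumr_ge0 => pi _; rewrite mulr_ge0// b_ge0.
by move: h; lra.
Qed.

(** Let [s] be the mass of [Q]. The choice of [c] makes the regret part equal to [c^-1 - s], and to
    [1 - c s] after rescaling. Its change is the exact opposite of the bound
    [(c - 1) s + (c^-1 - 1)] on the change of the entropy part, which comes from [ratio_tangent] and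
    the mass of the rescaled weights being at most 1. *)
Lemma phi_cd_scale Q : nonneg Q -> phi (cd_scale pol amo H mu Q) <= phi Q.
Proof.
move=> Q0; have := cd_scale_cost Q0; have := cd_scale_ge0 Q0.
rewrite /cd_scale -/(cost Q); case: ltP => // s0.
set c := 2 * K%:R / cost Q; set Q' : weights := [ffun _ => _] => Q'0 cQ'.
have K2 : 0 < 2 * K%:R :> R by rewrite mulr_gt0.
have cost0 : 0 < cost Q by apply: lt_trans s0.
have c0 : 0 < c by rewrite divr_gt0.
have mQ' := cost_mass Q'0 cQ'.
have sQ' : \sum_pi Q' pi = c * \sum_pi Q pi.
  by rewrite mulr_sumr; apply: eq_bigr => pi _; rewrite ffunE.
have bQ' : \sum_pi Q' pi * b pi = c * \sum_pi Q pi * b pi.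
  by rewrite mulr_sumr; apply: eq_bigr => pi _; rewrite ffunE; exact/esym/mulrA.
have costc : (\sum_pi Q pi * b pi) / (2 * K%:R) = c^-1 - \sum_pi Q pi.
  by rewrite /c invf_div costE; field; rewrite gt_eqF.
have entd x : ent Q' mu x - ent Q mu x <= (c - 1) * (\sum_pi Q pi) + (c^-1 - 1).
  rewrite /ent sQ'.
  set L' := \sum_a ln (K%:R * smoothed pol Q' mu a x).
  set L := \sum_a ln (K%:R * smoothed pol Q mu a x).
  have LL : L - L' <= (1 - kappa mu) * (c^-1 - 1) * K%:R.
    have c1 : 0 <= c^-1 - 1.
      by rewrite /c invf_div subr_ge0 ler_pdivlMr// mul1r ltW.
    rewrite /L /L' -sumrB.
    apply: (@le_trans _ _ (\sum_a (1 - kappa mu) * (c^-1 - 1) *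
       (1 + kappa mu * (K%:R * act_weight pol Q' a x - 1)))).
      apply: ler_sum => a _.
      have y0 := smooth_gt0 a x Q0; have y'0 := smooth_gt0 a x Q'0.
      rewrite -ln_div ?posrE ?mulr_gt0//.
      have aQ : act_weight pol Q a x = c^-1 * act_weight pol Q' a x.
        by rewrite act_weightZ mulrA mulVf ?mul1r// gt_eqF.
      have := @ln_le_sub1 _ (K%:R * smoothed pol Q mu a x / (K%:R * smoothed pol Q' mu a x)).
      rewrite divr_gt0 ?mulr_gt0// => /(_ isT) /le_trans; apply.
      have -> : K%:R * smoothed pol Q mu a x / (K%:R * smoothed pol Q' mu a x) - 1 =
         (1 - kappa mu) * (c^-1 - 1) * (act_weight pol Q' a x / smoothed pol Q' mu a x).
        have -> : smoothed pol Q mu a x = smoothed pol Q' mu a x +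
            (1 - kappa mu) * (c^-1 - 1) * act_weight pol Q' a x.
          by rewrite /smoothed aQ; ring.
        by field; rewrite !gt_eqF.
      apply: ler_wpM2l; first by rewrite mulr_ge0// subr_ge0 ltW.
      have := @ratio_tangent _ (kappa mu) (K%:R * act_weight pol Q' a x) k0 (ltW k1) _.
      rewrite mulr_ge0 ?act_weight_ge0// => /(_ isT); congr (_ <= _).
      have -> : (1 - kappa mu) * (K%:R * act_weight pol Q' a x) + kappa mu =
        K%:R * smoothed pol Q' mu a x by rewrite /smoothed; ring.
      by field; rewrite !gt_eqF.
    rewrite -mulr_sumr; apply: ler_wpM2l; first by rewrite mulr_ge0// subr_ge0 ltW.
    rewrite big_split/= -mulr_sumr sumrB -mulr_sumr sum_act_weight !sumr_const card_ord.
    have : 0 <= kappa mu * K%:R * (1 - \sum_pi Q' pi).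
      by rewrite mulr_ge0 ?subr_ge0// mulr_ge0// ltW.
    by lra.
  have -> : c * \sum_pi Q pi - 1 - (K%:R * (1 - kappa mu))^-1 * L' -
      (\sum_pi Q pi - 1 - (K%:R * (1 - kappa mu))^-1 * L) =
     (c - 1) * (\sum_pi Q pi) + (K%:R * (1 - kappa mu))^-1 * (L - L') by ring.
  rewrite lerD2l mulrC ler_pdivrMr; last by rewrite mulr_gt0// subr_gt0.
  by move: LL; congr (_ <= _); ring.
rewrite /phi bQ' -mulrA costc.
have : ctx_mean H (ent Q' mu) <= ctx_mean H (ent Q mu) + ((c - 1) * (\sum_pi Q pi) + (c^-1 - 1)).
  rewrite -[X in _ <= _ + X](ctx_mean_cst H0) -ctx_meanD; apply: ctx_mean_le => x.
  by rewrite -lerBlDl.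
have : c * c^-1 = 1 by rewrite mulfV// gt_eqF.
set S := \sum_pi Q pi; set d := c^-1; move=> cd h.
have -> : c * (d - S) = 1 - c * S by rewrite mulrBr cd.
by move: h; lra.
Qed.

Lemma S_le_V Q pi : nonneg Q -> S pi Q <= V pi Q / mu.
Proof.
move=> Q0; rewrite mulrC /S_ /V_ -ctx_meanZ; apply: ctx_mean_le => x.
have y0 := smooth_gt0 (pol pi x) x Q0.
rewrite expr2 invfM ler_pM2r ?invr_gt0//.
rewrite lef_pV2 ?posrE//; apply: smoothed_ge => //; exact: ltW.
Qed.

Lemma S_ge0 Q pi : 0 <= S pi Q.
Proof.
by rewrite /S_ -[leLHS](ctx_mean_cst H0); apply: ctx_mean_le => x; rewrite invr_ge0 sqr_ge0.
Qed.

Lemma V_le_inv Q pi : nonneg Q -> V pi Q <= mu^-1.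
Proof.
move=> Q0; rewrite -[leRHS](ctx_mean_cst H0); apply: ctx_mean_le => x.
by rewrite lef_pV2 ?posrE ?smooth_gt0//; apply: smoothed_ge => //; exact: ltW.
Qed.

(** [cd_alpha] maximises the decrease computed with [w - w^2 / 2] in place of [ln (1 + w)]. With the
    certified 3/4 instead of 1/2 the decrease is still [(V + D)^2 / (16 K (1 - K mu) S)], and
    [D > 0], [V > 2 K] and [S <= V / mu] bring it to [mu / 8]. *)
Lemma phi_cd_update Q : nonneg Q -> ~~ cd_stop pol amo H mu Q ->
  nonneg (cd_update pol amo H mu Q) /\ phi (cd_update pol amo H mu Q) <= phi Q - mu / 8.
Proof.
move=> Q0; rewrite negbK => /existsP[pi1 D1].
set pi := cd_policy pol amo H mu Q.
have Dpi : 0 < D pi Q by apply: lt_le_trans D1 _; exact: cd_policyP.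
have Vpi : 2 * K%:R < V pi Q.
  by move: Dpi; rewrite /D_; have := b_ge0 pi; lra.
have V0 : 0 < V pi Q by apply: lt_trans Vpi; rewrite mulr_gt0.
have SV : S pi Q * mu <= V pi Q by rewrite -ler_pdivlMr// S_le_V.
have S0 : 0 < S pi Q.
  rewrite lt_neqAle S_ge0 andbT eq_sym; apply/negP => /eqP SS.
  (* Non-negativity of the variance of the inverse weight; [S = 0] would then force [V = 0]. *)
  have V1 : V pi Q ^+ 2 <= S pi Q.
    have : 0 <= ctx_mean H (fun x => ((smoothed pol Q mu (pol pi x) x)^-1 - V pi Q) ^+ 2).
      by rewrite -[leLHS](ctx_mean_cst H0); apply: ctx_mean_le => x; exact: sqr_ge0.
    rewrite (_ : (fun x => _) = fun x => (smoothed pol Q mu (pol pi x) x ^+ 2)^-1 +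
       ((- 2 * V pi Q) * (smoothed pol Q mu (pol pi x) x)^-1 + V pi Q ^+ 2)); last first.
      by apply/funext => x; rewrite -exprVn; ring.
    rewrite ctx_meanD ctx_meanD ctx_meanZ ctx_mean_cst// -/(S pi Q) -/(V pi Q); lra.
  have : 0 < V pi Q ^+ 2 by rewrite exprn_gt0.
  by rewrite SS in V1; lra.
have k1' : 0 < 1 - kappa mu by rewrite subr_gt0.
set al := cd_alpha pol amo H mu pi Q.
have alE : al = (V pi Q + D pi Q) / (2 * (1 - kappa mu) * S pi Q) by [].
have al0 : 0 < al.
  rewrite alE; apply: divr_gt0; first exact: addr_gt0.
  by apply: mulr_gt0 => //; apply: mulr_gt0.
set Q' := cd_update _ _ _ _ _.
have Q'E pi' : Q' pi' = Q pi' + (pi' == pi)%:R * al by rewrite ffunE.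
have Q'0 : nonneg Q'.
  by move=> pi'; rewrite Q'E addr_ge0// mulr_ge0// ltW.
split=> //.
have sumQ' (f : Pi -> R) : \sum_pi' Q' pi' * f pi' = \sum_pi' Q pi' * f pi' + al * f pi.
  under eq_bigr do rewrite Q'E mulrDl; rewrite big_split/=; congr +%R.
  rewrite (bigD1 pi)//= eqxx mul1r big1 ?addr0// => pi' /negbTE ->.
  by rewrite !mul0r.
have massQ' : \sum_pi' Q' pi' = \sum_pi' Q pi' + al.
  by have := sumQ' (fun _ => 1); rewrite mulr1; under eq_bigr do rewrite mulr1;
     under [in X in _ = X -> _]eq_bigr do rewrite mulr1.
have smQ' a x : smoothed pol Q' mu a x = smoothed pol Q mu a x +
    (1 - kappa mu) * al * (pol pi x == a)%:R.
  rewrite /smoothed; suff -> : act_weight pol Q' a x = act_weight pol Q a x + al * (pol pi x == a)%:R by ring.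
  rewrite /act_weight big_mkcond [in RHS]big_mkcond/=.
  have := sumQ' (fun pi' => (pol pi' x == a)%:R) => h.
  transitivity (\sum_pi' Q' pi' * (pol pi' x == a)%:R).
    by apply: eq_bigr => pi' _; case: ifP; rewrite ?mulr1 ?mulr0.
  rewrite h; congr (_ + _).
  by apply: eq_bigr => pi' _; case: ifP; rewrite ?mulr1 ?mulr0.
have entd x : ent Q' mu x <= ent Q mu x + (al + ((- al / K%:R) * (smoothed pol Q mu (pol pi x) x)^-1 +
    (3 / 4 * (1 - kappa mu) * al ^+ 2 / K%:R) * (smoothed pol Q mu (pol pi x) x ^+ 2)^-1)).
  rewrite /ent massQ'.
  set L' := \sum_a ln (K%:R * smoothed pol Q' mu a x).
  set L := \sum_a ln (K%:R * smoothed pol Q mu a x).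
  set y := smoothed pol Q mu (pol pi x) x.
  have y0 : 0 < y by exact: smooth_gt0.
  pose w := (1 - kappa mu) * al / y.
  have t0 : 0 < (1 - kappa mu) * al by exact: mulr_gt0.
  have w0 : 0 <= w by apply: ltW; exact: divr_gt0.
  have LL : w - 3 / 4 * w ^+ 2 <= L' - L.
    apply: le_trans (ln1D_ge_quad w0) _.
    rewrite /L /L' -sumrB (bigD1 (pol pi x))//= big1 ?addr0 => [|a ax]; last first.
      by rewrite smQ' eq_sym (negbTE ax) mulr0 addr0 subrr.
    have yt : 0 < y + (1 - kappa mu) * al by exact: addr_gt0.
    rewrite smQ' eqxx mulr1 -/y -ln_div ?posrE; [|exact: mulr_gt0..].
    rewrite (_ : _ / _ = 1 + w)// /w; field; by rewrite !gt_eqF.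
  have : (K%:R * (1 - kappa mu))^-1 * (w - 3 / 4 * w ^+ 2) <= (K%:R * (1 - kappa mu))^-1 * (L' - L).
    by rewrite ler_wpM2l// invr_ge0 ltW// mulr_gt0.
  have -> : (K%:R * (1 - kappa mu))^-1 * (w - 3 / 4 * w ^+ 2) =
     al / K%:R * y^-1 - 3 / 4 * (1 - kappa mu) * al ^+ 2 / K%:R * (y ^+ 2)^-1.
    by rewrite /w; field; rewrite !gt_eqF.
  by lra.
rewrite /phi sumQ'.
have phi1 : ctx_mean H (ent Q' mu) <= ctx_mean H (ent Q mu) + (al + ((- al / K%:R) * V pi Q +
    (3 / 4 * (1 - kappa mu) * al ^+ 2 / K%:R) * S pi Q)).
  rewrite /V_ /S_ -!ctx_meanZ -ctx_meanD -{1}[al](ctx_mean_cst H0) -ctx_meanD -ctx_meanD.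
  exact: ctx_mean_le.
have DV : D pi Q = V pi Q - (2 * K%:R + b pi) by [].
set Vp := V pi Q in DV Vpi V0 SV alE phi1 *; set Dp := D pi Q in DV Dpi alE *; set Sp := S pi Q in SV S0 alE phi1 *.
have key : al + (- al / K%:R * Vp + 3 / 4 * (1 - kappa mu) * al ^+ 2 / K%:R * Sp) +
    al * b pi / (2 * K%:R) = - ((Vp + Dp) ^+ 2 / (16 * K%:R * (1 - kappa mu) * Sp)).
  have -> : b pi = Vp - Dp - 2 * K%:R by rewrite DV; ring.
  by rewrite alE; field; rewrite !gt_eqF.
suff : mu / 8 <= (Vp + Dp) ^+ 2 / (16 * K%:R * (1 - kappa mu) * Sp).
  rewrite [X in _ + X <= _]mulrDl => h.
  move: phi1 key h.
  set T1 := al + _; set T2 := al * b pi / _; set T3 := _ / (16 * _ * _ * _).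
  set T4 := (\sum_pi' _) / (2 * K%:R); set E1 := ctx_mean H (ent Q' mu); set E2 := ctx_mean H (ent Q mu).
  lra.
rewrite ler_pdivlMr; last first.
  by apply: mulr_gt0 => //; apply: mulr_gt0 => //; apply: mulr_gt0.
have h1 : (1 - kappa mu) * Sp <= Sp by rewrite ler_piMl ?(ltW S0)// gerBl ltW.
have h2 : (1 - kappa mu) * Sp * mu <= Vp.
  by apply: le_trans SV; rewrite ler_pM2r.
have h3 : 2 * K%:R * Vp <= (Vp + Dp) ^+ 2 by nra.
have -> : mu / 8 * (16 * K%:R * (1 - kappa mu) * Sp) = 2 * K%:R * ((1 - kappa mu) * Sp * mu) by field.
by apply: le_trans h3; rewrite ler_pM2l// mulr_gt0.
Qed.

Let step := cd_update pol amo H mu \o cd_scale pol amo H mu.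

Lemma phi_iter Q n : nonneg Q ->
  (forall i, (i < n)%N -> ~~ cd_stop pol amo H mu (cd_weights pol amo H mu Q i)) ->
  nonneg (iter n step Q) /\ phi (iter n step Q) <= phi Q - n%:R * (mu / 8).
Proof.
move=> Q0; elim: n => [|n IH] nstop; first by rewrite mul0r subr0.
have [Qn phin] := IH (fun i iN => nstop i (leqW iN)).
have sc := phi_cd_scale Qn; have scn := cd_scale_ge0 Qn.
have [] := phi_cd_update scn (nstop n (ltnSn n)); rewrite /= => up0 up; split=> //.
by rewrite -natr1 mulrDl mul1r; apply: le_trans up _; move: sc phin; rewrite /step; lra.
Qed.

Lemma coord_descentP Q : nonneg Q -> exists (Q' : weights) (n : nat),
  [/\ coord_descent pol amo H mu Q = Some (Q', n.+2), nonneg Q',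
    \sum_pi Q' pi * (2 * K%:R + b pi) <= 2 * K%:R,
    forall pi, D pi Q' <= 0 & phi Q' + n%:R * (mu / 8) <= phi Q].
Proof.
move=> Q0; rewrite /coord_descent; case: pselect => [ex|nex].
  case: ex_minnP => n stn nmin.
  have [Qn phin] : nonneg (iter n step Q) /\ phi (iter n step Q) <= phi Q - n%:R * (mu / 8).
    by apply: phi_iter => // i iN; apply: contraL iN => /nmin; rewrite -leqNgt.
  exists (cd_weights pol amo H mu Q n), n; split=> //.
  - exact: cd_scale_ge0.
  - exact: cd_scale_cost.
  - by move=> pi; rewrite leNgt; apply: contra stn => Dpi; apply/existsP; exists pi.
  - by have := phi_cd_scale Qn; rewrite /cd_weights -/step; lra.
exfalso.
have Hn n : n%:R * (mu / 8) <= phi Q.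
  have [Qn phin] : nonneg (iter n step Q) /\ phi (iter n step Q) <= phi Q - n%:R * (mu / 8).
    by apply: phi_iter => // i iN; apply/negP => st; apply: nex; exists i.
  by have := phi_ge0 Qn; lra.
have m8 : 0 < mu / 8 by rewrite divr_gt0.
(* More updates than the initial potential can pay for. *)
have := Hn (Num.truncn (phi Q / (mu / 8))).+1.
by rewrite -ler_pdivlMr// leNgt truncnS_gt.
Qed.

(** At this [mu] the smoothing alone gives [V <= 1 / mu = 2 K], so no constraint is violated and the
    first test halts. *)
Lemma coord_descent_uniform : mu = (2 * K%:R)^-1 ->
  coord_descent pol amo H mu [ffun=> 0] = Some ([ffun=> 0], 2%N).
Proof.
move=> muE; have Q0 pi : 0 <= @finfun Pi (fun=> R) (fun=> 0) pi by rewrite ffunE.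
have scE : cd_scale pol amo H mu [ffun=> 0] = [ffun=> 0].
  have s0 : \sum_pi @finfun Pi (fun=> R) (fun=> 0) pi * (2 * K%:R + b pi) = 0.
    by apply: big1 => pi _; rewrite ffunE mul0r.
  by rewrite /cd_scale s0 ltNge mulr_ge0.
have st : cd_stop pol amo H mu (cd_weights pol amo H mu [ffun=> 0] 0).
  rewrite /cd_weights /= scE; apply/existsPn => pi; rewrite -leNgt /D_ subr_le0.
  apply: le_trans (V_le_inv pi Q0) _; have := b_ge0 pi.
  have -> : mu^-1 = 2 * K%:R by rewrite muE invrK.
  by lra.
rewrite /coord_descent; case: pselect => [ex|[]]; last by exists 0%N.
case: ex_minnP => n _ /(_ _ st); rewrite leqn0 => /eqP ->.
by rewrite /cd_weights /= scE.
Qed.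

End fixed_history.
End coordinate_descent.

(** * Sampling sparse weights *)

Section sampling.
Context {R : realType} {Pi : finType}.
Variable W : Pi -> R.
Hypothesis W0 : forall pi, 0 <= W pi.
Hypothesis W1 : \sum_pi W pi = 1.
Implicit Types (F G : seq Pi -> R).

(* Expectation of [F] over [M] independent draws from [W]. *)
Fixpoint EM (M : nat) (F : seq Pi -> R) : R :=
  if M is M'.+1 then \sum_pi W pi * EM M' (fun s => F (pi :: s)) else F [::].

Lemma EM_le M F G : (forall s, size s = M -> F s <= G s) -> EM M F <= EM M G.
Proof.
elim: M F G => [|M IH] F G FG /=; first exact: FG.
by apply: ler_sum => pi _; apply: ler_wpM2l => //; apply: IH => s sM; apply: FG; rewrite /= sM.
Qed.

Lemma eq_EM M F G : (forall s, size s = M -> F s = G s) -> EM M F = EM M G.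
Proof. by move=> FG; apply/eqP; rewrite eq_le !EM_le// => s /FG ->. Qed.

Lemma EM_cst M c : EM M (fun _ => c) = c.
Proof.
by elim: M => //= M IH; rewrite IH -mulr_suml W1 mul1r.
Qed.

Lemma EMD M F G : EM M (fun s => F s + G s) = EM M F + EM M G.
Proof.
elim: M F G => //= M IH F G; rewrite -big_split/=; apply: eq_bigr => pi _.
by rewrite -mulrDr -IH.
Qed.

Lemma EMZ M c F : EM M (fun s => c * F s) = c * EM M F.
Proof.
elim: M F => //= M IH F; rewrite mulr_sumr; apply: eq_bigr => pi _.
by rewrite mulrCA -IH.
Qed.

Lemma EM_count M (p : pred Pi) :
  EM M (fun s => (count p s)%:R) = M%:R * \sum_(pi | p pi) W pi.
Proof.
elim: M => [|M IH] /=; first by rewrite mul0r.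
transitivity (\sum_pi W pi * ((p pi)%:R + M%:R * \sum_(pi | p pi) W pi)).
  apply: eq_bigr => pi _; congr (_ * _).
  by rewrite -IH -[X in X + _](EM_cst M) -EMD; apply: eq_EM => s _; rewrite natrD.
under [LHS]eq_bigr => pi _ do rewrite mulrDr.
rewrite big_split/= -mulr_suml W1 mul1r -natr1 mulrDl mul1r addrC; congr +%R.
by rewrite [RHS]big_mkcond; apply: eq_bigr => pi _; case: (p pi); rewrite ?mulr1 ?mulr0.
Qed.

Section binomial.
Variable q : R.
Hypothesis q01 : 0 <= q <= 1.
Implicit Types f g : nat -> R.

(* One Bernoulli([q]) step: [iter n binT f k] is the expectation of
   [f (k + B)] for [B] binomial with parameters [n] and [q]. *)
Definition binT f (k : nat) : R := q * f k.+1 + (1 - q) * f k.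

Lemma binTE f k : binT f k = q * f k.+1 + (1 - q) * f k.
Proof. by []. Qed.

Let shift g (k : nat) : R := k%:R * g k.-1.

Lemma binT_shift g : binT (shift g) = shift (binT g) \+ q \*o g.
Proof.
apply/funext => -[|k]; rewrite /binT /shift /=; first by ring.
by rewrite -!natr1; ring.
Qed.

Lemma iter_binTD n f g : iter n binT (f \+ q \*o g) = iter n binT f \+ q \*o iter n binT g.
Proof.
elim: n f g => // n IH f g; rewrite !iterSr -IH; congr iter.
by apply/funext => k; rewrite /binT /=; ring.
Qed.

(** At [k = 0] this is the identity E[B g(B - 1)] = (n + 1) q E[g(B')] for binomial variables B with
    n + 1 trials and B' with n; the general starting point makes the induction work. *)
Lemma iter_binT_shift n g :
  iter n.+1 binT (shift g) = shift (iter n.+1 binT g) \+ (n.+1%:R * q) \*o iter n binT g.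
Proof.
elim: n g => [|n IH] g.
  by rewrite /= binT_shift; apply/funext => k /=; rewrite mul1r.
rewrite iterSr binT_shift iter_binTD IH -!iterSr.
by apply/funext => k /=; rewrite -[n.+2%:R]natr1; ring.
Qed.

Lemma iter_binT_le n f g : (forall k, f k <= g k) -> forall k, iter n binT f k <= iter n binT g k.
Proof.
move=> fg; elim: n => //= n IH k; rewrite /binT; case/andP: q01 => q0 q1.
by apply: lerD; apply: ler_wpM2l => //; rewrite subr_ge0.
Qed.

Lemma iter_binT_cst n c k : iter n binT (fun _ => c) k = c.
Proof. by elim: n k => //= n IH k; rewrite /binT !IH; ring. Qed.

(* [(n + 1) q E(1 / (B + 1))] is the probability that [n + 1] trials succeed
   at least once. *)
Lemma iter_binT_inv n : n.+1%:R * q * iter n binT (fun k => k.+1%:R^-1) 0 <= 1.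
Proof.
have /(congr1 (fun f => f 0%N)) := iter_binT_shift n (fun k => k.+1%:R^-1).
rewrite /= /shift mul0r add0r => <-.
rewrite -[leRHS](iter_binT_cst n.+1 1 0); apply: (@iter_binT_le n.+1) => -[|k] /=.
  by rewrite mul0r.
by rewrite mulfV.
Qed.

End binomial.

Lemma EM_binT M (p : pred Pi) (f : nat -> R) j :
  EM M (fun s => f (j + count p s)%N) = iter M (binT (\sum_(pi | p pi) W pi)) f j.
Proof.
have W1' : \sum_(pi | ~~ p pi) W pi = 1 - \sum_(pi | p pi) W pi.
  by have := W1; rewrite (bigID p)/=; lra.
elim: M j => [|M IH] j /=; first by rewrite addn0.
rewrite (bigID p)/= binTE -W1' !mulr_suml; congr +%R; apply: eq_bigr => pi ppi; congr (_ * _).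
  by rewrite -IH ppi; apply: eq_EM => s _; rewrite addnA addn1.
by rewrite -IH (negbTE ppi).
Qed.

End sampling.

Section sampled_weights.
Context {R : realType} {K : nat} {X : Type} {Pi : finType}.
Variables (pol : Pi -> X -> 'I_K) (W : @weights R Pi) (mu : R) (M : nat).
Hypothesis W0 : forall pi, 0 <= W pi.
Hypothesis W1 : \sum_pi W pi = 1.
Hypothesis mu0 : 0 < mu.
Hypothesis mu2 : K%:R * mu <= 2^-1.
Hypothesis M1 : 1 <= M%:R * mu.
Implicit Types (a : 'I_K) (x : X) (s : seq Pi).

Let M0 : 0 < M%:R :> R.
Proof. by have := M1; rewrite lt_neqAle ler0n andbT eq_sym; apply: contraTneq => ->; rewrite mul0r ler10. Qed.

Definition empirical_weights s : @weights R Pi := [ffun pi => (count_mem pi s)%:R / M%:R].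

Lemma empirical_weights_ge0 s pi : 0 <= empirical_weights s pi.
Proof. by rewrite ffunE divr_ge0. Qed.

Lemma act_weight_empirical s a x :
  act_weight pol (empirical_weights s) a x = (count (fun pi => pol pi x == a) s)%:R / M%:R.
Proof.
rewrite /act_weight; under eq_bigr do rewrite ffunE; rewrite -mulr_suml; congr (_ / _).
rewrite -natr_sum; congr (_%:R).
elim: s => [|y s IH] /=; first by rewrite big1.
rewrite big_split/= IH; congr addn; rewrite big_mkcond (bigD1 y)//= big1 => [|i /negbTE iy].
  by rewrite eqxx addn0; case: (pol y x == a).
by case: ifP => // _; rewrite eq_sym iy.
Qed.

Let inv_sm s a x := (smoothed pol (empirical_weights s) mu a x)^-1.

Let sm_ge (Q : @weights R Pi) a x : (forall pi, 0 <= Q pi) -> mu <= smoothed pol Q mu a x.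
Proof. by move=> Q0; apply: smoothed_ge => //; have := mu2; lra. Qed.

(** Jensen's inequality for [1 / y], through the tangent at the mean [c]. *)
Lemma EM_inv_ge a x : (smoothed pol W mu a x)^-1 <= EM W M (fun s => inv_sm s a x).
Proof.
set c := smoothed pol W mu a x.
have c0 : 0 < c by apply: lt_le_trans mu0 (sm_ge _ _ _).
have Ey : EM W M (fun s => smoothed pol (empirical_weights s) mu a x) = c.
  transitivity (EM W M (fun s => (1 - K%:R * mu) / M%:R * (count (fun pi => pol pi x == a) s)%:R + mu)).
    by apply: eq_EM => // s _; rewrite /smoothed act_weight_empirical; ring.
  rewrite EMD EM_cst// EMZ EM_count// /c /smoothed /act_weight; congr (_ + _).
  by field; rewrite gt_eqF.
have <- : EM W M (fun s => 2 / c + (- (c ^+ 2)^-1) * smoothed pol (empirical_weights s) mu a x) = c^-1.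
  by rewrite EMD EM_cst// EMZ Ey; field; rewrite gt_eqF.
apply: EM_le => // s _; rewrite /inv_sm.
set y := smoothed _ _ _ _ _; have y0 : 0 < y.
  by apply: lt_le_trans mu0 (sm_ge _ _ _) => pi; exact: empirical_weights_ge0.
rewrite -subr_ge0.
have -> : y^-1 - (2 / c + - (c ^+ 2)^-1 * y) = (y - c) ^+ 2 / (c ^+ 2 * y).
  by field; rewrite !gt_eqF.
by rewrite divr_ge0 ?sqr_ge0// mulr_ge0 ?sqr_ge0// ltW.
Qed.

(** With [e] the mean of the inverse and [q] the true weight, [e mu <= 1] is trivial and [e q <= 2]
    comes from the binomial law of the count; together they give [e ((1 - K mu) q + mu) <= 3]. *)
Lemma EM_inv_le a x : EM W M (fun s => inv_sm s a x) <= 3 * (smoothed pol W mu a x)^-1.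
Proof.
set c := smoothed pol W mu a x.
have c0 : 0 < c by apply: lt_le_trans mu0 (sm_ge _ _ _).
set q := act_weight pol W a x.
have q0 : 0 <= q by exact: act_weight_ge0.
have q1 : q <= 1.
  rewrite -W1 /q /act_weight [leRHS](bigID (fun pi => pol pi x == a))/= lerDl.
  exact: sumr_ge0.
set e := EM _ _ _.
have k1 : 2^-1 <= 1 - K%:R * mu by have := mu2; lra.
have e1 : e * mu <= 1.
  rewrite -ler_pdivlMr// mul1r -[leRHS](EM_cst W1 M); apply: EM_le => // s _.
  rewrite /inv_sm; have h : mu <= smoothed pol (empirical_weights s) mu a x.
    by apply: sm_ge => pi; exact: empirical_weights_ge0.
  by rewrite lef_pV2 ?posrE//; apply: lt_le_trans h.
have e2 : e * q <= 2.
  (* With [B] draws choosing [a], the smoothed weight is at least [(B + 1) / (2 M)], by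
     [1 - K mu >= 1/2] and [M mu >= 1]. *)
  have : e <= EM W M (fun s => 2 * M%:R * (0 + count (fun pi => pol pi x == a) s)%N.+1%:R^-1).
    apply: EM_le => // s _; rewrite /inv_sm /smoothed act_weight_empirical add0n.
    set B := (count _ s)%:R; rewrite -natr1 -/B.
    have B0 : 0 <= B by rewrite /B ler0n.
    have d0 : 0 < (1 - K%:R * mu) * (B / M%:R) + mu.
      apply: ltr_wpDl => //; apply: mulr_ge0; last by rewrite divr_ge0.
      by have := k1; lra.
    rewrite -[leLHS]mul1r ler_pdivrMr// mulrAC ler_pdivlMr; last by lra.
    rewrite mul1r.
    have -> : 2 * M%:R * ((1 - K%:R * mu) * (B / M%:R) + mu) =
      2 * ((1 - K%:R * mu) * B) + 2 * (M%:R * mu) by field; rewrite gt_eqF.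
    have : 2^-1 * B <= (1 - K%:R * mu) * B by rewrite ler_wpM2r.
    by have := M1; lra.
  rewrite EMZ (EM_binT W0 W1 M _ (fun k => k.+1%:R^-1) 0) -/(act_weight pol W a x) -/q => he.
  have hb : M.+1%:R * q * iter M (binT q) (fun k => k.+1%:R^-1) 0 <= 1.
    by apply: iter_binT_inv; rewrite q0 q1.
  have it0 : 0 <= iter M (binT q) (fun k => k.+1%:R^-1 : R) 0.
    rewrite -[leLHS](iter_binT_cst q M 0 0); apply: iter_binT_le => [|k]; first by rewrite q0 q1.
    by rewrite invr_ge0.
  set I := iter M _ _ _ in he hb it0.
  have : e * q <= 2 * M%:R * I * q by apply: ler_wpM2r.
  have : M%:R * q * I <= M.+1%:R * q * I.
    have := mulr_ge0 q0 it0; rewrite -natr1; lra.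
  by lra.
rewrite ler_pdivlMr// /c /smoothed -/q.
have e0 : 0 <= e.
  rewrite -[leLHS](EM_cst W1 M); apply: EM_le => // s _; rewrite invr_ge0.
  by apply: le_trans (ltW mu0) (sm_ge _ _ _) => pi; exact: empirical_weights_ge0.
have : (1 - K%:R * mu) * (e * q) <= e * q.
  rewrite ler_piMl ?mulr_ge0// gerBl mulr_ge0//; exact: ltW.
by lra.
Qed.

End sampled_weights.

(** * Expectations of bounded measurable functions *)

Section expectation.
Context {R : realType} dY (Y : measurableType dY) (D : probability Y R).
Implicit Types F G : Y -> R.

Definition bmf F := measurable_fun setT F /\ exists M : R, forall y, `|F y| <= M.

Definition ED F : R := \int[D]_y F y.

Lemma bmf_integrable F : bmf F -> D.-integrable setT (EFin \o F).
Proof.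
move=> [mF [M FM]]; apply: measurable_bounded_integrable => //.
  by rewrite (le_lt_trans (probability_le1 _ _))// ltry.
by exists M; split; [exact: num_real|move=> M' MM' y _; apply: le_trans (FM y) (ltW MM')].
Qed.

Lemma bmfD F G : bmf F -> bmf G -> bmf (fun y => F y + G y).
Proof.
move=> [mF [M FM]] [mG [N GN]]; split; first exact: measurable_funD.
by exists (M + N) => y; apply: le_trans (ler_normD _ _) _; exact: lerD.
Qed.

Lemma bmf_cst c : bmf (fun _ => c).
Proof. by split; [exact: measurable_cst|exists `|c|]. Qed.

Lemma bmfM F G : bmf F -> bmf G -> bmf (fun y => F y * G y).
Proof.
move=> [mF [M FM]] [mG [N GN]]; split; first exact: measurable_funM.
by exists (M * N) => y; rewrite normrM ler_pM.
Qed.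

Lemma bmfZ c F : bmf F -> bmf (fun y => c * F y).
Proof. by move=> bF; apply: bmfM => //; exact: bmf_cst. Qed.

Lemma bmf_sum (I : finType) (F : I -> Y -> R) :
  (forall i, bmf (F i)) -> bmf (fun y => \sum_i F i y).
Proof.
move=> bF; split; first by apply: measurable_sum => i; case: (bF i).
have /choice[M HM] := fun i => (bF i).2.
by exists (\sum_i M i) => y; apply: le_trans (ler_norm_sum _ _ _) _; apply: ler_sum => i _.
Qed.

Lemma EDD F G : bmf F -> bmf G -> ED (fun y => F y + G y) = ED F + ED G.
Proof. by move=> bF bG; rewrite /ED RintegralD//; exact: bmf_integrable. Qed.

Lemma EDZ c F : bmf F -> ED (fun y => c * F y) = c * ED F.
Proof. by move=> bF; rewrite /ED RintegralZl//; exact: bmf_integrable. Qed.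

Lemma ED_cst c : ED (fun _ => c) = c.
Proof.
by rewrite /ED Rintegral_cst//= probability_setT/= mulr1.
Qed.

Lemma ED_le F G : bmf F -> bmf G -> (forall y, F y <= G y) -> ED F <= ED G.
Proof. by move=> bF bG FG; apply: le_Rintegral => //; exact: bmf_integrable. Qed.

Lemma ED_sum (I : finType) (F : I -> Y -> R) :
  (forall i, bmf (F i)) -> ED (fun y => \sum_i F i y) = \sum_i ED (F i).
Proof.
move=> bF; elim: (index_enum I) => [|i s IH].
  by rewrite big_nil -[RHS](ED_cst 0); congr ED; apply/funext => y; rewrite big_nil.
rewrite big_cons -IH -EDD//; first by congr ED; apply/funext => y; rewrite big_cons.
split; first by apply: measurable_sum => j; case: (bF j).
have /choice[M HM] := fun i => (bF i).2.
by exists (\sum_(j <- s) M j) => y; apply: le_trans (ler_norm_sum _ _ _) _; apply: ler_sum => j _.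
Qed.

Lemma ED_ereal F : bmf F -> (\int[D]_y (F y)%:E = (ED F)%:E)%E.
Proof.
by move=> bF; rewrite /ED /Rintegral fineK//; apply: integrable_fin_num => //; exact: bmf_integrable.
Qed.

End expectation.

Section sampled_value.
Context {R : realType} {K : nat} dX {X : measurableType dX} {Pi : finType}.
Notation Y := (X * K.-tuple R)%type.
Variables (D : probability Y R) (pol : Pi -> X -> 'I_K).
Hypothesis mpol : forall pi a, measurable (pol pi @^-1` [set a]).
Implicit Types (Q W : @weights R Pi) (mu : R).

Definition inv_smoothed Q mu pi x : R := (smoothed pol Q mu (pol pi x) x)^-1.

Lemma inv_smoothed_ge0 Q mu pi x : (forall pi, 0 <= Q pi) -> 0 < mu ->
  K%:R * mu <= 1 -> 0 <= inv_smoothed Q mu pi x.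
Proof.
by move=> Q0 mu0 k1; rewrite invr_ge0; apply: le_trans (ltW mu0) _; exact: smoothed_ge.
Qed.

Lemma inv_smoothed_le Q mu pi x : (forall pi, 0 <= Q pi) -> 0 < mu ->
  K%:R * mu <= 1 -> inv_smoothed Q mu pi x <= mu^-1.
Proof.
move=> Q0 mu0 k1; have h := smoothed_ge pol (pol pi x) x Q0 k1.
by rewrite lef_pV2 ?posrE//; apply: lt_le_trans h.
Qed.

Lemma bmf_inv_smoothed Q mu pi : (forall pi, 0 <= Q pi) -> 0 < mu ->
  K%:R * mu <= 1 -> bmf (fun y : Y => inv_smoothed Q mu pi y.1).
Proof.
move=> Q0 mu0 k1; split.
  apply: measurable_funV.
  apply: (@measurable_smoothed _ Y R K _ X Pi pol mpol (fun _ => Q) mu (fun y => pol pi y.1) fst) => //.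
  move=> a; rewrite -[X in measurable X]setTI.
  have mf : measurable_fun setT (fst : Y -> X) by exact: measurable_fst.
  exact: (mf measurableT _ (mpol pi a)).
exists mu^-1 => y; rewrite ger0_norm; first exact: inv_smoothed_le.
exact: inv_smoothed_ge0.
Qed.

Lemma bmf_EM W M (F : seq Pi -> Y -> R) : (forall s, bmf (F s)) ->
  bmf (fun y => EM W M (F ^~ y)).
Proof.
elim: M F => [|M IH] F bF /=; first exact: bF.
by apply: bmf_sum => pi; apply: bmfZ; apply: (IH (fun s => F (pi :: s))).
Qed.

Lemma ED_EM W M (F : seq Pi -> Y -> R) : (forall s, bmf (F s)) ->
  ED D (fun y => EM W M (F ^~ y)) = EM W M (fun s => ED D (F s)).
Proof.
elim: M F => [|M IH] F bF //=.
have b pi : bmf (fun y => EM W M (fun s => F (pi :: s) y)).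
  exact: (@bmf_EM W M (fun s => F (pi :: s))).
rewrite ED_sum; last by move=> pi; exact: bmfZ.
by apply: eq_bigr => pi _; rewrite EDZ// (IH (fun s => F (pi :: s))).
Qed.

Lemma ctx_mean_EM W M (H : seq (@obs R K X)) (F : seq Pi -> X -> R) :
  ctx_mean H (fun x => EM W M (F ^~ x)) = EM W M (fun s => ctx_mean H (F s)).
Proof.
elim: M F => [|M IH] F //=.
under [RHS]eq_bigr => pi _ do rewrite -(IH (fun s => F (pi :: s))).
rewrite /ctx_mean exchange_big/= mulr_sumr; apply: eq_bigr => pi _.
by rewrite -mulr_sumr mulrCA.
Qed.

(** The comparison, assumed for all empirical weights of [M] draws, is averaged over draws from [W].
    [EM_inv_ge] recovers [W] on the side of [D], [EM_inv_le] on the side of the history, and 6 = 2 *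
    3. *)
Lemma sampled_value W mu M (H : seq (@obs R K X)) (C : R) pi :
  (forall pi, 0 <= W pi) -> \sum_pi W pi = 1 -> 0 < mu -> K%:R * mu <= 2^-1 ->
  1 <= M%:R * mu ->
  (forall s : seq Pi, size s = M ->
     ED D (fun y => inv_smoothed (empirical_weights M s) mu pi y.1) <=
     2 * ctx_mean H (inv_smoothed (empirical_weights M s) mu pi) + C) ->
  ED D (fun y => inv_smoothed W mu pi y.1) <= 6 * ctx_mean H (inv_smoothed W mu pi) + C.
Proof.
move=> W0 W1 mu0 mu2 M1 HC.
have k1 : K%:R * mu <= 1 by lra.
pose F s (y : Y) := inv_smoothed (empirical_weights M s) mu pi y.1.
have bF s : bmf (F s) by apply: bmf_inv_smoothed => // pi'; exact: empirical_weights_ge0.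
apply: (@le_trans _ _ (ED D (fun y => EM W M (F ^~ y)))).
  apply: ED_le; [exact: bmf_inv_smoothed|exact: bmf_EM|].
  by move=> y; apply: EM_inv_ge.
rewrite ED_EM//; apply: le_trans (EM_le W0 HC) _.
rewrite EMD EM_cst// EMZ -ctx_mean_EM lerD2r.
have -> : 6 * ctx_mean H (inv_smoothed W mu pi) = 2 * (3 * ctx_mean H (inv_smoothed W mu pi)) by ring.
rewrite ler_pM2l// -ctx_meanZ; apply: ctx_mean_le => x; exact: EM_inv_le.
Qed.

End sampled_value.

(** * Epoch schedule *)

Lemma tauE m : (2 < m)%N -> tau m = (m ^ 2)%N.
Proof. by case: m => [|[|[|m]]]. Qed.

Lemma tau_double m : (0 < m)%N -> (tau m.+1 <= 2 * tau m)%N.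
Proof.
case: m => [|[|[|m]]] // _.
rewrite !tauE //; set k := m; rewrite !expnS !expn0 !muln1; nia.
Qed.

Lemma tau_lt m : (tau m < tau m.+1)%N.
Proof. by case: m => [|[|[|m]]] //; rewrite !tauE // ltn_exp2r. Qed.

Lemma tau_mono : {mono tau : m n / (m <= n)%N}.
Proof. by apply: leq_mono; apply: (homo_ltn ltn_trans); exact: tau_lt. Qed.

Lemma tau_ltmono : {mono tau : m n / (m < n)%N}.
Proof. by apply: leqW_mono; exact: tau_mono. Qed.

Lemma tau_ge_sqr m : (m ^ 2 <= tau m)%N.
Proof. by case: m => [|[|[|m]]]. Qed.

Lemma tau_gt0 m : (0 < m)%N -> (0 < tau m)%N.
Proof. by case: m => [|[|[|m]]]. Qed.

Section schedule.
Context {R : realType} (K : nat) (Pi : finType) (delta : R).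
Hypothesis K0 : (0 < K)%N.
Hypothesis Pi0 : (0 < #|Pi|)%N.
Hypothesis delta01 : 0 < delta < 1.

Local Notation v := (@ln R (#|Pi|%:R / delta)).
Local Notation mu m := (@mu_ R K Pi delta m).
Local Notation natR n := (@GRing.natmul R 1 n).
Local Notation tauR m := (natR (tau m)).

Definition Lg m : R := ln (16 * tauR m ^+ 2 * #|Pi|%:R / delta).
(* The epochs whose minimum probability is the square root; there
   [K tau_m mu_m ^ 2 = Lg m]. *)
Definition normal m := mu m < (2 * K%:R)^-1.

Let delta0 : 0 < delta. Proof. by case/andP: delta01. Qed.
Let K0R : 0 < natR K. Proof. by rewrite ltr0n. Qed.
Let tau0R m : (0 < m)%N -> 0 < tauR m. Proof. by move=> m0; rewrite ltr0n tau_gt0. Qed.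
Let Pi0R : 1 <= natR #|Pi|. Proof. by rewrite ler1n. Qed.

Lemma v_gt0 : 0 < v.
Proof.
rewrite ln_gt0// ltr_pdivlMr// mul1r; apply: lt_le_trans Pi0R; by case/andP: delta01.
Qed.

Lemma ln16_bounds : 2 <= @ln R 16 <= 4.
Proof.
have -> : ln 16 = 4 * ln 2 :> R.
  have -> : 16 = 2 ^+ 4 :> R by rewrite -natrX.
  by rewrite lnXn// mulr_natl.
have h2 : ln 2 <= 1 :> R.
  by have := @ln_le_sub1 R 2; rewrite ltr0n => /(_ isT); lra.
have : ln 2^-1 <= 2^-1 - 1 :> R by apply: ln_le_sub1.
by rewrite lnV ?posrE//; lra.
Qed.

Lemma LgE m : (0 < m)%N -> Lg m = ln 16 + 2 * ln (tauR m) + v.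
Proof.
move=> m0; rewrite /Lg; have t0 := tau0R m0; have p0 : 0 < natR #|Pi| by rewrite ltr0n.
have t2 : 0 < tauR m ^+ 2 by rewrite exprn_gt0.
have t3 : 0 < 16 * tauR m ^+ 2 by rewrite mulr_gt0.
have p1 : 0 < #|Pi|%:R / delta by rewrite divr_gt0.
have -> : 2 * ln (tauR m) = ln (tauR m ^+ 2) by rewrite lnXn// mulr_natl.
by rewrite -mulrA [LHS]lnM ?posrE// [ln (16 * _)]lnM ?posrE.
Qed.

Lemma Lg_ge m : (0 < m)%N -> 2 + v <= Lg m.
Proof.
move=> m0; rewrite LgE//; have /andP[h _] := ln16_bounds.
have : 0 <= ln (tauR m) by rewrite ln_ge0// ler1n tau_gt0.
by lra.
Qed.

Lemma Lg_gt0 m : (0 < m)%N -> 0 < Lg m.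
Proof. by move=> m0; have := Lg_ge m0; have := v_gt0; lra. Qed.

Lemma Lg_le m n : (0 < m)%N -> (m <= n)%N -> Lg m <= Lg n.
Proof.
move=> m0 mn; rewrite !LgE//; last exact: leq_trans mn.
rewrite lerD2r lerD2l ler_pM2l// ler_ln ?posrE ?tau0R//; last exact: leq_trans mn.
by rewrite ler_nat tau_mono.
Qed.

Lemma muE m : (0 < m)%N -> mu m = Num.min (2 * K%:R)^-1 (Num.sqrt (Lg m / (K%:R * tauR m))).
Proof. by case: m. Qed.

Lemma mu_gt0 m : 0 < mu m.
Proof.
have h : 0 < (2 * natR K)^-1 by rewrite invr_gt0 mulr_gt0.
case: m => [|m]; first exact: h.
rewrite muE// lt_min h sqrtr_gt0 divr_gt0 ?Lg_gt0// mulr_gt0//; exact: tau0R.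
Qed.

Lemma mu_le m : mu m <= (2 * K%:R)^-1.
Proof. by case: m => [|m] //; rewrite muE// ge_min lexx. Qed.

Lemma Kmu_le m : K%:R * mu m <= 2^-1.
Proof.
have := mu_le m; rewrite invfM -(ler_pM2l K0R) mulrCA mulfV ?mulr1//; by rewrite gt_eqF.
Qed.

Lemma mu_not_normal m : ~~ normal m -> mu m = (2 * K%:R)^-1.
Proof. by rewrite -leNgt => h; apply/eqP; rewrite eq_le mu_le h. Qed.

Lemma normal0 : ~~ normal 0. Proof. by rewrite /normal ltxx. Qed.

Lemma normal_mu m : normal m -> mu m = Num.sqrt (Lg m / (K%:R * tauR m)).
Proof.
case: m => [|m]; first by rewrite (negbTE normal0).
by rewrite /normal muE// gt_min ltxx /= => h; rewrite min_r// ltW.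
Qed.

Lemma normal_gt0 m : normal m -> (0 < m)%N.
Proof. by case: m => // /(negP normal0). Qed.

Lemma normal_mu2 m : normal m -> K%:R * tauR m * mu m ^+ 2 = Lg m.
Proof.
move=> nm; have m0 := normal_gt0 nm; have t0 := tau0R m0.
rewrite normal_mu// sqr_sqrtr; last by rewrite divr_ge0 ?mulr_ge0 ?(ltW (Lg_gt0 m0))// ltW.
by field; rewrite !gt_eqF.
Qed.

(** By [ln x <= x - 1], [Lg] gains at most [2 (tau_n / tau_m - 1)]; since [Lg m >= 2] this is less
    than proportional growth. It makes [mu_] non-increasing. *)
Lemma Lg_ratio m n : (0 < m)%N -> (m <= n)%N -> Lg n / tauR n <= Lg m / tauR m.
Proof.
move=> m0 mn; have n0 : (0 < n)%N by exact: leq_trans mn.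
have tm := tau0R m0; have tn := tau0R n0.
have tmn : tauR m <= tauR n by rewrite ler_nat tau_mono.
have Lm : 2 <= Lg m by have := Lg_ge m0; have := v_gt0; lra.
rewrite ler_pdivrMr// mulrAC ler_pdivlMr//.
have lx : ln (tauR n) <= ln (tauR m) + (tauR n / tauR m - 1).
  rewrite -[X in ln X <= _](divfK (lt0r_neq0 tm)) mulrC lnM ?posrE ?divr_gt0//.
  by rewrite lerD2l ln_le_sub1// divr_gt0.
have : Lg n <= Lg m + 2 * (tauR n / tauR m - 1).
  by rewrite !LgE//; lra.
move=> /(ler_wpM2r (ltW tm)) /le_trans; apply.
have -> : (Lg m + 2 * (tauR n / tauR m - 1)) * tauR m = Lg m * tauR m + 2 * (tauR n - tauR m).
  by field; rewrite gt_eqF.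
have : 0 <= (Lg m - 2) * (tauR n - tauR m) by rewrite mulr_ge0 ?subr_ge0.
by lra.
Qed.

Lemma mu_mono m n : (m <= n)%N -> mu n <= mu m.
Proof.
case: m => [|m] mn; first exact: mu_le.
have n0 : (0 < n)%N by exact: leq_trans mn.
rewrite !muE// le_min ge_min lexx/= ge_min; apply/orP; right.
rewrite ler_sqrt; last by rewrite divr_ge0 ?(ltW (Lg_gt0 _))// mulr_ge0.
by rewrite [K%:R * _]mulrC [K%:R * _]mulrC !invfM !mulrA ler_pM2r ?invr_gt0//; exact: Lg_ratio.
Qed.

Lemma normal_mono m n : (m <= n)%N -> normal m -> normal n.
Proof. by move=> mn; apply: le_lt_trans; exact: mu_mono. Qed.

End schedule.

(** * Growth of the potential between epochs *)

Section potential.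
Context {R : realType} {K : nat} {X : Type} {Pi : finType}.
Variables (pol : Pi -> X -> 'I_K) (amo : seq (X * K.-tuple R) -> Pi).
Hypothesis K0 : (0 < K)%N.
Hypothesis amoP : is_AMO pol amo.
Notation kappa mu := (K%:R * mu).
Implicit Types (Q : @weights R Pi) (x : X) (mu : R) (H : seq (@obs R K X)).
Notation nonneg Q := (forall pi, 0 <= Q pi).
Notation good H := (all (fun h => (0 <= obs_rew h) && (0 < obs_prob h)) H).

Let K0R : 0 < @GRing.natmul R 1 K. Proof. by rewrite ltr0n. Qed.

Lemma ent_le Q mu x : nonneg Q -> \sum_pi Q pi <= 1 -> 0 < mu -> kappa mu <= 2^-1 ->
  ent pol Q mu x <= - (2 * ln (kappa mu)).
Proof.
move=> Q0 Q1 mu0 k2; have k0 : 0 < kappa mu by rewrite mulr_gt0.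
have lk : ln (kappa mu) <= 0 by apply: ln_le0; lra.
have k1 : kappa mu <= 1 by lra.
have k1' : 0 < 1 - kappa mu by lra.
have LL : K%:R * ln (kappa mu) <= \sum_a ln (K%:R * smoothed pol Q mu a x).
  have <- : \sum_(a < K) ln (kappa mu) = K%:R * ln (kappa mu) by rewrite sumr_const card_ord -[LHS]mulr_natl.
  apply: ler_sum => a _.
  have h : mu <= smoothed pol Q mu a x by exact: smoothed_ge.
  have s0 : 0 < smoothed pol Q mu a x by exact: lt_le_trans h.
  have Ks0 : 0 < K%:R * smoothed pol Q mu a x by exact: mulr_gt0.
  by rewrite ler_ln ?posrE// ler_pM2l.
rewrite /ent; set L := \sum_a _ in LL *.
have : (K%:R * (1 - kappa mu))^-1 * (K%:R * ln (kappa mu)) <= (K%:R * (1 - kappa mu))^-1 * L.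
  by rewrite ler_wpM2l// invr_ge0 mulr_ge0// ltW.
have -> : (K%:R * (1 - kappa mu))^-1 * (K%:R * ln (kappa mu)) = (1 - kappa mu)^-1 * ln (kappa mu).
  by field; rewrite !gt_eqF.
have : 2 * ln (kappa mu) <= (1 - kappa mu)^-1 * ln (kappa mu).
  rewrite -subr_ge0 -mulrBl -mulrNN mulr_ge0 ?oppr_ge0//.
  rewrite subr_le0 -[leRHS]invrK lef_pV2 ?posrE ?invr_gt0//; lra.
by lra.
Qed.

(** Lowering [mu] shrinks a smoothed weight by at most the factor [mu' / mu], so [(1 - K mu) ent], a
    relative entropy when the mass is 1, grows by at most [ln (mu / mu')]. The factor
    [mu / (1 - K mu)] in front of it is monotone and at most [2 mu]. *)
Lemma ent_mono Q mu mu' x : nonneg Q -> \sum_pi Q pi <= 1 -> 0 < mu' -> mu' <= mu ->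
  kappa mu <= 2^-1 -> mu' * ent pol Q mu' x <= mu * ent pol Q mu x + 2 * mu * ln (mu / mu').
Proof.
move=> Q0 Q1 mu'0 mumu k2; have mu0 : 0 < mu by exact: lt_le_trans mumu.
have kk : kappa mu' <= kappa mu by rewrite ler_pM2l.
have k0 : 0 < kappa mu by rewrite mulr_gt0.
have k1 : 0 < 1 - kappa mu by lra.
have k1' : 0 < 1 - kappa mu' by lra.
pose RE m := (1 - kappa m) * ent pol Q m x.
have RE'0 : 0 <= RE mu'.
  by rewrite /RE mulr_ge0 ?(ltW k1')// ent_ge0//; lra.
have entE m : 0 < 1 - kappa m -> m * ent pol Q m x = m / (1 - kappa m) * RE m.
  by move=> m1; rewrite /RE; field; rewrite gt_eqF.
have lm0 : 0 <= ln (mu / mu').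
  by rewrite ln_ge0// ler_pdivlMr// mul1r.
have REd : RE mu' <= RE mu + ln (mu / mu').
  have REE m : 0 < 1 - kappa m -> RE m = (1 - kappa m) * (\sum_pi Q pi - 1) -
      K%:R^-1 * \sum_a ln (K%:R * smoothed pol Q m a x).
    by move=> m1; rewrite /RE /ent; field; rewrite !gt_eqF.
  rewrite !REE//.
  set L := \sum_a ln (K%:R * smoothed pol Q mu a x).
  set L' := \sum_a ln (K%:R * smoothed pol Q mu' a x).
  have LL : L - L' <= K%:R * ln (mu / mu').
    rewrite /L /L' -sumrB.
    have <- : \sum_(a < K) ln (mu / mu') = K%:R * ln (mu / mu') by rewrite sumr_const card_ord -[LHS]mulr_natl.
    apply: ler_sum => a _.
    have s0 : 0 < smoothed pol Q mu a x.
      by apply: lt_le_trans mu0 _; apply: smoothed_ge => //; lra.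
    have s'0 : 0 < smoothed pol Q mu' a x.
      by apply: lt_le_trans mu'0 _; apply: smoothed_ge => //; lra.
    have Ks0 : 0 < K%:R * smoothed pol Q mu a x by exact: mulr_gt0.
    have Ks'0 : 0 < K%:R * smoothed pol Q mu' a x by exact: mulr_gt0.
    have d1 := divr_gt0 Ks0 Ks'0; have d2 := divr_gt0 mu0 mu'0.
    rewrite -ln_div ?posrE// ler_ln ?posrE// ler_pdivrMr//.
    have -> : mu / mu' * (K%:R * smoothed pol Q mu' a x) = K%:R * (mu / mu' * smoothed pol Q mu' a x) by ring.
    rewrite ler_pM2l// /smoothed; set q := act_weight _ _ _ _.
    have q0 : 0 <= q by exact: act_weight_ge0.
    have -> : mu / mu' * ((1 - kappa mu') * q + mu') = mu / mu' * ((1 - kappa mu') * q) + mu.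
      by field; rewrite gt_eqF.
    rewrite lerD2r; apply: (@le_trans _ _ ((1 - kappa mu') * q)).
      by apply: ler_wpM2r => //; lra.
    rewrite ler_peMl ?mulr_ge0 ?(ltW k1')// ler_pdivlMr// mul1r//.
  have : K%:R^-1 * (L - L') <= ln (mu / mu').
    by rewrite mulrC ler_pdivrMr// [leRHS]mulrC.
  have : 0 <= (kappa mu - kappa mu') * (1 - \sum_pi Q pi) by rewrite mulr_ge0 ?subr_ge0.
  by lra.
rewrite !entE//.
have fr : mu' / (1 - kappa mu') <= mu / (1 - kappa mu).
  apply: ler_pM => //; rewrite ?invr_ge0 ?(ltW mu'0) ?(ltW k1')//.
  by rewrite lef_pV2 ?posrE//; lra.
have fr2 : mu / (1 - kappa mu) <= 2 * mu.
  by rewrite ler_pdivrMr//; have : 0 <= mu * (1 - 2 * kappa mu); [rewrite mulr_ge0 ?(ltW mu0)//|]; lra.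
apply: (@le_trans _ _ (mu / (1 - kappa mu) * RE mu')); first exact: ler_wpM2r.
have f0 : 0 <= mu / (1 - kappa mu) by rewrite divr_ge0 ?(ltW mu0) ?(ltW k1).
apply: le_trans (ler_wpM2l f0 REd) _.
by rewrite mulrDr lerD2l ler_wpM2r.
Qed.

Definition ips_sum H pi : R := \sum_(h <- H) ips h (pol pi (obs_ctx h)).

Definition best_sum H : R := ips_sum H (best_policy amo H).

Lemma ips_sum_cat H1 H2 pi : ips_sum (H1 ++ H2) pi = ips_sum H1 pi + ips_sum H2 pi.
Proof. by rewrite /ips_sum big_cat. Qed.

Lemma emp_rewardE H pi : (0 < size H)%N -> (size H)%:R * emp_reward pol H pi = ips_sum H pi.
Proof. by move=> H0; rewrite /emp_reward mulrA mulfV ?mul1r// pnatr_eq0 -lt0n. Qed.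

Lemma best_sumP H pi : (0 < size H)%N -> good H -> ips_sum H pi <= best_sum H.
Proof.
move=> H0 gH; rewrite /best_sum -!emp_rewardE// ler_pM2l ?ltr0n//.
exact: best_policyP.
Qed.

(** The constant 200 is 2 [psi]; the factor [mu] of the regret part has cancelled. *)
Definition Phi H mu Q : R := mu * (\sum_(h <- H) ent pol Q mu (obs_ctx h)) +
  (200 * K%:R)^-1 * \sum_pi Q pi * (best_sum H - ips_sum H pi).

Lemma PhiE H mu Q : (0 < size H)%N -> 0 < mu ->
  (size H)%:R * mu * phi pol amo H mu Q = Phi H mu Q.
Proof.
move=> H0 mu0; have t0 : (size H)%:R != 0 :> R by rewrite pnatr_eq0 -lt0n.
rewrite /phi /Phi mulrDr; congr (_ + _).
  by rewrite /ctx_mean; field.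
have -> : \sum_pi Q pi * (best_sum H - ips_sum H pi) =
    (size H)%:R * (psi * mu) * \sum_pi Q pi * b_ pol amo H mu pi.
  rewrite mulr_sumr; apply: eq_bigr => pi _.
  by rewrite /b_ /emp_regret /best_sum -!emp_rewardE//; field; rewrite gt_eqF.
by rewrite /psi; field; rewrite !gt_eqF.
Qed.

Definition complete Q (l : Pi) pi : R := Q pi + (1 - \sum_pi' Q pi') * @unit_mass R Pi l pi.

Lemma sum_unit_mass l (f : Pi -> R) : \sum_pi @unit_mass R Pi l pi * f pi = f l.
Proof.
rewrite (bigD1 l)//= big1 ?addr0 ?ffunE ?eqxx ?mul1r// => i /negbTE il.
by rewrite ffunE il mul0r.
Qed.

Lemma sum_complete Q l (f : Pi -> R) :
  \sum_pi complete Q l pi * f pi = \sum_pi Q pi * f pi + (1 - \sum_pi Q pi) * f l.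
Proof.
under eq_bigr do rewrite /complete mulrDl -mulrA.
by rewrite big_split/= -mulr_sumr sum_unit_mass.
Qed.

Lemma mass_complete Q l : \sum_pi complete Q l pi = 1.
Proof.
have := sum_complete Q l (fun _ => 1); rewrite mulr1.
under eq_bigr do rewrite mulr1; move=> ->; under eq_bigr do rewrite mulr1.
by ring.
Qed.

Lemma complete_ge Q l pi : \sum_pi Q pi <= 1 -> Q pi <= complete Q l pi.
Proof.
by move=> Q1; rewrite lerDl mulr_ge0 ?subr_ge0// ffunE; case: eqP.
Qed.

(** In the regret part [Q] may be completed by the leader of [H]: this adds nothing on [H], where
    the leader has regret zero, and something non-negative on the longer history. With total mass 1
    the best rewards then come out of the sums. *)
Lemma Phi_step H Hn mu mu' Q : (0 < size H)%N -> good (H ++ Hn) -> nonneg Q ->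
  \sum_pi Q pi <= 1 -> 0 < mu' -> mu' <= mu -> kappa mu <= 2^-1 ->
  Phi (H ++ Hn) mu' Q <= Phi H mu Q + (size H)%:R * (2 * mu * ln (mu / mu')) +
    (size Hn)%:R * (mu' * - (2 * ln (kappa mu'))) +
    (200 * K%:R)^-1 * (best_sum (H ++ Hn) - best_sum H -
      \sum_pi complete Q (best_policy amo H) pi * ips_sum Hn pi).
Proof.
move=> H0 gHH Q0 Q1 mu'0 mumu k2; set l := best_policy amo H.
have kk : kappa mu' <= kappa mu by rewrite ler_pM2l.
have entO : mu' * (\sum_(h <- H) ent pol Q mu' (obs_ctx h)) <=
    mu * (\sum_(h <- H) ent pol Q mu (obs_ctx h)) + (size H)%:R * (2 * mu * ln (mu / mu')).
  have -> : (size H)%:R * (2 * mu * ln (mu / mu')) = \sum_(h <- H) (2 * mu * ln (mu / mu')).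
    by rewrite big_const_seq count_predT iter_addr_0 -[RHS]mulr_natl.
  rewrite !mulr_sumr -big_split/=; apply: ler_sum => h _; exact: ent_mono.
have entN : mu' * (\sum_(h <- Hn) ent pol Q mu' (obs_ctx h)) <=
    (size Hn)%:R * (mu' * - (2 * ln (kappa mu'))).
  have -> : (size Hn)%:R * (mu' * - (2 * ln (kappa mu'))) = \sum_(h <- Hn) (mu' * - (2 * ln (kappa mu'))).
    by rewrite big_const_seq count_predT iter_addr_0 -[RHS]mulr_natl.
  rewrite mulr_sumr; apply: ler_sum => h _; rewrite ler_pM2l//; apply: ent_le => //; lra.
have H'0 : (0 < size (H ++ Hn))%N by rewrite size_cat ltn_addr.
have reg : \sum_pi Q pi * (best_sum (H ++ Hn) - ips_sum (H ++ Hn) pi) <=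
    \sum_pi Q pi * (best_sum H - ips_sum H pi) + (best_sum (H ++ Hn) - best_sum H -
      \sum_pi complete Q l pi * ips_sum Hn pi).
  apply: (@le_trans _ _ (\sum_pi complete Q l pi * (best_sum (H ++ Hn) - ips_sum (H ++ Hn) pi))).
    apply: ler_sum => pi _; apply: ler_wpM2r; last exact: complete_ge.
    by rewrite subr_ge0 best_sumP.
  have -> : \sum_pi Q pi * (best_sum H - ips_sum H pi) =
      \sum_pi complete Q l pi * (best_sum H - ips_sum H pi).
    by rewrite sum_complete /best_sum -/l subrr mulr0 addr0.
  have sp (c : R) (f : Pi -> R) : \sum_pi complete Q l pi * (c - f pi) =
      c - \sum_pi complete Q l pi * f pi.
    under eq_bigr do rewrite mulrBr.
    by rewrite sumrB -mulr_suml mass_complete mul1r.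
  rewrite !sp; under eq_bigr do rewrite ips_sum_cat mulrDr.
  by rewrite big_split/=; lra.
rewrite /Phi big_cat/= mulrDr.
have r0 : 0 <= (200 * K%:R)^-1 :> R by rewrite invr_ge0 mulr_ge0 ?ler0n.
have := ler_wpM2l r0 reg; rewrite mulrDr.
lra.
Qed.

End potential.

(** * Regret and number of updates *)

Section deterministic.
Context {R : realType} {K : nat} {dX : measure_display} {X : measurableType dX} {Pi : finType}.
Variables (pol : Pi -> X -> 'I_K) (amo : seq (X * K.-tuple R) -> Pi) (delta : R).
Hypothesis K0 : (0 < K)%N.
Hypothesis amoP : is_AMO pol amo.
Variable pi0 : Pi.
Hypothesis delta01 : 0 < delta < 1.
Notation natR n := (@GRing.natmul R 1 n).
Notation tauR m := (natR (tau m)).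
Notation mu m := (@mu_ R K Pi delta m).
Notation Lg m := (@Lg R Pi delta m).
Notation normal m := (@normal R K Pi delta m).
Notation nonneg Q := (forall pi, 0 <= Q pi).

Variables (o : nat -> @obs R K X) (N : nat) (Q : nat -> @weights R Pi) (k : nat -> nat).
Definition hist n : seq (@obs R K X) := [seq o i | i <- iota 0 n].
Notation H m := (hist (tau m)).
Definition batch j : seq (@obs R K X) := [seq o i | i <- iota (tau j) (tau j.+1 - tau j)].
Notation lead m := (best_policy amo (H m)).
(* [played 0] uses the answer of the oracle on the empty history instead of the
   initial leader; only epochs with [normal m], hence [0 < m], matter. *)
Definition played m := complete (Q m) (lead m).

Hypothesis o_pos : forall t, (t < tau N)%N -> (0 <= obs_rew (o t)) && (0 < obs_prob (o t)).
Hypothesis Q0 : Q 0 = [ffun=> 0].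
Hypothesis cdE : forall m, (m < N)%N ->
  coord_descent pol amo (H m.+1) (mu m.+1) (Q m) = Some (Q m.+1, (k m.+1).+2).
(** [Rw] stands for the true rewards and [VD j] for the conditional variance proxy E_D[1/Q^mu] in a
    round of epoch [j]. [G1] is the deviation of the estimates and [G2] the transfer of the
    variances to the data, both on the good event. *)
Variables (Rw : Pi -> R) (VD : nat -> Pi -> R).
Hypothesis VD_le : forall j pi, (j < N)%N -> VD j pi <= (mu j)^-1.
Hypothesis G1 : forall m pi, (m <= N)%N -> normal m ->
  `|ips_sum pol (H m) pi - tauR m * Rw pi| <=
  mu m * (\sum_(j < m) natR (tau j.+1 - tau j) * VD j pi) + 2 * Lg m / mu m.
Hypothesis G2 : forall m pi, (m < N)%N -> normal m ->
  VD m pi <= 6 * ctx_mean (H m) (inv_smoothed pol [ffun pi => played m pi] (mu m) pi) + 8 * K%:R.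

Let Pi0 : (0 < #|Pi|)%N. Proof. by apply/card_gt0P; exists pi0. Qed.
Let K0R : 0 < natR K. Proof. by rewrite ltr0n. Qed.
Let mu0 m : 0 < mu m. Proof. exact: mu_gt0. Qed.
Let Kmu m : natR K * mu m <= 2^-1. Proof. exact: Kmu_le. Qed.

Lemma size_hist n : size (hist n) = n.
Proof. by rewrite size_map size_iota. Qed.

Lemma hist_batch m : H m.+1 = H m ++ batch m.
Proof.
by rewrite /hist /batch -map_cat -iotaD subnKC// ltnW// tau_lt.
Qed.

Lemma hist_good m : (m <= N)%N ->
  all (fun h => (0 <= obs_rew h) && (0 < obs_prob h)) (H m).
Proof.
move=> mN; rewrite all_map; apply/allP => i; rewrite mem_iota add0n /= => im.
by apply: o_pos; apply: leq_trans im _; rewrite tau_mono.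
Qed.

Lemma Qfacts m : (m <= N)%N -> [/\ nonneg (Q m), \sum_pi Q m pi <= 1 &
  (0 < m)%N -> \sum_pi Q m pi * (2 * K%:R + b_ pol amo (H m) (mu m) pi) <= 2 * K%:R /\
    forall pi, D_ pol amo (H m) (mu m) pi (Q m) <= 0].
Proof.
elim: m => [_|m IH mN].
  by rewrite Q0; split => // [pi|]; [rewrite ffunE|rewrite big1// => pi _; rewrite ffunE].
have [Qm _ _] := IH (ltnW mN).
have sz : (0 < size (H m.+1))%N by rewrite size_hist tau_gt0.
have [Q' [n [E Q'0 cost Dle _]]] := coord_descentP K0 amoP sz (mu0 m.+1) (Kmu m.+1) (hist_good mN) Qm.
move: E Q'0 cost Dle; rewrite cdE// => -[<- _] Q'0 cost Dle.
split=> //; apply: (cost_mass K0 amoP (mu0 m.+1) (hist_good mN)) => //.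
Qed.

Lemma not_normal_zero m : (m <= N)%N -> ~~ normal m -> Q m = [ffun=> 0] /\ ((0 < m)%N -> k m = 0%N).
Proof.
elim: m => [|m IH] mN; first by rewrite Q0.
move=> nn; have nm : ~~ normal m.
  by apply: contra nn; exact: (normal_mono K0 Pi0 delta01).
have [Qm _] := IH (ltnW mN) nm.
have sz : (0 < size (H m.+1))%N by rewrite size_hist tau_gt0.
have muE' : mu m.+1 = (2 * K%:R)^-1 by exact: mu_not_normal.
have := coord_descent_uniform amoP sz (mu0 m.+1) (Kmu m.+1) (hist_good mN) muE'.
have := cdE mN; rewrite Qm => -> [-> ->]; by split.
Qed.

Definition pis := [arg max_(pi > pi0) Rw pi]%O.
Definition Reg pi := Rw pis - Rw pi.

Lemma Reg_ge0 pi : 0 <= Reg pi.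
Proof. by rewrite subr_ge0 /pis; case: arg_maxP => // i _ h; exact: h. Qed.

Lemma Reg_pis : Reg pis = 0.
Proof. exact: subrr. Qed.

Lemma played_nonneg m pi : (m <= N)%N -> 0 <= played m pi.
Proof.
by move=> mN; have [Qm Q1 _] := Qfacts mN; apply: le_trans (Qm pi) (complete_ge _ _ Q1).
Qed.

(** Completing the weights only lowers the inverse probabilities, and the halting test bounds those
    of [Q m] by [2 K + b]; hence 20 = 6 * 2 + 8. *)
Lemma VD_le_b m pi : (m < N)%N -> normal m ->
  VD m pi <= 20 * K%:R + 6 * b_ pol amo (H m) (mu m) pi.
Proof.
move=> mN nm; apply: le_trans (G2 _ mN nm) _.
have m0 := normal_gt0 nm.
have [Qm Q1 /(_ m0)[_ Dle]] := Qfacts (ltnW mN).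
have : ctx_mean (H m) (inv_smoothed pol [ffun pi => played m pi] (mu m) pi) <= V_ pol (H m) (mu m) pi (Q m).
  apply: ctx_mean_le => x; rewrite /inv_smoothed.
  have k1 : K%:R * mu m <= 1 by have := Kmu m; lra.
  have s0 : 0 < smoothed pol (Q m) (mu m) (pol pi x) x.
    by apply: lt_le_trans (mu0 m) _; exact: smoothed_ge.
  have ss : smoothed pol (Q m) (mu m) (pol pi x) x <= smoothed pol [ffun pi => played m pi] (mu m) (pol pi x) x.
    rewrite lerD2r ler_wpM2l ?subr_ge0//; apply: ler_sum => pi' _; rewrite ffunE.
    exact: complete_ge.
  by rewrite lef_pV2 ?posrE//; exact: lt_le_trans ss.
have := Dle pi; rewrite /D_; lra.
Qed.

(** The regret hypothesis gives [b <= K + 2/100 Reg / mu], so [20 K + 6 b] becomes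
    [26 K + 12/100 Reg / mu]; epochs that are not normal have variance at most [2 K]. The term
    [2 Lg / mu] of [G1] is [2 K tau mu], whence 28. *)
Lemma dev_step m : (m <= N)%N -> normal m ->
  (forall j pi, (j < m)%N -> normal j -> emp_regret pol amo (H j) pi <= 2 * Reg pi + 100 * K%:R * mu j) ->
  forall pi, `|emp_reward pol (H m) pi - Rw pi| <= 28 * K%:R * mu m + 12 / 100 * Reg pi.
Proof.
move=> mN nm IH pi; have m0 := normal_gt0 nm.
have t0 : 0 < tauR m by rewrite ltr0n tau_gt0.
have R0 := Reg_ge0 pi.
have Vj (j : 'I_m) : VD j pi <= 26 * K%:R + 12 / 100 * (Reg pi / mu m).
  have mj : mu m <= mu j by apply: (mu_mono K0 Pi0 delta01); exact: ltnW.
  have RR : Reg pi / mu j <= Reg pi / mu m.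
    by apply: ler_wpM2l => //; rewrite lef_pV2 ?posrE.
  have jN : (j < N)%N by exact: leq_trans (ltn_ord j) mN.
  have Rm0 : 0 <= Reg pi / mu m by rewrite divr_ge0 ?(ltW (mu0 m)).
  have [nj|nj] := boolP (normal j).
    apply: le_trans (VD_le_b _ jN nj) _.
    have := IH j pi (ltn_ord j) nj.
    rewrite -(ler_pM2r (_ : 0 < (100 * mu j)^-1)) ?invr_gt0 ?mulr_gt0//.
    have -> : (2 * Reg pi + 100 * K%:R * mu j) * (100 * mu j)^-1 = 2 / 100 * (Reg pi / mu j) + K%:R.
      by field; rewrite gt_eqF.
    have -> : emp_regret pol amo (H j) pi * (100 * mu j)^-1 = b_ pol amo (H j) (mu j) pi by [].
    by have := K0R; lra.
  apply: le_trans (VD_le _ jN) _; rewrite (mu_not_normal nj) invrK.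
  by have := K0R; lra.
have sumV : \sum_(j < m) natR (tau j.+1 - tau j) * VD j pi <=
    tauR m * (26 * K%:R + 12 / 100 * (Reg pi / mu m)).
  have -> : tauR m = \sum_(j < m) natR (tau j.+1 - tau j).
    rewrite -natr_sum -(big_mkord xpredT (fun j => (tau j.+1 - tau j)%N)).
    by rewrite telescope_sumn ?subn0// => i j ij; rewrite tau_mono.
  by rewrite mulr_suml; apply: ler_sum => j _; exact: ler_wpM2l.
have sz : (0 < size (H m))%N by rewrite size_hist tau_gt0.
have := G1 pi mN nm.
rewrite -emp_rewardE// size_hist -mulrBr normrM gtr0_norm//.
rewrite -(normal_mu2 K0 Pi0 delta01 nm) => h.
rewrite -(ler_pM2l t0); apply: le_trans h _.
have -> : 2 * (K%:R * tauR m * mu m ^+ 2) / mu m = tauR m * (2 * K%:R * mu m).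
  by field; rewrite gt_eqF.
have := ler_wpM2l (ltW (mu0 m)) sumV.
have -> : mu m * (tauR m * (26 * K%:R + 12 / 100 * (Reg pi / mu m))) =
  tauR m * (26 * K%:R * mu m + 12 / 100 * Reg pi) by field; rewrite gt_eqF.
by lra.
Qed.

(** A regret is compared through two deviations of size [28 K mu + 12/100 Reg]. Absorbing the regret
    terms leaves factors well below the claimed 2 and 100, so the same constants survive the
    induction. *)
Lemma regret_bounds m : (m <= N)%N -> normal m -> forall pi,
  Reg pi <= 2 * emp_regret pol amo (H m) pi + 100 * K%:R * mu m /\
  emp_regret pol amo (H m) pi <= 2 * Reg pi + 100 * K%:R * mu m.
Proof.
elim/ltn_ind: m => m IH mN nm.
have dev := dev_step mN nm (fun j pi jm nj => (IH j jm (ltnW (leq_trans jm mN)) nj pi).2).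
have gH := hist_good mN.
have sz : (0 < size (H m))%N by rewrite size_hist tau_gt0 ?(normal_gt0 nm).
set u := K%:R * mu m; have u0 : 0 < u by rewrite mulr_gt0.
have dev' pi : `|emp_reward pol (H m) pi - Rw pi| <= 28 * u + 12 / 100 * Reg pi.
  by rewrite /u mulrA.
have part1 pi : Reg pi <= 2 * emp_regret pol amo (H m) pi + 100 * u.
  have := dev' pi; have := dev' pis; rewrite Reg_pis mulr0 addr0 !ler_norml.
  have := best_policyP amoP gH pis.
  have := emp_regret_ge0 amoP gH pi.
  by rewrite /emp_regret /Reg => h1 h2 /andP[h3 h4] /andP[h5 h6]; lra.
move=> pi; rewrite -!mulrA -/u; split; first exact: part1.
have := dev' pi; have := dev' (lead m); rewrite !ler_norml.
have := part1 (lead m); rewrite {1}/emp_regret subrr mulr0 add0r.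
have := Reg_ge0 (lead m); have := Reg_ge0 pi.
by rewrite /emp_regret /Reg => h0 h1 h2 /andP[h3 h4] /andP[h5 h6]; lra.
Qed.

Lemma dev_bound m pi : (m <= N)%N -> normal m ->
  `|ips_sum pol (H m) pi - tauR m * Rw pi| <= tauR m * (28 * K%:R * mu m + 12 / 100 * Reg pi).
Proof.
move=> mN nm; have t0 : 0 < tauR m by rewrite ltr0n tau_gt0// (normal_gt0 nm).
have sz : (0 < size (H m))%N by rewrite size_hist tau_gt0 ?(normal_gt0 nm).
rewrite -emp_rewardE// size_hist -mulrBr normrM gtr0_norm// ler_pM2l//.
apply: dev_step => // j pi' jm nj.
by have [] := regret_bounds (ltnW (leq_trans jm mN)) nj pi'.
Qed.

Notation v := (@ln R (#|Pi|%:R / delta)).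
Notation nn j := (natR (tau j.+1 - tau j)).

Let muM m n : (m <= n)%N -> mu n <= mu m.
Proof. exact: (mu_mono K0 Pi0 delta01). Qed.

(** In a normal epoch [tau (K mu)^2 = K Lg >= 1]. *)
Lemma ln_kappa j : (j <= N)%N -> normal j -> - (2 * ln (K%:R * mu j)) <= ln (tauR N).
Proof.
move=> jN nj; have j0 := normal_gt0 nj.
have t0 : 0 < tauR j by rewrite ltr0n tau_gt0.
have tN : tauR j <= tauR N by rewrite ler_nat tau_mono.
have k0 : 0 < natR K * mu j by rewrite mulr_gt0.
have -> : - (2 * ln (natR K * mu j)) = ln ((natR K * mu j) ^+ 2)^-1.
  by rewrite lnV ?posrE ?exprn_gt0// lnXn// mulr_natl.
have E := normal_mu2 K0 Pi0 delta01 nj.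
have L2 : 1 <= Lg j by have := Lg_ge Pi0 delta01 j0; have := v_gt0 Pi0 delta01; lra.
have K1 : 1 <= natR K by rewrite ler1n.
have h : 1 <= tauR j * (natR K * mu j) ^+ 2.
  have -> : tauR j * (natR K * mu j) ^+ 2 = natR K * (natR K * tauR j * mu j ^+ 2) by ring.
  by rewrite E; nra.
rewrite ler_ln ?posrE ?invr_gt0 ?exprn_gt0//; last exact: lt_le_trans tN.
apply: le_trans tN; rewrite -[leLHS]mul1r ler_pdivrMr ?exprn_gt0//.
Qed.

(** Since [K tau mu^2 = Lg] does not decrease, the square of the ratio of the [mu] is at most the
    ratio of the [tau]; then [ln x <= x - 1]. *)
Lemma mu_ratio j : normal j -> tauR j * (2 * mu j * ln (mu j / mu j.+1)) <= mu j * nn j.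
Proof.
move=> nj; have j0 := normal_gt0 nj.
have nj' : normal j.+1 by exact: (normal_mono K0 Pi0 delta01 (leqnSn j)).
have t0 : 0 < tauR j by rewrite ltr0n tau_gt0.
have t'0 : 0 < tauR j.+1 by rewrite ltr0n tau_gt0.
have E := normal_mu2 K0 Pi0 delta01 nj.
have E' := normal_mu2 K0 Pi0 delta01 nj'.
have LL : Lg j <= Lg j.+1 by exact: (Lg_le Pi0 delta01 j0).
have r0 : 0 < mu j / mu j.+1 by rewrite divr_gt0.
have rr : (mu j / mu j.+1) ^+ 2 <= tauR j.+1 / tauR j.
  rewrite expr_div_n ler_pdivrMr ?exprn_gt0// mulrAC ler_pdivlMr//.
  by rewrite -(ler_pM2l K0R); move: E E' LL; nra.
have l2 : 2 * ln (mu j / mu j.+1) <= tauR j.+1 / tauR j - 1.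
  have -> : 2 * ln (mu j / mu j.+1) = ln ((mu j / mu j.+1) ^+ 2) by rewrite lnXn// mulr_natl.
  apply: le_trans (ln_le_sub1 _) _; first by rewrite exprn_gt0.
  by rewrite lerD2r.
have -> : tauR j * (2 * mu j * ln (mu j / mu j.+1)) = mu j * (tauR j * (2 * ln (mu j / mu j.+1))) by ring.
rewrite ler_pM2l//; apply: le_trans (ler_wpM2l (ltW t0) l2) _.
rewrite natrB; last exact: ltnW (tau_lt j).
by rewrite mulrBr mulr1 mulrC divfK// gt_eqF.
Qed.

(** Equal to [tau_N mu_N] when [N] is normal; the common scale of all error terms. *)
Definition GG := Num.sqrt (Lg N * tauR N / natR K).

Lemma tau_mu_le j : (j <= N)%N -> normal j -> tauR j * mu j <= GG.
Proof.
move=> jN nj; have j0 := normal_gt0 nj.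
have t0 : 0 < tauR j by rewrite ltr0n tau_gt0.
have E := normal_mu2 K0 Pi0 delta01 nj.
have L0 : 0 < Lg N by apply: (Lg_gt0 Pi0 delta01); exact: leq_trans jN.
rewrite -[leLHS]gtr0_norm ?mulr_gt0// -sqrtr_sqr ler_sqrt; last first.
  by rewrite divr_ge0// mulr_ge0// ltW.
rewrite ler_pdivlMr//.
have -> : (tauR j * mu j) ^+ 2 * natR K = Lg j * tauR j by rewrite -E; ring.
apply: ler_pM => //; [exact: ltW (Lg_gt0 Pi0 delta01 j0)|exact: (Lg_le Pi0 delta01 j0)|].
by rewrite ler_nat tau_mono.
Qed.

(** With [s] and [s'] the roots of consecutive [tau], the epoch length is [(s' - s) (s' + s)]. The
    doubling property of the schedule gives [s' + s <= 3 s], and [mu_j s] is at most the root of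
    [Lg N / K]; what remains telescopes. *)
Lemma nn_mu_le j : (j < N)%N -> normal j ->
  mu j * nn j <= 3 * Num.sqrt (Lg N / natR K) * (Num.sqrt (tauR j.+1) - Num.sqrt (tauR j)).
Proof.
move=> jN nj; have j0 := normal_gt0 nj.
have t0 : 0 < tauR j by rewrite ltr0n tau_gt0.
have tt : tauR j <= tauR j.+1 by rewrite ler_nat tau_mono.
set s := Num.sqrt (tauR j); set s' := Num.sqrt (tauR j.+1).
have s0 : 0 < s by rewrite sqrtr_gt0.
have ss : s <= s' by rewrite ler_sqrt.
have sE : s ^+ 2 = tauR j by rewrite sqr_sqrtr// ltW.
have s'E : s' ^+ 2 = tauR j.+1 by rewrite sqr_sqrtr.
have s2 : s' <= 2 * s.
  rewrite -[2 * s]gtr0_norm ?mulr_gt0// -sqrtr_sqr ler_sqrt ?sqr_ge0//.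
  have : tauR j.+1 <= 2 * tauR j by rewrite -natrM ler_nat tau_double.
  by rewrite exprMn sE; lra.
have LN : Lg j <= Lg N by apply: (Lg_le Pi0 delta01 j0); exact: ltnW.
have muE' : mu j * s <= Num.sqrt (Lg N / natR K).
  rewrite (normal_mu nj) -sqrtrM; last by rewrite divr_ge0 ?(ltW (Lg_gt0 Pi0 delta01 j0))// mulr_ge0.
  have -> : Lg j / (natR K * tauR j) * tauR j = Lg j / natR K by field; rewrite !gt_eqF.
  rewrite ler_sqrt ?ler_pM2r ?invr_gt0// divr_ge0//.
  exact: le_trans (ltW (Lg_gt0 Pi0 delta01 j0)) LN.
rewrite natrB; last exact: ltnW (tau_lt j).
rewrite -sE -s'E subr_sqr.
have h1 : mu j * ((s' - s) * (s' + s)) <= mu j * ((s' - s) * (3 * s)).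
  by rewrite ler_pM2l// ler_wpM2l ?subr_ge0//; lra.
apply: le_trans h1 _.
have -> : mu j * ((s' - s) * (3 * s)) = (mu j * s) * (3 * (s' - s)) by ring.
have -> : 3 * Num.sqrt (Lg N / natR K) * (s' - s) = Num.sqrt (Lg N / natR K) * (3 * (s' - s)) by ring.
by rewrite ler_wpM2r// mulr_ge0// subr_ge0.
Qed.

Lemma sum_nn_mu m0 : (m0 <= N)%N -> normal m0 -> \sum_(m0 <= j < N) mu j * nn j <= 3 * GG.
Proof.
move=> m0N n0; have N0 : (0 < N)%N by apply: leq_trans m0N; exact: normal_gt0 n0.
have L0 := Lg_gt0 Pi0 delta01 N0.
apply: (@le_trans _ _ (\sum_(m0 <= j < N) 3 * Num.sqrt (Lg N / natR K) * (Num.sqrt (tauR j.+1) - Num.sqrt (tauR j)))).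
  rewrite big_nat_cond [leRHS]big_nat_cond; apply: ler_sum => j /andP[/andP[mj jN] _].
  apply: nn_mu_le => //; exact: (normal_mono K0 Pi0 delta01 mj).
rewrite -mulr_sumr telescope_sumr//.
have -> : GG = Num.sqrt (Lg N / natR K) * Num.sqrt (tauR N).
  by rewrite /GG mulrAC sqrtrM// divr_ge0// ltW.
rewrite mulrA ler_wpM2l ?mulr_ge0 ?sqrtr_ge0//.
by rewrite gerBl sqrtr_ge0.
Qed.

(** Replacing [Lg] by its lower bound [1 + v] gives an update the same price in all epochs. *)
Lemma Phi_cd m : (m < N)%N -> normal m.+1 ->
  Phi pol amo (H m.+1) (mu m.+1) (Q m.+1) + natR (k m.+1) * ((1 + v) / (8 * natR K)) <=
  Phi pol amo (H m.+1) (mu m.+1) (Q m).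
Proof.
move=> mN nm; have sz : (0 < size (H m.+1))%N by rewrite size_hist tau_gt0.
have [Qm _ _] := Qfacts (ltnW mN).
have [Q' [n [E _ _ _ ph]]] := coord_descentP K0 amoP sz (mu0 m.+1) (Kmu m.+1) (hist_good mN) Qm.
move: E ph; rewrite cdE// => -[<- ->] ph.
have t0 : 0 < tauR m.+1 by rewrite ltr0n tau_gt0.
rewrite -!PhiE// size_hist.
have tm0 : 0 < tauR m.+1 * mu m.+1 by rewrite mulr_gt0.
have := ler_wpM2l (ltW tm0) ph; rewrite mulrDr; apply: le_trans; rewrite lerD2l.
have -> : tauR m.+1 * mu m.+1 * (natR n * (mu m.+1 / 8)) =
   natR n * (natR K * tauR m.+1 * mu m.+1 ^+ 2 / (8 * natR K)).
  by field; rewrite gt_eqF.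
rewrite (normal_mu2 K0 Pi0 delta01 nm) ler_wpM2l// ler_pM2r ?invr_gt0 ?mulr_gt0//.
by have := Lg_ge Pi0 delta01 (ltn0Sn m); lra.
Qed.

Section first_normal.
Variable m0 : nat.
Hypothesis normal_m0 : normal m0.
Hypothesis m0_min : forall j, (j < m0)%N -> ~~ normal j.
Hypothesis m0N : (m0 <= N)%N.
Notation played_ips j := (\sum_pi played j pi * ips_sum pol (batch j) pi).
Hypothesis G3 : \sum_(m0 <= j < N) nn j * (\sum_pi played j pi * Rw pi) -
  3 * natR K * (tauR N * mu N) <= \sum_(m0 <= j < N) played_ips j.

Notation ell := (ln (tauR N)).
Let bs m := best_sum pol amo (H m).

(** [Phi_step] accounts for new data under old weights, [Phi_cd] for new weights on the same data.
    The updates made at time [tau (m0 + d)] are included, hence the upper limit [.+1]. *)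
Lemma telescope d : (m0 + d <= N)%N ->
  Phi pol amo (H (m0 + d)) (mu (m0 + d)) (Q (m0 + d)) +
    (\sum_(m0 <= j < (m0 + d).+1) natR (k j)) * ((1 + v) / (8 * natR K)) <=
  GG * ell + (1 + ell) * \sum_(m0 <= j < m0 + d) mu j * nn j +
  (200 * natR K)^-1 * (bs (m0 + d) - bs m0 - \sum_(m0 <= j < m0 + d) played_ips j).
Proof.
have m00 := normal_gt0 normal_m0.
have nrm j : (m0 <= j)%N -> normal j by move=> h; exact: (normal_mono K0 Pi0 delta01 h).
elim: d => [|d IH] mdN.
  rewrite addn0 in mdN *; rewrite big_nat1 !big_geq// mulr0 addr0 subrr subr0 mulr0 addr0.
  have [m1 m0E] : exists m1, m0 = m1.+1 by exists m0.-1; rewrite prednK.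
  have m1N : (m1 < N)%N by rewrite -m0E.
  have nm1 : ~~ normal m1 by apply: m0_min; rewrite m0E.
  have [Qm1 _] := not_normal_zero (ltnW m1N) nm1.
  have := Phi_cd m1N; rewrite -m0E => /(_ normal_m0) /le_trans; apply.
  (* The last epoch before [m0] is not normal, so its weights are zero and only the entropy part of
     the initial potential is left. *)
  rewrite Qm1 /Phi.
  have -> : \sum_pi ([ffun=> 0] : @weights R Pi) pi * (best_sum pol amo (H m0) - ips_sum pol (H m0) pi) = 0.
    by rewrite big1// => pi _; rewrite ffunE mul0r.
  rewrite mulr0 addr0.
  apply: (@le_trans _ _ (mu m0 * (tauR m0 * ell))).
    rewrite ler_pM2l//.
    have -> : tauR m0 * ell = \sum_(h <- H m0) ell.
      by rewrite big_const_seq count_predT size_hist iter_addr_0 -[RHS]mulr_natl.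
    apply: ler_sum => h _; apply: le_trans (ln_kappa mdN normal_m0).
    apply: ent_le => //.
    - by move=> pi; rewrite ffunE.
    - by rewrite big1// => pi _; rewrite ffunE.
  rewrite mulrA [mu m0 * _]mulrC ler_wpM2r//; last exact: tau_mu_le.
  by rewrite ln_ge0// ler1n tau_gt0//; exact: leq_trans mdN.
rewrite addnS in mdN *.
have {}IH := IH (ltnW mdN).
have h0 : (m0 <= m0 + d)%N by exact: leq_addr.
set m := (m0 + d)%N in mdN IH h0 *.
have nm := nrm _ h0; have nm' := nrm _ (leqW h0).
have mp : (0 < m)%N by exact: leq_trans h0.
have [Qm Q1 _] := Qfacts (ltnW mdN).
have gd := hist_good mdN; rewrite hist_batch in gd.
have sz : (0 < size (H m))%N by rewrite size_hist tau_gt0.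
have st := Phi_step K0 amoP sz gd Qm Q1 (mu0 m.+1) (muM (leqnSn m)) (Kmu m).
rewrite -hist_batch size_hist size_map size_iota -/(played m) in st.
have cd := Phi_cd mdN nm'.
have kr : \sum_(m0 <= j < m.+2) natR (k j) = \sum_(m0 <= j < m.+1) natR (k j) + natR (k m.+1).
  by rewrite big_nat_recr// leqW.
have nr : \sum_(m0 <= j < m.+1) mu j * nn j = \sum_(m0 <= j < m) mu j * nn j + mu m * nn m.
  by rewrite big_nat_recr.
have pr : \sum_(m0 <= j < m.+1) played_ips j = \sum_(m0 <= j < m) played_ips j + played_ips m.
  by rewrite big_nat_recr.
rewrite kr nr pr.
have e1 := mu_ratio nm.
have lnk := ln_kappa mdN nm'.
have e2 : nn m * (mu m.+1 * - (2 * ln (K%:R * mu m.+1))) <= ell * (mu m * nn m).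
  rewrite mulrC [leRHS]mulrA; apply: ler_wpM2r => //.
  rewrite [leRHS]mulrC; apply: ler_pM => //; rewrite ?(ltW (mu0 _))//; last exact: muM.
  by rewrite oppr_ge0 mulr_ge0_le0// ln_le0//; have := Kmu m.+1; lra.
have r0 : 0 <= (200 * natR K)^-1 by rewrite invr_ge0 mulr_ge0 ?ler0n.
move: IH st cd e1 e2; rewrite /bs.
set S1 := \sum_(m0 <= j < m) mu j * nn j; set S2 := \sum_(m0 <= j < m) played_ips j.
set S3 := \sum_(m0 <= j < m.+1) natR (k j).
lra.
Qed.

(** The leader added by the completion has estimated regret 0, and the weights [Q j] satisfy
    [sum Q b <= 2 K], that is, estimated regret at most [200 K mu]. With
    [Reg <= 2 emp_regret + 100 K mu] this gives 500 = 2 * 200 + 100. *)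
Lemma played_reward j : (j <= N)%N -> normal j ->
  Rw pis - 500 * natR K * mu j <= \sum_pi played j pi * Rw pi.
Proof.
move=> jN nj; have j0 := normal_gt0 nj.
have [Qj Q1 /(_ j0)[cost _]] := Qfacts jN.
have -> : \sum_pi played j pi * Rw pi = Rw pis - \sum_pi played j pi * Reg pi.
  rewrite /Reg; under [in RHS]eq_bigr do rewrite mulrBr.
  by rewrite sumrB -mulr_suml /played mass_complete mul1r; ring.
rewrite lerB//.
have hR : \sum_pi played j pi * emp_regret pol amo (H j) pi = \sum_pi Q j pi * emp_regret pol amo (H j) pi.
  by rewrite /played sum_complete {2}/emp_regret subrr mulr0 addr0.
apply: (@le_trans _ _ (\sum_pi played j pi * (2 * emp_regret pol amo (H j) pi + 100 * natR K * mu j))).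
  apply: ler_sum => pi _; apply: ler_wpM2l; first exact: played_nonneg.
  by have [] := regret_bounds jN nj pi.
have -> : \sum_pi played j pi * (2 * emp_regret pol amo (H j) pi + 100 * natR K * mu j) =
    2 * (\sum_pi played j pi * emp_regret pol amo (H j) pi) + 100 * natR K * mu j.
  under eq_bigr do rewrite mulrDr mulrCA.
  by rewrite big_split/= -mulr_sumr -mulr_suml /played mass_complete mul1r.
rewrite hR.
have sz : (0 < size (H j))%N by rewrite size_hist tau_gt0.
have bE : \sum_pi Q j pi * b_ pol amo (H j) (mu j) pi <= 2 * natR K.
  apply: le_trans cost; apply: ler_sum => pi _; apply: ler_wpM2l => //.
  by rewrite lerDr mulr_ge0.
have -> : \sum_pi Q j pi * emp_regret pol amo (H j) pi =
    100 * mu j * \sum_pi Q j pi * b_ pol amo (H j) (mu j) pi.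
  rewrite mulr_sumr; apply: eq_bigr => pi _.
  by rewrite /b_ /psi; field; rewrite gt_eqF.
have m100 : 0 <= 100 * mu j by rewrite mulr_ge0// ltW.
have := ler_wpM2l m100 bE.
by lra.
Qed.

(** The optimal reward [Rw pis] enters with the total weight
    [tau_N - tau_m0 - (tau_N - tau_m0) = 0], so only errors remain; 31 adds the 3 of [G3] to the 28
    of [dev_bound] at [N]. *)
Lemma regret_sum : bs N - bs m0 - \sum_(m0 <= j < N) played_ips j <=
  natR K * (31 * (tauR N * mu N) + 28 * (tauR m0 * mu m0) + 500 * \sum_(m0 <= j < N) mu j * nn j).
Proof.
have m00 := normal_gt0 normal_m0.
have nrm j : (m0 <= j)%N -> normal j by move=> h; exact: (normal_mono K0 Pi0 delta01 h).
have hN : bs N <= tauR N * (Rw pis + 28 * natR K * mu N).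
  have := dev_bound (lead N) (leqnn N) (nrm _ m0N).
  rewrite ler_norml => /andP[_ h].
  have : ips_sum pol (H N) (lead N) <= tauR N * (Rw (lead N) + 28 * natR K * mu N + 12 / 100 * Reg (lead N)) by lra.
  move=> /le_trans; apply; apply: ler_wpM2l => //.
  by have := Reg_ge0 (lead N); rewrite /Reg; lra.
have hm : tauR m0 * (Rw pis - 28 * natR K * mu m0) <= bs m0.
  have := dev_bound pis m0N normal_m0; rewrite Reg_pis mulr0 addr0.
  rewrite ler_norml => /andP[h _].
  apply: (@le_trans _ _ (ips_sum pol (H m0) pis)); first by lra.
  by apply: best_sumP => //; [rewrite size_hist tau_gt0|exact: hist_good].
have hs : \sum_(m0 <= j < N) nn j * (Rw pis - 500 * natR K * mu j) <=
    \sum_(m0 <= j < N) nn j * (\sum_pi played j pi * Rw pi).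
  rewrite big_nat_cond [leRHS]big_nat_cond; apply: ler_sum => j /andP[/andP[mj jN] _].
  by apply: ler_wpM2l => //; apply: played_reward; [exact: ltnW|exact: nrm].
have hs2 : \sum_(m0 <= j < N) nn j * (Rw pis - 500 * natR K * mu j) =
    (tauR N - tauR m0) * Rw pis - 500 * natR K * \sum_(m0 <= j < N) mu j * nn j.
  have -> : tauR N - tauR m0 = \sum_(m0 <= j < N) nn j.
    rewrite -natr_sum telescope_sumn; first by rewrite natrB// tau_mono.
    by move=> i j ij; rewrite tau_mono.
  rewrite mulr_suml mulr_sumr -sumrB; apply: eq_bigr => j _; ring.
move: G3 hN hm hs; rewrite hs2.
set S := \sum_(m0 <= j < N) mu j * nn j; set S2 := \sum_(m0 <= j < N) played_ips j.
set S3 := \sum_(m0 <= j < N) nn j * _.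
lra.
Qed.

(** The final potential is non-negative and is dropped. The constant 11 rounds up 3 + (31 + 28 + 500
    * 3) / 200, and 4 = 1 + 3. *)
Lemma updates_sum : (\sum_(m0 <= j < N.+1) natR (k j)) * ((1 + v) / (8 * natR K)) <= (11 + 4 * ell) * GG.
Proof.
have m00 := normal_gt0 normal_m0.
have N0 : (0 < N)%N by exact: leq_trans m0N.
have nN : normal N by exact: (normal_mono K0 Pi0 delta01 m0N).
have := @telescope (N - m0); rewrite subnKC// => /(_ (leqnn N)).
have sz : (0 < size (H N))%N by rewrite size_hist tau_gt0.
have [QN _ _] := Qfacts (leqnn N).
have P0 : 0 <= Phi pol amo (H N) (mu N) (Q N).
  rewrite -PhiE// mulr_ge0 ?mulr_ge0 ?(ltW (mu0 _))//.
  by apply: (phi_ge0 K0 amoP sz (mu0 N) (Kmu N)) => //; exact: hist_good.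
have hG0 : 0 <= GG by exact: sqrtr_ge0.
have hl : 0 <= ell by rewrite ln_ge0// ler1n tau_gt0.
have h1 := tau_mu_le (leqnn N) nN.
have h2 := tau_mu_le m0N normal_m0.
have h3 := sum_nn_mu m0N normal_m0.
have r0 : 0 <= (200 * natR K)^-1 by rewrite invr_ge0 mulr_ge0 ?ler0n.
have := ler_wpM2l r0 regret_sum.
set S := \sum_(m0 <= j < N) mu j * nn j in h3 *; set S2 := \sum_(m0 <= j < N) played_ips j.
have -> : (200 * natR K)^-1 * (natR K * (31 * (tauR N * mu N) + 28 * (tauR m0 * mu m0) + 500 * S)) =
  (31 * (tauR N * mu N) + 28 * (tauR m0 * mu m0) + 500 * S) / 200 by field; rewrite gt_eqF.
have h4 : (1 + ell) * S <= (1 + ell) * (3 * GG) by apply: ler_wpM2l => //; lra.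
move=> h5 h6.
set S3 := \sum_(m0 <= j < N.+1) _ in h6 *.
have : S3 * ((1 + v) / (8 * natR K)) <= GG * ell + (1 + ell) * (3 * GG) +
    (31 * GG + 28 * GG + 500 * (3 * GG)) / 200 by lra.
by lra.
Qed.

End first_normal.

Lemma updates_bound : (0 < N)%N ->
  (forall m0, normal m0 -> (forall j, (j < m0)%N -> ~~ normal j) -> (m0 <= N)%N ->
   \sum_(m0 <= j < N) nn j * (\sum_pi played j pi * Rw pi) - 3 * natR K * (tauR N * mu N) <=
   \sum_(m0 <= j < N) \sum_pi played j pi * ips_sum pol (batch j) pi) ->
  \sum_(1 <= j < N.+1) natR (k j) <= 352 * (1 + ln (tauR N)) ^+ 2 * Num.sqrt (natR K * tauR N / v).
Proof.
move=> N0 G3; set ell := ln (tauR N).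
have l0 : 0 <= ell by rewrite ln_ge0// ler1n tau_gt0.
have v0 := v_gt0 Pi0 delta01.
have [nN|nN] := boolP (normal N); last first.
  have B0 : 0 <= 352 * (1 + ell) ^+ 2 * Num.sqrt (natR K * tauR N / v).
    exact: mulr_ge0 (mulr_ge0 (ler0n _ _) (sqr_ge0 _)) (sqrtr_ge0 _).
  rewrite big_nat_cond big1// => j /andP[/andP[j0 jN] _].
  have nj : ~~ normal j by apply: contra nN; apply: (normal_mono K0 Pi0 delta01).
  by have [_ ->] := not_normal_zero jN nj.
have [m0 nm0 mmin] := ex_minnP (ex_intro (fun j => normal j) N nN).
have m0N : (m0 <= N)%N by exact: mmin.
have m0min j : (j < m0)%N -> ~~ normal j.
  by move=> jm; apply/negP => /mmin; rewrite leqNgt jm.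
have m00 := normal_gt0 nm0.
have := updates_sum nm0 m0min m0N (G3 _ nm0 m0min m0N).
have -> : \sum_(1 <= j < N.+1) natR (k j) = \sum_(m0 <= j < N.+1) natR (k j).
  rewrite (big_cat_nat (n := m0))//=; last exact: leqW.
  rewrite big_nat_cond big1 ?add0r// => j /andP[/andP[j0 jm] _].
  by have [_ ->] := not_normal_zero (ltnW (leq_trans jm m0N)) (m0min _ jm).
rewrite -/ell; set S := \sum_(m0 <= j < N.+1) _ => h.
have L0 : 0 < Lg N by exact: (Lg_gt0 Pi0 delta01).
have LN : Lg N <= (4 + 2 * ell) * (1 + v).
  rewrite (LgE Pi0 delta01 N0) -/ell.
  have /andP[_ l16] := @ln16_bounds R.
  have : 0 <= ell * v by rewrite mulr_ge0// ltW.
  by nra.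
have t0 : 0 < tauR N by rewrite ltr0n tau_gt0.
set B := Num.sqrt (natR K * tauR N / v).
have B0 : 0 <= B by exact: sqrtr_ge0.
have v1 : 0 < 1 + v by lra.
(* The price of an update contributes [1 / (1 + v)], and the square root of [Lg N] takes back at
   most the root of [(4 + 2 ell) (1 + v)]; this is where [v] ends up in the denominator of the
   bound. *)
have GB : natR K * GG / (1 + v) <= (4 + 2 * ell) * B.
  have -> : natR K * GG / (1 + v) = Num.sqrt (natR K * tauR N * Lg N / (1 + v) ^+ 2).
    rewrite /GG -[natR K * _ / _]ger0_norm; last by rewrite divr_ge0 ?mulr_ge0 ?sqrtr_ge0 ?(ltW v1).
    rewrite -sqrtr_sqr; congr Num.sqrt; rewrite expr_div_n exprMn sqr_sqrtr; last first.
      by rewrite divr_ge0// mulr_ge0// ltW.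
    by field; rewrite !gt_eqF.
  have -> : (4 + 2 * ell) * B = Num.sqrt ((4 + 2 * ell) ^+ 2 * (natR K * tauR N / v)).
    by rewrite sqrtrM ?sqr_ge0// sqrtr_sqr ger0_norm//; lra.
  rewrite ler_sqrt; last by rewrite mulr_ge0 ?sqr_ge0// divr_ge0 ?mulr_ge0// ltW.
  rewrite ler_pdivrMr ?exprn_gt0//.
  have kt : 0 < natR K * tauR N by rewrite mulr_gt0.
  have -> : (4 + 2 * ell) ^+ 2 * (natR K * tauR N / v) * (1 + v) ^+ 2 =
     natR K * tauR N * ((4 + 2 * ell) ^+ 2 * (1 + v) ^+ 2 / v) by field; rewrite gt_eqF.
  rewrite ler_pM2l//; apply: le_trans LN _.
  rewrite ler_pdivlMr//.
  have : (4 + 2 * ell) * (1 + v) * v <= (4 + 2 * ell) * (1 + v) * (1 + v) by rewrite ler_wpM2l ?mulr_ge0//; lra.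
  move=> /le_trans; apply.
  have -> : (4 + 2 * ell) * (1 + v) * (1 + v) = 1 * ((4 + 2 * ell) * (1 + v) ^+ 2) by ring.
  have -> : (4 + 2 * ell) ^+ 2 * (1 + v) ^+ 2 = (4 + 2 * ell) * ((4 + 2 * ell) * (1 + v) ^+ 2) by ring.
  by rewrite ler_wpM2r ?mulr_ge0 ?sqr_ge0//; lra.
have hS : S <= 8 * (11 + 4 * ell) * (natR K * GG / (1 + v)).
  rewrite -(ler_pM2r (_ : 0 < (1 + v) / (8 * natR K))) ?divr_gt0 ?mulr_gt0//.
  apply: le_trans h _; rewrite le_eqVlt; apply/orP; left; apply/eqP.
  by field; rewrite !gt_eqF.
apply: le_trans hS _.
apply: (@le_trans _ _ (8 * (11 + 4 * ell) * ((4 + 2 * ell) * B))).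
  by apply: ler_wpM2l => //; lra.
rewrite mulrA; apply: ler_wpM2r => //.
(* 352 = 8 * 11 * 4 is the constant coefficient in [ell]; the other coefficients are below those of
   [352 (1 + ell)^2]. *)
nra.
Qed.

End deterministic.

(** * Epochs of a run *)

Section run_epochs.
Context {R : realType} {K : nat} {dX : measure_display} {X : measurableType dX} {Pi : finType}.
Variables (pol : Pi -> X -> 'I_K) (amo : seq (X * K.-tuple R) -> Pi) (delta : R) (pi0 : Pi).
Hypothesis K0 : (0 < K)%N.
Hypothesis amoP : is_AMO pol amo.
Hypothesis delta01 : 0 < delta < 1.
Variables (z : nat -> X * K.-tuple R) (act : nat -> 'I_K).
Notation mu m := (@mu_ R K Pi delta m).
Notation nonneg Q := (forall pi, 0 <= Q pi).
Notation run := (run pol amo delta pi0 z act).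

Definition observed t : @obs R K X :=
  Obs (z t).1 (act t) (tnth (z t).2 (act t)) (run_prob pol amo delta pi0 z act t (act t)).

Notation H m := (hist observed (tau m)).

Fixpoint epoch_weights m : @weights R Pi :=
  if m is m'.+1 then
    if coord_descent pol amo (H m) (mu m) (epoch_weights m') is Some r then r.1
    else epoch_weights m'
  else [ffun=> 0].

Lemma epoch_weightsS m : epoch_weights m.+1 =
  if coord_descent pol amo (H m.+1) (mu m.+1) (epoch_weights m) is Some r then r.1
  else epoch_weights m.
Proof. by []. Qed.

Definition epoch_updates m : nat :=
  if coord_descent pol amo (H m) (mu m) (epoch_weights m.-1) is Some r then r.2.-2 else 0.

Definition epoch_leader m : Pi := if m is 0 then pi0 else best_policy amo (H m).

(** [st_epoch] is one ahead of [m]: it numbers the epoch being played, whose weights were computed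
    at time [tau m]. *)
Definition epoch_state m n : @state R K X Pi :=
  State (hist observed n) m.+1 (epoch_weights m) (epoch_leader m)
    (\sum_(1 <= j < m.+1) (epoch_updates j).+2) m.

Let Pi0 : (0 < #|Pi|)%N. Proof. by apply/card_gt0P; exists pi0. Qed.

Lemma completed_epoch m n :
  completed (epoch_state m n) = [ffun pi => complete (epoch_weights m) (epoch_leader m) pi].
Proof. by []. Qed.

Lemma histS n : hist observed n.+1 = rcons (hist observed n) (observed n).
Proof. by rewrite /hist -cats1 -addn1 iotaD map_cat. Qed.

Lemma act_prob_gt0 m n x a : nonneg (epoch_weights m) -> \sum_pi epoch_weights m pi <= 1 ->
  0 < act_prob pol delta (epoch_state m n) x a.
Proof.
move=> Q0 Q1; apply: (lt_le_trans (mu_gt0 K0 Pi0 delta01 m)); apply: smoothed_ge.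
  by move=> pi; rewrite completed_epoch ffunE; apply: le_trans (Q0 pi) (complete_ge _ _ Q1).
by have := @Kmu_le R K Pi delta K0 m; lra.
Qed.

Record epoch_inv m n : Prop := EpochInv {
  ei_lo : (tau m <= n)%N;
  ei_hi : (n < tau m.+1)%N;
  ei_run : run n = Some (epoch_state m n);
  ei_pos : forall t, (t < n)%N -> (0 <= obs_rew (observed t)) && (0 < obs_prob (observed t));
  ei_nonneg : nonneg (epoch_weights m);
  ei_mass : \sum_pi epoch_weights m pi <= 1;
  ei_cd : forall j, (j < m)%N -> coord_descent pol amo (H j.+1) (mu j.+1) (epoch_weights j) =
    Some (epoch_weights j.+1, (epoch_updates j.+1).+2) }.

(** The invariants need each other: descent halts on histories with positive recorded probabilities,
    these are positive while the weights have mass at most 1, and that in turn is ensured by the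
    output of the descent. *)
Lemma run_epoch n : (forall t, (t < n)%N -> forall a, 0 <= tnth (z t).2 a) ->
  exists m, epoch_inv m n.
Proof.
elim: n => [|n IH] rew0.
  exists 0%N; split=> //.
  - by rewrite /epoch_state /= big_geq.
  - by move=> pi; rewrite ffunE.
  - by rewrite big1// => pi _; rewrite ffunE.
have [m [lo hi rn pos Q0 Q1 cd]] := IH (fun t tn => rew0 t (leqW tn)).
have pos' t : (t < n.+1)%N -> (0 <= obs_rew (observed t)) && (0 < obs_prob (observed t)).
  rewrite ltnS leq_eqVlt => /orP[/eqP ->|/pos//]; rewrite /= rew0//=.
  by rewrite /run_prob rn; exact: act_prob_gt0.
have oE : Obs (z n).1 (act n) (tnth (z n).2 (act n)) (act_prob pol delta (epoch_state m n) (z n).1 (act n)) = observed n.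
  by rewrite /observed /run_prob rn.
have rS : run n.+1 = round pol amo delta (epoch_state m n) (z n) (act n) by rewrite /= rn.
rewrite /round oE [st_hist _]/= -histS size_hist [st_epoch _]/= in rS.
have [nm|nm] := eqVneq n.+1 (tau m.+1); last first.
  exists m; split=> //; first exact: leqW.
    by rewrite ltn_neqAle nm.
  by rewrite rS (negbTE nm).
have good : all (fun h => (0 <= obs_rew h) && (0 < obs_prob h)) (hist observed n.+1).
  by rewrite all_map; apply/allP => i; rewrite mem_iota add0n => /pos'.
have sz : (0 < size (hist observed n.+1))%N by rewrite size_hist.
have [Q' [c [E Q'0 cost _ _]]] := coord_descentP K0 amoP sz (mu_gt0 K0 Pi0 delta01 m.+1)
  (@Kmu_le R K Pi delta K0 m.+1) good Q0.
have Q'E : epoch_weights m.+1 = Q' by rewrite epoch_weightsS -nm E.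
have uE : epoch_updates m.+1 = c by rewrite /epoch_updates -nm E.
exists m.+1; split=> //.
- by rewrite nm.
- by rewrite nm tau_lt.
- have lE : epoch_leader m.+1 = best_policy amo (hist observed n.+1) by rewrite nm.
  by rewrite /epoch_state lE Q'E big_nat_recr// uE rS nm eqxx -nm [st_weights _]/= E.
- by rewrite Q'E.
- rewrite Q'E; apply: (cost_mass K0 amoP (mu_gt0 K0 Pi0 delta01 m.+1) good) => //.
- move=> j; rewrite ltnS leq_eqVlt => /orP[/eqP ->|/cd//].
  by rewrite Q'E uE -nm.
Qed.

End run_epochs.

(** * Concentration *)

Section rounds.
Context {R : realType} {K : nat} {dX : measure_display} {X : measurableType dX} {Pi : finType}.
Variables (pol : Pi -> X -> 'I_K) (pi0 : Pi).
Notation Y := (X * K.-tuple R)%type.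
Variables (D : probability Y R) (delta : R) (amo : seq Y -> Pi).
Context {dO : measure_display} {Omega : measurableType dO} (P : probability Omega R).
Variables (z : nat -> Omega -> Y) (act : nat -> Omega -> 'I_K).
Hypothesis mpol : forall pi a, measurable (pol pi @^-1` [set a]).
Hypothesis K0 : (0 < K)%N.
Hypothesis delta01 : 0 < delta < 1.
Hypothesis mamo : measurable_AMO amo.
Hypothesis inter : interaction pol amo delta pi0 D P z act.
Notation mu m := (@mu_ R K Pi delta m).
Notation runw w n := (run pol amo delta pi0 (z ^~ w) (act ^~ w) n).
Notation OmegaP t := (g_sigma_algebraType (past z act t)).

Let Pi0 : (0 < #|Pi|)%N. Proof. by apply/card_gt0P; exists pi0. Qed.

(* Clamping makes the tail bounds hold for all reward vectors; the rewards lie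
   in [0, 1] almost surely, so that it does not change them. *)
Definition clamp (x : R) : R := Num.min 1 (Num.max 0 x).

Lemma clamp01 x : 0 <= clamp x <= 1.
Proof. by rewrite /clamp le_min ler01 le_max lexx ge_min lexx. Qed.

Lemma clampE x : 0 <= x <= 1 -> clamp x = x.
Proof. by case/andP=> x0 x1; rewrite /clamp max_r// min_r. Qed.

Definition qr n w (y : Y) (a : 'I_K) : R :=
  if runw w n is Some s then act_prob pol delta s y.1 a else K%:R^-1.

(** A condition on the past alone under which the prescribed probabilities sum to 1 and are at least
    the current [mu]; it plays the part of [V] in the supermartingales. *)
Definition ok n w : bool :=
  if runw w n is Some s then
    [&& [forall pi, 0 <= st_weights s pi], \sum_pi st_weights s pi <= 1,
        (tau (st_epoch s).-1 <= n)%N & (n < tau (st_epoch s))%N]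
  else false.

Definition cw n w (pi : Pi) : R := if runw w n is Some s then completed s pi else 0.

Let past_meas1 n : exists (A : set (OmegaP n)) (p : nat -> OmegaP n -> R) (m cd : nat)
    (w : OmegaP n -> @weights R Pi) (ldr : OmegaP n -> Pi) (kk : OmegaP n -> nat),
  [/\ measurable A, forall i, (i < n)%N -> measurable_fun setT (p i),
    forall pi, measurable_fun setT (fun s : OmegaP n => w s pi : R),
    forall i : Pi, measurable (ldr @^-1` [set i]) &
    forall i : nat, measurable (kk @^-1` [set i])] /\
  forall s, runw s n =
    if `[< A s >] then Some (State (mk_hist z act p n s) m (w s) (ldr s) (kk s) cd) else None.
Proof.
apply: (@run_measurable _ (OmegaP n) R K _ X Pi pol amo mpol mamo delta pi0 z act n).
- by move=> i iN; exact: past_z.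
- by move=> i iN a; exact: past_act.
Qed.

Lemma measurable_qr n a : measurable_fun setT (fun x : OmegaP n * Y => qr n x.1 x.2 a).
Proof.
apply: (@run_prob_measurable _ (OmegaP n) R K _ X Pi pol amo mpol mamo delta pi0 z act n).
- by move=> i iN; exact: past_z.
- by move=> i iN b; exact: past_act.
Qed.

Lemma measurable_cw n pi : measurable_fun setT (fun w : OmegaP n => cw n w pi).
Proof.
have [A [p [m [cd [w [ldr [kk [[mA mp mw ml mk] E]]]]]]]] := past_meas1 n.
rewrite (_ : (fun w => _) = fun s : OmegaP n => if `[< A s >] then
    w s pi + (1 - \sum_pi' w s pi') * @unit_mass R Pi (ldr s) pi else 0).
  apply: measurable_if0 => //; last exact: meas_completed.
  by rewrite (_ : [set s | _] = A)//; apply/seteqP; split=> s /asboolP.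
by apply/funext => s; rewrite /cw E; case: asboolP => // _; rewrite completedE.
Qed.

Lemma measurable_ok n : measurable_fun setT (ok n : OmegaP n -> bool).
Proof.
have [A [p [m [cd [w [ldr [kk [[mA mp mw ml mk] E]]]]]]]] := past_meas1 n.
apply: (measurable_fun_bool true) => //; rewrite setTI.
rewrite (_ : _ @^-1` _ = if (tau m.-1 <= n)%N && (n < tau m)%N then
   A `&` ([set s | ~~ [exists pi, w s pi < 0]] `&` [set s : OmegaP n | \sum_pi w s pi <= 1]) else set0).
  case: ifP => // _; apply: measurableI => //; apply: measurableI.
    rewrite (_ : [set s | _] = ~` [set s | [exists pi, w s pi < 0]]).
      apply: measurableC; apply: measurable_exists => pi; apply: measurable_boolset.
      exact: measurable_fun_ltr.
    by apply/seteqP; split=> s /negP.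
  by apply: measurable_boolset; apply: measurable_fun_ler => //; exact: measurable_sum.
set cnd := (tau m.-1 <= n)%N && (n < tau m)%N.
have okE s : ok n s = [&& `[< A s >], ~~ [exists pi, w s pi < 0], \sum_pi w s pi <= 1 & cnd].
  rewrite /ok E; case: asboolP => // _; rewrite andTb; congr andb.
  by rewrite negb_exists; apply: eq_forallb => pi; rewrite leNgt.
apply/seteqP; split=> s; rewrite /preimage /mkset okE.
  by case/and4P => /asboolP As h1 h2 ->; split.
by case: ifP => // _ [/asboolP -> [-> ->]].
Qed.

Lemma okP n w : ok n w -> exists j (W : @weights R Pi),
  [/\ (tau j <= n < tau j.+1)%N, forall pi, 0 <= W pi, \sum_pi W pi = 1,
    forall pi, cw n w pi = W pi & forall y a, qr n w y a = smoothed pol W (mu j) a y.1].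
Proof.
rewrite /ok /cw /qr; case E : (runw w n) => [s|//] /and4P[/forallP w0 w1 lo hi].
exists (st_epoch s).-1, (completed s); split=> //.
- rewrite lo/= prednK//; case: (st_epoch s) hi => //=.
- by move=> pi; rewrite completedE; exact: le_trans (w0 pi) (complete_ge _ _ w1).
- under eq_bigr do rewrite completedE; exact: (mass_complete (st_weights s) (st_leader s)).
Qed.

Definition rw pi (y : Y) : R := clamp (tnth y.2 (pol pi y.1)).
Definition Rtrue pi : R := ED D (rw pi).

Lemma measurable_clamp d (S : measurableType d) (f : S -> R) :
  measurable_fun setT f -> measurable_fun setT (fun s => clamp (f s)).
Proof.
by move=> mf; apply: measurable_minr => //; exact: measurable_maxr.
Qed.

Lemma measurable_reward a : measurable_fun setT (fun y : Y => clamp (tnth y.2 a)).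
Proof.
apply: measurable_clamp; apply: (measurableT_comp (measurable_tnth a)); exact: measurable_snd.
Qed.

Lemma measurable_pol_fst pi a : measurable ((fun y : Y => pol pi y.1) @^-1` [set a]).
Proof.
rewrite -[X in measurable X]setTI.
have mf : measurable_fun setT (fst : Y -> X) by exact: measurable_fst.
exact: (mf measurableT _ (mpol pi a)).
Qed.

Lemma bmf_rw pi : bmf (rw pi).
Proof.
split.
  apply: (measurable_finsel (F := fun (y : Y) a => clamp (tnth y.2 a))).
    by move=> a; exact: measurable_pol_fst.
  exact: measurable_reward.
by exists 1 => y; have /andP[h0 h1] := clamp01 (tnth y.2 (pol pi y.1)); rewrite ger0_norm.
Qed.

Lemma int_le_exp (F G : Y -> R) (c : R) : measurable_fun setT F -> (forall y, 0 <= F y) ->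
  bmf G -> (forall y, F y <= 1 + G y) -> ED D G <= c ->
  (\int[D]_y (F y)%:E <= (expR c)%:E)%E.
Proof.
move=> mF F0 bG FG Gc.
have b1 : bmf (fun y => 1 + G y) by apply: bmfD => //; exact: bmf_cst.
apply: (@le_trans _ _ (\int[D]_y (1 + G y)%:E)%E).
  apply: ge0_le_integral => //.
  - by move=> y _; rewrite lee_fin.
  - exact/measurable_EFinP.
  - by apply/measurable_EFinP; case: b1.
  - by move=> y _; rewrite lee_fin.
rewrite ED_ereal// lee_fin EDD//; last exact: bmf_cst.
rewrite ED_cst; apply: le_trans (expR_ge1Dx c).
by rewrite lerD2l.
Qed.

Let mz t : measurable_fun setT (z t). Proof. exact: ip_meas_pair inter t. Qed.
Let ma t a : measurable (act t @^-1` [set a]). Proof. exact: ip_meas_act inter t a. Qed.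
Let mu0 m : 0 < mu m. Proof. exact: mu_gt0. Qed.
Let Kmu m : K%:R * mu m <= 2^-1. Proof. exact: Kmu_le. Qed.

Lemma qr_ge n w y a : ok n w -> exists2 j, (tau j <= n < tau j.+1)%N & mu j <= qr n w y a.
Proof.
move=> /okP[j [W [jn W0 W1 _ qE]]]; exists j => //; rewrite qE.
by apply: smoothed_ge => //; have := Kmu j; lra.
Qed.

Lemma qr_gt0 n w y a : ok n w -> 0 < qr n w y a.
Proof. by move=> /(qr_ge y a)[j _]; exact: lt_le_trans. Qed.

Lemma sum_qr n w y : ok n w -> \sum_a qr n w y a = 1.
Proof.
move=> /okP[j [W [_ _ W1 _ qE]]]; under eq_bigr do rewrite qE.
by rewrite sum_smoothed W1; ring.
Qed.

(** [supermartingale_tail] for the run. A majorant [1 + G] of the moment given the pair suffices, as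
    [1 + x <= expR x]. *)
Lemma round_tail (U : nat -> Omega -> Y -> 'I_K -> R) (c : nat -> Omega -> R) (N : nat) (l : R) :
  (forall n, (n < N)%N -> measurable_fun setT (c n : OmegaP n -> R)) ->
  (forall n a, (n < N)%N -> measurable_fun setT (fun x : OmegaP n * Y => U n x.1 x.2 a)) ->
  (forall n w, (n < N)%N -> ok n w -> exists G : Y -> R,
     [/\ bmf G, forall y, \sum_a qr n w y a * expR (U n w y a) <= 1 + G y & ED D G <= c n w]) ->
  exists E, [/\ measurable E, (P E <= (expR (- l))%:E)%E &
    forall w, (forall n, (n < N)%N -> ok n w) -> ~ E w ->
      \sum_(n < N) (U n w (z n w) (act n w) - c n w) <= l].
Proof.
move=> mc mU HU.
have q0 n w y a : (n < N)%N -> ok n w -> 0 <= qr n w y a by move=> _ /(qr_gt0 y a)/ltW.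
have HU' n w : (n < N)%N -> ok n w ->
    (\int[D]_y (\sum_a qr n w y a * expR (U n w y a))%:E <= (expR (c n w))%:E)%E.
  move=> nN okn; have [G [bG FG Gc]] := HU n w nN okn.
  have sec (F : OmegaP n * Y -> R) : measurable_fun setT F ->
      measurable_fun setT (fun y => F (w, y)).
    by move=> mF; apply: (measurableT_comp mF); exact/measurable_fun_pair.
  apply: (int_le_exp (G := G)) => //.
    apply: measurable_sum => a; apply: measurable_funM.
      apply: (sec (fun x => qr n x.1 x.2 a)); exact: measurable_qr.
    apply: measurableT_comp => //; apply: (sec (fun x => U n x.1 x.2 a)); exact: mU.
  by move=> y; apply: sumr_ge0 => a _; rewrite mulr_ge0 ?expR_ge0 ?q0.
have [mE PE] := @supermartingale_tail _ Omega _ X R K P D z act qr mz ma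
  (ip_fresh inter) (ip_draw inter) ok U c N (fun n _ => @measurable_ok n) mc
  (fun n a _ => @measurable_qr n a) mU q0 HU' l.
eexists; split; [exact: mE|exact: PE|].
by move=> w okw nE; rewrite leNgt; apply/negP => lt; apply: nE; split.
Qed.

Notation Lg m := (@Lg R Pi delta m).
Notation natR n := (@GRing.natmul R 1 n).

Definition est pi n w (y : Y) (a : 'I_K) : R :=
  clamp (tnth y.2 a) * (pol pi y.1 == a)%:R / qr n w y a.

(** The absolute value keeps the integrand non-negative for all outcomes, valid or not, so that
    Tonelli's theorem gives measurability in the past. *)
Definition value_var pi n w : R := fine (\int[D]_y (`|qr n w y (pol pi y.1)|^-1)%:E).

Lemma value_varE pi n w (W : @weights R Pi) j : ok n w -> (forall pi, 0 <= W pi) ->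
  (forall y a, qr n w y a = smoothed pol W (mu j) a y.1) ->
  value_var pi n w = ED D (fun y => inv_smoothed pol W (mu j) pi y.1).
Proof.
move=> okn W0 qE; rewrite /value_var /ED /Rintegral; congr fine; apply: eq_integral => y _.
rewrite gtr0_norm; last by exact: qr_gt0.
by rewrite qE.
Qed.

Lemma measurable_qr_pol pi n : measurable_fun setT (fun x : OmegaP n * Y => qr n x.1 x.2 (pol pi x.2.1)).
Proof.
apply: (measurable_finsel (F := fun (x : OmegaP n * Y) a => qr n x.1 x.2 a)).
  move=> a; rewrite -[X in measurable X]setTI.
  have ms : measurable_fun setT (snd : OmegaP n * Y -> Y) by exact: measurable_snd.
  exact: (ms measurableT _ (measurable_pol_fst pi a)).
by move=> a; exact: measurable_qr.
Qed.

Lemma measurable_value_var pi n : measurable_fun setT (value_var pi n : OmegaP n -> R).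
Proof.
have H : measurable_fun setT (fun w : OmegaP n => \int[D]_y (`|qr n w y (pol pi y.1)|^-1)%:E)%E.
  apply: (@measurable_fun_fubini_tonelli_F _ _ (OmegaP n) Y R D
    (fun x => (`|qr n x.1 x.2 (pol pi x.2.1)|^-1)%:E)).
    apply/measurable_EFinP; apply: measurable_funV; apply: measurableT_comp => //.
    exact: measurable_qr_pol.
  by move=> x; rewrite lee_fin invr_ge0.
exact: (measurableT_comp (@fine_measurable R setT measurableT) H).
Qed.

Lemma measurable_est pi n a : measurable_fun setT (fun x : OmegaP n * Y => est pi n x.1 x.2 a).
Proof.
apply: measurable_funM; last by apply: measurable_funV; exact: measurable_qr.
apply: measurable_funM.
  exact: (measurableT_comp (measurable_reward a) measurable_snd).
rewrite (_ : (fun x => _) = \1_((fun x : OmegaP n * Y => pol pi x.2.1) @^-1` [set a])).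
  apply: measurable_indic; rewrite -[X in measurable X]setTI.
  have ms : measurable_fun setT (snd : OmegaP n * Y -> Y) by exact: measurable_snd.
  exact: (ms measurableT _ (measurable_pol_fst pi a)).
by apply/funext => x; rewrite indicE; congr ((nat_of_bool _)%:R); apply/eqP/idP => [e|]; rewrite inE.
Qed.

Lemma est_ge0 pi n w y a : ok n w -> 0 <= est pi n w y a.
Proof.
move=> okn; have /andP[c0 _] := clamp01 (tnth y.2 a).
by rewrite /est divr_ge0 ?mulr_ge0// ltW// qr_gt0.
Qed.

(** Estimates are at most [1 / mu_m], because earlier epochs have larger [mu]; at the rate
    [mu_m / 2] the exponent is at most 1/2 and the quadratic bound on [expR] applies. The second
    moment of an estimate given the pair is at most the inverse probability of the policy's
    action. *)
Lemma value_tail m pi (e : R) : (0 < m)%N -> e ^+ 2 = 1 ->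
  exists E, [/\ measurable E, (P E <= (expR (- Lg m))%:E)%E &
    forall w, (forall n, (n < tau m)%N -> ok n w) -> ~ E w ->
      e * \sum_(n < tau m) (est pi n w (z n w) (act n w) - Rtrue pi) <=
      mu m * (\sum_(n < tau m) value_var pi n w) + 2 * Lg m / mu m].
Proof.
move=> m0 e2; pose la := mu m / 2.
have la0 : 0 < la by rewrite divr_gt0.
have [|||E [mE PE HE]] := @round_tail (fun n w y a => e * la * est pi n w y a)
  (fun n w => e * la * Rtrue pi + 2 * la ^+ 2 * value_var pi n w) (tau m) (Lg m).
- move=> n nm; apply: measurable_funD => //; apply: measurable_funM => //.
  exact: measurable_value_var.
- by move=> n a nm; apply: measurable_funM => //; exact: measurable_est.
- move=> n w nm okn; have [j [W [/andP[jn nj] W0 W1 _ qE]]] := okP okn.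
  have jm : (j <= m)%N by rewrite -tau_mono ltnW// (leq_ltn_trans jn nm).
  have mj : mu m <= mu j by exact: (mu_mono K0 Pi0 delta01).
  have k1 : K%:R * mu j <= 1 by have := Kmu j; lra.
  exists (fun y => e * la * rw pi y + 2 * la ^+ 2 * inv_smoothed pol W (mu j) pi y.1).
  have b1 : bmf (fun y : Y => inv_smoothed pol W (mu j) pi y.1) by exact: bmf_inv_smoothed.
  have b2 := bmf_rw pi.
  split.
  + by apply: bmfD; apply: bmfZ.
  + move=> y; set x := pol pi y.1.
    have q0 a : 0 < qr n w y a by exact: qr_gt0.
    have qm a : mu m <= qr n w y a.
      by apply: (le_trans mj); rewrite qE; exact: smoothed_ge.
    have U2 a : e * la * est pi n w y a <= 2^-1.
      have /andP[c0 c1] := clamp01 (tnth y.2 a).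
      have h : est pi n w y a <= (mu m)^-1.
        rewrite /est -[leRHS]mul1r; apply: ler_pM => //.
        - by rewrite mulr_ge0.
        - by rewrite invr_ge0 ltW.
        - by case: eqP => _; rewrite ?mulr1 ?mulr0.
        - by rewrite lef_pV2 ?posrE.
      have e1 : e <= 1 by have : 0 <= (e - 1) ^+ 2 by [exact: sqr_ge0]; nra.
      have h2 : la * est pi n w y a <= 2^-1.
        have := ler_wpM2l (ltW la0) h; congr (_ <= _); rewrite /la; field.
        by rewrite gt_eqF.
      have h3 : 0 <= la * est pi n w y a by rewrite mulr_ge0 ?est_ge0// ltW.
      by rewrite -mulrA; nra.
    apply: (@le_trans _ _ (\sum_a qr n w y a * (1 + e * la * est pi n w y a + 2 * (e * la * est pi n w y a) ^+ 2))).
      by apply: ler_sum => a _; rewrite ler_pM2l//; exact: expR_le_quad.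
    have -> : \sum_a qr n w y a * (1 + e * la * est pi n w y a + 2 * (e * la * est pi n w y a) ^+ 2) =
       1 + (\sum_a (x == a)%:R * (e * la * clamp (tnth y.2 a) + 2 * la ^+ 2 * clamp (tnth y.2 a) ^+ 2 / qr n w y a)).
      rewrite -[X in _ = X + _](sum_qr y okn) -big_split/=; apply: eq_bigr => a _.
      rewrite /est -/x; case: eqP => _ /=; last by rewrite mulr0n; ring.
      rewrite mulr1n; have -> : 2 * (e * la * (clamp (tnth y.2 a) * 1 / qr n w y a)) ^+ 2 =
        2 * (e ^+ 2) * (la * (clamp (tnth y.2 a) / qr n w y a)) ^+ 2 by ring.
      by rewrite e2; field; rewrite gt_eqF.
    rewrite lerD2l (bigD1 x)//= eqxx mul1r big1 ?addr0 => [|a]; last first.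
      by rewrite eq_sym => /negbTE ->; rewrite mul0r.
    rewrite /rw -/x lerD2l /inv_smoothed -qE -/x.
    have /andP[c0 c1] := clamp01 (tnth y.2 x).
    rewrite ler_pM2r ?invr_gt0// ler_piMr//; first by rewrite mulr_ge0// sqr_ge0.
    by rewrite expr_le1.
  + rewrite EDD; [|exact: bmfZ..]; rewrite !EDZ// -/(Rtrue pi).
    by rewrite (value_varE pi okn W0 qE).
exists E; split=> // w okw nE; have := HE w okw nE.
have -> : \sum_(n < tau m) (e * la * est pi n w (z n w) (act n w) -
    (e * la * Rtrue pi + 2 * la ^+ 2 * value_var pi n w)) =
  la * (e * \sum_(n < tau m) (est pi n w (z n w) (act n w) - Rtrue pi) -
    mu m * \sum_(n < tau m) value_var pi n w).
  rewrite mulrBr !mulr_sumr -sumrB; apply: eq_bigr => n _.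
  by rewrite /la; field.
rewrite mulrC -ler_pdivlMr// lerBlDl => h; apply: le_trans h _.
rewrite lerD2l le_eqVlt; apply/orP; left; apply/eqP; rewrite /la.
by field; rewrite gt_eqF.
Qed.

(** A multiplicative lower-tail bound for fixed weights: at the rate [mu / 2] the exponent [u] lies
    in [0, 1/2], where [1 - u + u^2 <= 1 - u / 2]. This halving is the factor 2 in front of the
    empirical mean. *)
Lemma context_tail m (Q : @weights R Pi) pi (l : R) : (0 < m)%N -> (forall pi, 0 <= Q pi) ->
  exists E, [/\ measurable E, (P E <= (expR (- l))%:E)%E &
    forall w, (forall n, (n < tau m)%N -> ok n w) -> ~ E w ->
      ED D (fun y => inv_smoothed pol Q (mu m) pi y.1) <=
      2 * ((tau m)%:R^-1 * \sum_(n < tau m) inv_smoothed pol Q (mu m) pi (z n w).1) +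
        4 * l / (mu m * (tau m)%:R)].
Proof.
move=> m0 Q0; pose la := mu m / 2.
have la0 : 0 < la by rewrite divr_gt0.
have k1 : K%:R * mu m <= 1 by have := Kmu m; lra.
pose F (y : Y) := inv_smoothed pol Q (mu m) pi y.1.
have bF : bmf F by exact: bmf_inv_smoothed.
have F0 y : 0 <= F y by exact: inv_smoothed_ge0.
have F1 y : la * F y <= 2^-1.
  have := ler_wpM2l (ltW la0) (inv_smoothed_le pol pi y.1 Q0 (mu0 m) k1).
  by congr (_ <= _); rewrite /la; field; rewrite gt_eqF.
have [|||E [mE PE HE]] := @round_tail (fun n w y a => - (la * F y))
  (fun n w => - (la / 2 * ED D F)) (tau m) l.
- by move=> n nm; exact: measurable_cst.
- move=> n a nm; apply: measurableT_comp => //; apply: measurable_funM => //.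
  exact: (measurableT_comp bF.1 measurable_snd).
- move=> n w nm okn; exists (fun y => - (la / 2) * F y); split.
  + exact: bmfZ.
  + move=> y; rewrite -mulr_suml sum_qr// mul1r.
    have h := F1 y; have h0 : 0 <= la * F y by rewrite mulr_ge0// ltW.
    by apply: le_trans (expRN_le_quad h0) _; nra.
  + by rewrite EDZ// mulNr.
exists E; split=> // w okw nE; have := HE w okw nE.
rewrite big_split/= sumr_const card_ord sumrN -mulr_sumr opprK.
set S := \sum_(n < tau m) F (z n w).
have t0 : 0 < natR (tau m) by rewrite ltr0n tau_gt0.
rewrite -[_ *+ tau m]mulr_natl => h.
rewrite -/F -/S -(ler_pM2l (_ : 0 < natR (tau m) * (la / 2))) ?mulr_gt0 ?divr_gt0//.
have -> : natR (tau m) * (la / 2) * (2 * ((natR (tau m))^-1 * S) + 4 * l / (mu m * natR (tau m))) = la * S + l.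
  by rewrite /la; field; rewrite !gt_eqF.
by rewrite mulrA in h *; lra.
Qed.

(** For the played mixture an action has weight [A a] at most twice the probability of drawing it,
    so the second moment of the estimate is at most 2, without the [1 / mu] of a single policy. This
    permits the larger rate [la = K mu_N]: the cost [2 la^2] per round and the level
    [Lg N = la tau_N mu_N] sum to at most [la * 3 K tau_N mu_N]. *)
Lemma played_tail m0 N : normal K Pi delta N ->
  exists E, [/\ measurable E, (P E <= (expR (- Lg N))%:E)%E &
    forall w, (forall n, (n < tau N)%N -> ok n w) -> ~ E w ->
      \sum_(n < tau N | (tau m0 <= n)%N) (\sum_pi cw n w pi * Rtrue pi) -
        3 * natR K * (natR (tau N) * mu N) <=
      \sum_(n < tau N | (tau m0 <= n)%N) (\sum_pi cw n w pi * est pi n w (z n w) (act n w))].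
Proof.
move=> nN; have N0 := normal_gt0 nN.
pose la := natR K * mu N.
have K0R : 0 < natR K by rewrite ltr0n.
have la0 : 0 < la by rewrite mulr_gt0.
pose U n w y a := if (tau m0 <= n)%N then - (la * \sum_pi cw n w pi * est pi n w y a) else 0.
pose c n w := if (tau m0 <= n)%N then - (la * \sum_pi cw n w pi * Rtrue pi) + 2 * la ^+ 2 else 0.
have [|||E [mE PE HE]] := @round_tail U c (tau N) (Lg N).
- move=> n nm; rewrite /c; case: (tau m0 <= n)%N; last exact: measurable_cst.
  apply: measurable_funD => //; apply: measurableT_comp => //; apply: measurable_funM => //.
  by apply: measurable_sum => pi; apply: measurable_funM => //; exact: measurable_cw.
- move=> n a nm; rewrite /U; case: (tau m0 <= n)%N; last exact: measurable_cst.
  apply: measurableT_comp => //; apply: measurable_funM => //.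
  apply: measurable_sum => pi; apply: measurable_funM; last exact: measurable_est.
  exact: (measurableT_comp (@measurable_cw n pi) measurable_fst).
- move=> n w nm okn; rewrite /U /c; case: (tau m0 <= n)%N; last first.
    exists (fun _ => 0); split; [exact: bmf_cst| |by rewrite ED_cst].
    by move=> y; under eq_bigr do rewrite expR0 mulr1; rewrite sum_qr// addr0.
  have [j [W [jn W0 W1 cwE qE]]] := okP okn.
  have k1 : K%:R * mu j <= 1 by have := Kmu j; lra.
  have bS : bmf (fun y => \sum_pi W pi * rw pi y).
    by apply: bmf_sum => pi; apply: bmfZ; exact: bmf_rw.
  exists (fun y => - la * (\sum_pi W pi * rw pi y) + 2 * la ^+ 2); split.
  + by apply: bmfD; [exact: bmfZ|exact: bmf_cst].
  + move=> y.
    have q0 a : 0 < qr n w y a by exact: qr_gt0.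
    pose A a := act_weight pol W a y.1; pose r a := clamp (tnth y.2 a).
    have r01 a : 0 <= r a <= 1 by exact: clamp01.
    have A0 a : 0 <= A a by exact: act_weight_ge0.
    have sA : \sum_a A a = 1 by rewrite sum_act_weight.
    have uE a : \sum_pi cw n w pi * est pi n w y a = r a * A a / qr n w y a.
      rewrite /A /act_weight [in RHS]big_mkcond/= mulr_sumr mulr_suml; apply: eq_bigr => pi _.
      by rewrite cwE /est -/(r a); case: eqP => _; rewrite ?mulr1 ?mulr0 ?mul0r ?mulr0//; ring.
    have Aq a : A a <= 2 * qr n w y a.
      rewrite qE /smoothed -/(A a); have := Kmu j; have := A0 a; have := mu0 j.
      by move=> h1 h2 h3; nra.
    have u0 a : 0 <= la * (r a * A a / qr n w y a).
      by have /andP[r0 _] := r01 a; rewrite mulr_ge0 ?(ltW la0)// divr_ge0 ?mulr_ge0// ltW.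
    apply: (@le_trans _ _ (\sum_a qr n w y a * (1 - la * (r a * A a / qr n w y a) + (la * (r a * A a / qr n w y a)) ^+ 2))).
      by apply: ler_sum => a _; rewrite uE ler_pM2l//; exact: expRN_le_quad.
    apply: (@le_trans _ _ (\sum_a (qr n w y a - la * (r a * A a) + 2 * la ^+ 2 * A a))).
      apply: ler_sum => a _; have /andP[r0 r1] := r01 a.
      have -> : qr n w y a * (1 - la * (r a * A a / qr n w y a) + (la * (r a * A a / qr n w y a)) ^+ 2) =
         qr n w y a - la * (r a * A a) + la ^+ 2 * (r a ^+ 2 * A a * (A a / qr n w y a)).
        by field; rewrite gt_eqF.
      have -> : 2 * la ^+ 2 * A a = la ^+ 2 * (A a * 2) by ring.
      rewrite lerD2l; apply: ler_wpM2l; first exact: sqr_ge0.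
      have h1 : A a / qr n w y a <= 2 by rewrite ler_pdivrMr.
      have h2 : 0 <= A a / qr n w y a by rewrite divr_ge0// ltW.
      have h3 : r a ^+ 2 * A a <= A a by rewrite ler_piMl// expr_le1.
      have h4 : 0 <= r a ^+ 2 * A a by rewrite mulr_ge0// sqr_ge0.
      exact: ler_pM.
    rewrite big_split/= sumrB sum_qr// -!mulr_sumr sA mulr1.
    have -> : \sum_a r a * A a = \sum_pi W pi * rw pi y; last by lra.
    rewrite [RHS](partition_big (fun pi => pol pi y.1) xpredT)//=; apply: eq_bigr => a _.
    by rewrite /A /act_weight mulr_sumr; apply: eq_bigr => pi /eqP <-; rewrite mulrC.
  + rewrite EDD; [|exact: bmfZ|exact: bmf_cst]; rewrite (@EDZ _ _ Y D (- la))// ED_cst ED_sum; last first.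
      by move=> pi; apply: bmfZ; exact: bmf_rw.
    have -> : \sum_pi ED D (fun y => W pi * rw pi y) = \sum_pi cw n w pi * Rtrue pi.
      by apply: eq_bigr => pi _; rewrite cwE EDZ//; exact: bmf_rw.
    by rewrite mulNr.
exists E; split=> // w okw nE; have := HE w okw nE.
set S1 := \sum_(n < tau N | _) _; set S2 := \sum_(n < tau N | _) _.
have h : \sum_(n < tau N) (U n w (z n w) (act n w) - c n w) >= la * (S1 - S2) - 2 * la ^+ 2 * natR (tau N).
  rewrite /S1 /S2 -sumrB mulr_sumr.
  have -> : 2 * la ^+ 2 * natR (tau N) = \sum_(n < tau N) 2 * la ^+ 2.
    by rewrite sumr_const card_ord -[RHS]mulr_natr.
  rewrite big_mkcond -sumrB; apply: ler_sum => n _; rewrite /U /c; case: ifP => _.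
    by lra.
  by rewrite sub0r subrr oppr_le0 mulr_ge0// sqr_ge0.
move=> /(le_trans h).
rewrite -(normal_mu2 K0 Pi0 delta01 nN).
have t0 : 0 < natR (tau N) by rewrite ltr0n tau_gt0.
have K1 : 1 <= natR K by rewrite ler1n.
have e1 : natR K * natR (tau N) * mu N ^+ 2 = la * (natR (tau N) * mu N) by rewrite /la; ring.
have e2 : 2 * la ^+ 2 * natR (tau N) = la * (2 * natR K * (natR (tau N) * mu N)) by rewrite /la; ring.
rewrite e1 e2 -mulrBr ler_pM2l// => h5.
have : 0 <= (natR K - 1) * (natR (tau N) * mu N) by rewrite mulr_ge0 ?subr_ge0 ?mulr_ge0// ltW.
by lra.
Qed.

End rounds.

(** * From the last completed epoch to the horizon *)

Lemma epoch_index T : exists N, (tau N <= T < tau N.+1)%N.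
Proof.
elim: T => [|T [N /andP[lo hi]]]; first by exists 0%N.
have [h|h] := ltnP T.+1 (tau N.+1); first by exists N; rewrite h leqW.
exists N.+1; rewrite h /=; apply: leq_trans (tau_lt N.+1); exact: hi.
Qed.

Section numeric.
Context {R : realType}.
Notation natR n := (@GRing.natmul R 1 n).
Variables (K T : nat) (v : R).
Hypotheses (K0 : (0 < K)%N) (T0 : (0 < T)%N) (v0 : 0 < v).

Lemma polylog_ge : 1 + ln (natR T) <= @polylog R K T v.
Proof.
have lT : 0 <= ln (natR T) by rewrite ln_ge0// ler1n.
have lK : 0 <= ln (natR K) by rewrite ln_ge0// ler1n.
have lv : 0 <= ln (1 + v) by rewrite ln_ge0// lerDl ltW.
rewrite /polylog -[leLHS]mulr1 -mulrA ler_wpM2l//; first by lra.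
by rewrite -[leLHS]mulr1; apply: ler_pM => //; lra.
Qed.

Lemma polylog_ge1 : 1 <= @polylog R K T v.
Proof. by apply: le_trans polylog_ge; rewrite lerDl ln_ge0// ler1n. Qed.

(** The two calls per epoch satisfy [N^2 <= tau N <= T], and [T] is compared with [K T / v] by the
    hypothesis [v <= K polylog^j]; hence the exponent [2 + j] and 354 = 352 + 2. *)
Lemma call_bounds N (S : R) : (0 < N)%N -> (tau N <= T)%N ->
  S <= 352 * (1 + ln (natR (tau N))) ^+ 2 * Num.sqrt (natR K * natR (tau N) / v) ->
  forall j : nat, v <= natR K * polylog K T v ^+ j ->
  S + 2 * natR N <= 354 * polylog K T v ^+ (2 + j) * Num.sqrt (natR K * natR T / v).
Proof.
move=> N0 NT hS j vj.
set p := polylog K T v; set B := Num.sqrt (natR K * natR T / v).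
have p1 : 1 <= p by exact: polylog_ge1.
have K0R : 0 < natR K by rewrite ltr0n.
have T0R : 0 < natR T by rewrite ltr0n.
have t0 : 0 < natR (tau N) by rewrite ltr0n tau_gt0.
have tT : natR (tau N) <= natR T by rewrite ler_nat.
have pj : 1 <= p ^+ j by exact: exprn_ege1.
have B0 : 0 <= B by exact: sqrtr_ge0.
have h1 : 352 * (1 + ln (natR (tau N))) ^+ 2 * Num.sqrt (natR K * natR (tau N) / v) <= 352 * p ^+ (2 + j) * B.
  have l0 : 0 <= ln (natR (tau N)) by rewrite ln_ge0// ler1n tau_gt0.
  have lp : 1 + ln (natR (tau N)) <= p.
    by apply: le_trans polylog_ge; rewrite lerD2l ler_ln ?posrE.
  have l2 : (1 + ln (natR (tau N))) ^+ 2 <= p ^+ 2 by rewrite lerXn2r ?nnegrE//; lra.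
  have p2 : p ^+ 2 <= p ^+ (2 + j) by apply: ler_weXn2l => //; exact: leq_addr.
  have q0 : 0 <= (1 + ln (natR (tau N))) ^+ 2 by exact: sqr_ge0.
  apply: ler_pM; [exact: mulr_ge0 (ler0n _ _) (sqr_ge0 _)|exact: sqrtr_ge0| |].
    by apply: ler_wpM2l; [exact: ler0n|exact: le_trans p2].
  rewrite ler_sqrt; last by rewrite divr_ge0 ?mulr_ge0// ltW.
  by rewrite ler_pM2r ?invr_gt0// ler_pM2l.
have h2 : natR N <= p ^+ (2 + j) * B.
  have pp0 : 0 <= p ^+ (2 + j) by apply: exprn_ge0; lra.
  rewrite -[leRHS]ger0_norm; last by rewrite mulr_ge0.
  rewrite -[leLHS]ger0_norm// -ler_sqr ?nnegrE// !real_normK ?num_real//.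
  rewrite exprMn sqr_sqrtr; last by rewrite divr_ge0 ?mulr_ge0// ltW.
  apply: (@le_trans _ _ (natR T)).
    by rewrite -natrX ler_nat (leq_trans (tau_ge_sqr N)).
  have -> : (p ^+ (2 + j)) ^+ 2 * (natR K * natR T / v) = natR T * ((natR K * p ^+ j) / v * (p ^+ 4 * p ^+ j)).
    by rewrite exprD; field; rewrite gt_eqF.
  rewrite ler_peMr// -[leLHS]mulr1 ler_pM//; first by rewrite ler_pdivlMr// mul1r.
  by rewrite -[leLHS]mulr1 ler_pM// exprn_ege1.
by lra.
Qed.

Lemma epochs_le_sqrt N : (tau N <= T)%N -> natR N <= Num.sqrt (natR T).
Proof.
move=> NT; rewrite -[leLHS]ger0_norm// -sqrtr_sqr ler_sqrt// -natrX ler_nat.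
exact: leq_trans (tau_ge_sqr N) NT.
Qed.

End numeric.

Lemma sum_epochs (R : realType) (m0 m : nat) (F : nat -> R) : (m0 <= m)%N ->
  \sum_(n < tau m | (tau m0 <= n)%N) F n =
  \sum_(m0 <= j < m) \sum_(tau j <= n < tau j.+1) F n.
Proof.
move=> m0m; rewrite -(big_mkord (fun n => tau m0 <= n)%N F).
have mm : (tau m0 <= tau m)%N by rewrite tau_mono.
rewrite (big_cat_nat (n := tau m0))//= big_nat_cond big1 ?add0r; last first.
  by move=> i /andP[/andP[_ im] mi]; move: im; rewrite ltnNge mi.
transitivity (\sum_(tau m0 <= n < tau m) F n).
  rewrite big_nat_cond [RHS]big_nat_cond; apply: eq_bigl => i.
  by case: (tau m0 <= i)%N; rewrite ?andbT ?andbF.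
elim: m m0m {mm} => [|m IH]; first by rewrite leqn0 => /eqP ->; rewrite !big_geq.
rewrite leq_eqVlt => /orP[/eqP ->|m0m]; first by rewrite !big_geq.
rewrite big_nat_recr//= -IH// (big_cat_nat (n := tau m))//.
  by rewrite tau_mono.
exact: ltnW (tau_lt m).
Qed.

Lemma sum_hist (R : realType) (K : nat) (X : Type) (o : nat -> @obs R K X) n (F : @obs R K X -> R) :
  \sum_(h <- [seq o i | i <- iota 0 n]) F h = \sum_(i < n) F (o i).
Proof. by rewrite big_map -[in LHS](subn0 n) -/(index_iota 0 n) big_mkord. Qed.

(** * Bounds along a single run on the good event *)

Section pathwise.
Context {R : realType} {K : nat} {dX : measure_display} {X : measurableType dX} {Pi : finType}.
Variables (pol : Pi -> X -> 'I_K) (pi0 : Pi).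
Notation Y := (X * K.-tuple R)%type.
Variables (D : probability Y R) (delta : R) (amo : seq Y -> Pi).
Context {dO : measure_display} {Omega : measurableType dO}.
Variables (z : nat -> Omega -> Y) (act : nat -> Omega -> 'I_K).
Hypothesis mpol : forall pi a, measurable (pol pi @^-1` [set a]).
Hypothesis K0 : (0 < K)%N.
Hypothesis delta01 : 0 < delta < 1.
Hypothesis amoP : is_AMO pol amo.
Variables (w : Omega) (T : nat).
Hypothesis rew01 : forall t, (t < T)%N -> forall a, 0 <= tnth (z t w).2 a <= 1.

Notation natR n := (@GRing.natmul R 1 n).
Notation mu m := (@mu_ R K Pi delta m).
Notation Lg m := (@Lg R Pi delta m).
Notation zw := (z ^~ w).
Notation aw := (act ^~ w).
Notation o := (observed pol amo delta pi0 zw aw).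
Notation ew := (epoch_weights pol amo delta pi0 zw aw).
Notation el := (epoch_leader pol amo delta pi0 zw aw).
Notation inv := (epoch_inv pol amo delta pi0 zw aw).
Notation okw n := (ok pol pi0 delta amo z act n w).
Notation cww n := (cw pol pi0 delta amo z act n w).
Notation qrw n := (qr pol pi0 delta amo z act n w).
Notation estw pi n := (est pol pi0 delta amo z act pi n w (z n w) (act n w)).
Notation varw pi n := (value_var pol pi0 D delta amo z act pi n w).

Let Pi0 : (0 < #|Pi|)%N. Proof. by apply/card_gt0P; exists pi0. Qed.
Let mu0 m : 0 < mu m. Proof. exact: mu_gt0. Qed.
Let Kmu m : K%:R * mu m <= 2^-1. Proof. exact: Kmu_le. Qed.

Lemma epoch_exists n : (n <= T)%N -> exists m, inv m n.
Proof.
move=> nT; apply: run_epoch => // t tn a.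
by have /andP[] := rew01 (leq_trans tn nT) a.
Qed.

Lemma epoch_at j n : (n <= T)%N -> (tau j <= n < tau j.+1)%N -> inv j n.
Proof.
move=> nT /andP[lo hi].
have [m inm] := epoch_exists nT.
suff <- : m = j by [].
apply/eqP; rewrite eqn_leq; apply/andP; split; rewrite -ltnS -tau_ltmono.
  exact: leq_ltn_trans (ei_lo inm) hi.
exact: leq_ltn_trans lo (ei_hi inm).
Qed.

Lemma epoch_ok n : (n <= T)%N -> okw n.
Proof.
move=> nT; have [m [lo hi rn _ Q0 Q1 _]] := epoch_exists nT.
by rewrite /ok rn /epoch_state; apply/and4P; split=> //; apply/forallP.
Qed.

Definition epoch_play j : @weights R Pi := [ffun pi => complete (ew j) (el j) pi].
Definition epoch_var j pi : R :=
  ED D (fun y => inv_smoothed pol (epoch_play j) (mu j) pi y.1).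

Lemma epoch_qr j n y a : (n <= T)%N -> (tau j <= n < tau j.+1)%N ->
  qrw n y a = smoothed pol (epoch_play j) (mu j) a y.1.
Proof. by move=> nT /(epoch_at nT)/ei_run; rewrite /qr => ->. Qed.

Lemma epoch_cw j n pi : (n <= T)%N -> (tau j <= n < tau j.+1)%N ->
  cww n pi = complete (ew j) (el j) pi.
Proof. by move=> nT /(epoch_at nT)/ei_run; rewrite /cw => ->; rewrite completed_epoch ffunE. Qed.

Lemma epoch_play_ge0 j n pi : (n <= T)%N -> (tau j <= n < tau j.+1)%N -> 0 <= epoch_play j pi.
Proof.
move=> nT /(epoch_at nT) i; rewrite ffunE; apply: le_trans (ei_nonneg i pi) _.
exact: complete_ge (ei_mass i).
Qed.

Lemma epoch_value_var j n pi : (n <= T)%N -> (tau j <= n < tau j.+1)%N ->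
  varw pi n = epoch_var j pi.
Proof.
move=> nT jn; apply: value_varE => //; first exact: epoch_ok.
  by move=> pi'; exact: epoch_play_ge0 jn.
by move=> y a; exact: epoch_qr.
Qed.

Lemma est_ips n pi : (n < T)%N -> estw pi n = ips (o n) (pol pi (obs_ctx (o n))).
Proof. by move=> nT; rewrite /est /ips clampE ?rew01. Qed.

Lemma ips_sum_hist n pi : (n <= T)%N -> ips_sum pol (hist o n) pi = \sum_(i < n) estw pi i.
Proof.
move=> nT; rewrite /ips_sum sum_hist; apply: eq_bigr => i _.
by rewrite est_ips// (leq_trans (ltn_ord i)).
Qed.

Lemma ips_sum_batch j pi : (tau j.+1 <= T)%N ->
  ips_sum pol (batch o j) pi = \sum_(tau j <= i < tau j.+1) estw pi i.
Proof.
move=> nT; rewrite /ips_sum /batch big_map -/(index_iota _ _).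
rewrite big_nat_cond [RHS]big_nat_cond; apply: eq_bigr => i /andP[/andP[_ hi] _].
by rewrite est_ips// (leq_trans hi).
Qed.

(** Enough draws for [M mu >= 1], as the sampling argument requires, yet [(M + 1) mu <= 2]. The
    union bound has [M + 1] choices of a policy: the draws and the policy being evaluated. *)
Definition sparsity m : nat := (Num.truncn (mu m)^-1).+1.

Lemma sparsity_ge m : 1 <= natR (sparsity m) * mu m.
Proof.
have i0 : 0 < (mu m)^-1 by rewrite invr_gt0.
have /andP[_ /ltW h] := truncn_itv (ltW i0).
by rewrite -ler_pdivrMr// div1r.
Qed.

Lemma sparsity_le m : natR (sparsity m).+1 * mu m <= 2.
Proof.
have i0 : 0 < (mu m)^-1 by rewrite invr_gt0.
have /andP[h _] := truncn_itv (ltW i0).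
have h1 : natR (Num.truncn (mu m)^-1) * mu m <= 1 by rewrite -ler_pdivlMr// div1r.
have k1 : 1 <= natR K by rewrite ler1n.
have h2 : mu m <= natR K * mu m by rewrite ler_peMl// ltW.
have h3 := Kmu m.
by rewrite /sparsity -!natr1 !mulrDl !mul1r; lra.
Qed.

Variable N : nat.
Hypotheses (N0 : (0 < N)%N) (NT : (tau N <= T)%N).

Hypothesis value_dev : forall m pi (b : bool), (0 < m)%N -> (m <= N)%N ->
  (-1) ^+ b * \sum_(n < tau m) (estw pi n - Rtrue pol D pi) <=
    mu m * (\sum_(n < tau m) varw pi n) + 2 * Lg m / mu m.
Hypothesis context_dev : forall m (s : seq Pi) pi, (0 < m)%N -> (m < N)%N -> size s = sparsity m ->
  ED D (fun y => inv_smoothed pol (@empirical_weights R Pi (sparsity m) s) (mu m) pi y.1) <=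
    2 * ((tau m)%:R^-1 * \sum_(n < tau m)
      inv_smoothed pol (@empirical_weights R Pi (sparsity m) s) (mu m) pi (z n w).1) +
    4 * ((sparsity m).+1%:R * Lg m) / (mu m * (tau m)%:R).
Hypothesis played_dev : forall m0, normal K Pi delta m0 ->
  (forall j, (j < m0)%N -> ~~ normal K Pi delta j) -> (m0 <= N)%N ->
  \sum_(n < tau N | (tau m0 <= n)%N) (\sum_pi cww n pi * Rtrue pol D pi) -
      3 * natR K * (natR (tau N) * mu N) <=
    \sum_(n < tau N | (tau m0 <= n)%N) (\sum_pi cww n pi * estw pi n).

Let tauT m : (m <= N)%N -> (tau m <= T)%N.
Proof. by move=> mN; apply: leq_trans NT; rewrite tau_mono. Qed.

Lemma epoch_updates_bound :
  \sum_(1 <= j < N.+1) natR (epoch_updates pol amo delta pi0 zw aw j) <=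
  352 * (1 + ln (natR (tau N))) ^+ 2 *
    Num.sqrt (natR K * natR (tau N) / @ln R (#|Pi|%:R / delta)).
Proof.
have iN : inv N (tau N) by apply: epoch_at => //; rewrite leqnn tau_lt.
have epochT j n : (j < N)%N -> (n < tau j.+1)%N -> (n < T)%N.
  by move=> jN nj; apply: leq_trans nj _; exact: tauT.
apply: (@updates_bound R K dX X Pi pol amo delta K0 amoP pi0 delta01 o N ew
   (epoch_updates pol amo delta pi0 zw aw) (ei_pos iN) _ (ei_cd iN) (Rtrue pol D) epoch_var) => //.
- move=> j pi jN; have jj : (tau j <= tau j < tau j.+1)%N by rewrite leqnn tau_lt.
  have k1 : K%:R * mu j <= 1 by have := Kmu j; lra.
  have W0 : forall pi, 0 <= epoch_play j pi.
    by move=> pi'; apply: (epoch_play_ge0 pi' _ jj); apply: tauT; exact: ltnW.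
  have b := bmf_inv_smoothed mpol pi W0 (mu0 j) k1.
  rewrite -[leRHS](ED_cst D); apply: ED_le => //; first exact: bmf_cst.
  by move=> y; exact: inv_smoothed_le.
- move=> m pi mN nm; have m0 := normal_gt0 nm.
  rewrite ips_sum_hist ?tauT//.
  have -> : \sum_(j < m) natR (tau j.+1 - tau j) * epoch_var j pi = \sum_(n < tau m) varw pi n.
    rewrite -(big_mkord xpredT (fun j => natR (tau j.+1 - tau j) * epoch_var j pi)).
    transitivity (\sum_(n < tau m | (tau 0 <= n)%N) varw pi n); last by apply: eq_bigl.
    rewrite (sum_epochs (fun n => varw pi n) (leq0n m)); apply: eq_big_nat => j /andP[_ jm].
    rewrite (eq_big_nat _ _ (F2 := fun _ => epoch_var j pi)); last first.
      move=> n nj; apply: epoch_value_var => //; apply: ltnW; apply: (epochT j).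
        exact: leq_trans jm mN.
      by case/andP: nj.
    by rewrite big_const_nat iter_addr_0 mulr_natl.
  have -> : \sum_(i < tau m) estw pi i - natR (tau m) * Rtrue pol D pi =
      \sum_(n < tau m) (estw pi n - Rtrue pol D pi).
    by rewrite sumrB sumr_const card_ord mulr_natl.
  rewrite ler_norml; have := value_dev pi true m0 mN; have := value_dev pi false m0 mN.
  rewrite expr0 expr1 mul1r mulN1r => h1 h2; apply/andP; split=> //.
  by rewrite lerNl.
- move=> m pi mN nm; have m0 := normal_gt0 nm.
  have mm : (tau m <= tau m < tau m.+1)%N by rewrite leqnn tau_lt.
  have mT : (tau m <= T)%N by apply: tauT; exact: ltnW.
  (* The two leaders can differ only at [m = 0], which is not normal. *)
  have E : [ffun pi => played amo o ew m pi] = epoch_play m.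
    apply/ffunP => pi'; rewrite !ffunE /played.
    by case: (m) m0.
  rewrite E /epoch_var; apply: (sampled_value mpol (M := sparsity m)) => //.
  + by move=> pi'; exact: epoch_play_ge0 mm.
  + by under eq_bigr do rewrite ffunE; exact: mass_complete.
  + exact: sparsity_ge.
  + move=> s sz; apply: le_trans (context_dev pi m0 mN sz) _.
    apply: lerD.
      by rewrite ler_pM2l// /ctx_mean size_hist sum_hist.
    (* Writing [Lg] as [K tau mu^2] turns the deviation term into [4 K (M + 1) mu <= 8 K]. *)
    rewrite -(normal_mu2 K0 Pi0 delta01 nm).
    have t0 : 0 < natR (tau m) by rewrite ltr0n tau_gt0.
    have -> : 4 * ((sparsity m).+1%:R * (natR K * natR (tau m) * mu m ^+ 2)) / (mu m * natR (tau m)) =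
      4 * natR K * (natR (sparsity m).+1 * mu m) by field; rewrite !gt_eqF.
    have -> : 8 * natR K = 4 * natR K * 2 by ring.
    by rewrite ler_pM2l ?mulr_gt0 ?ltr0n// sparsity_le.
- move=> m0 nm m0min m0N; have m00 := normal_gt0 nm.
  have := played_dev nm m0min m0N.
  have pE j pi : (m0 <= j < N)%N -> played amo o ew j pi = complete (ew j) (el j) pi.
    by case/andP=> mj _; rewrite /played; case: j mj => //; rewrite leqNgt m00.
  rewrite (sum_epochs (fun n => \sum_pi cww n pi * Rtrue pol D pi) m0N).
  rewrite (sum_epochs (fun n => \sum_pi cww n pi * estw pi n) m0N).
  have -> : \sum_(m0 <= j < N) \sum_(tau j <= n < tau j.+1) \sum_pi cww n pi * Rtrue pol D pi =
      \sum_(m0 <= j < N) natR (tau j.+1 - tau j) * (\sum_pi played amo o ew j pi * Rtrue pol D pi).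
    apply: eq_big_nat => j mj; have jN : (j < N)%N by case/andP: mj.
    rewrite (eq_big_nat _ _ (F2 := fun _ => \sum_pi played amo o ew j pi * Rtrue pol D pi)).
      by rewrite big_const_nat iter_addr_0 mulr_natl.
    move=> n nj; apply: eq_bigr => pi _; rewrite pE// -(@epoch_cw j n)// ltnW//.
    by apply: (epochT j) => //; case/andP: nj.
  have -> : \sum_(m0 <= j < N) \sum_(tau j <= n < tau j.+1) \sum_pi cww n pi * estw pi n =
      \sum_(m0 <= j < N) \sum_pi played amo o ew j pi * ips_sum pol (batch o j) pi; last by [].
  apply: eq_big_nat => j mj; have jN : (j < N)%N by case/andP: mj.
  rewrite exchange_big/=; apply: eq_bigr => pi _; rewrite ips_sum_batch ?tauT// mulr_sumr.
  apply: eq_big_nat => n nj; rewrite pE// -(@epoch_cw j n)// ltnW//.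
  by apply: (epochT j) => //; case/andP: nj.
Qed.

Lemma run_bounds : (T < tau N.+1)%N ->
  if run pol amo delta pi0 zw aw T is Some s then
    (st_cd_calls s)%:R <= 354 * Num.sqrt (natR T) /\
    (forall j : nat, @ln R (#|Pi|%:R / delta) <= K%:R * polylog K T (ln (#|Pi|%:R / delta)) ^+ j ->
       (st_amo_calls s)%:R <= 354 * polylog K T (ln (#|Pi|%:R / delta)) ^+ (2 + j) *
         Num.sqrt (K%:R * T%:R / ln (#|Pi|%:R / delta)))
  else False.
Proof.
move=> TN; have T0 : (0 < T)%N by apply: leq_trans NT; exact: tau_gt0.
have iT : inv N T by apply: epoch_at => //; rewrite NT.
have v0 := v_gt0 Pi0 delta01.
rewrite (ei_run iT); split.
  have := epochs_le_sqrt (R := R) NT; have := sqrtr_ge0 (natR T).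
  rewrite /epoch_state [st_cd_calls _]/=; lra.
move=> j vj; apply: le_trans (call_bounds K0 T0 v0 N0 NT epoch_updates_bound vj).
rewrite /epoch_state [st_amo_calls _]/= natr_sum.
have -> : 2 * natR N = \sum_(1 <= i < N.+1) 2.
  by rewrite big_const_nat iter_addr_0 subSS subn0 mulr_natr.
rewrite -big_split/= le_eqVlt; apply/orP; left; apply/eqP; apply: eq_bigr => i _.
by rewrite -addn2 natrD.
Qed.

End pathwise.

(** * Failure probability *)

Section failure.
Context {R : realType} {K : nat} {dX : measure_display} {X : measurableType dX} {Pi : finType}.
Variables (pol : Pi -> X -> 'I_K) (pi0 : Pi).
Notation Y := (X * K.-tuple R)%type.
Variables (D : probability Y R) (delta : R) (amo : seq Y -> Pi).
Context {dO : measure_display} {Omega : measurableType dO} (P : probability Omega R).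

(** Failure is only covered by a measurable event, so [G] itself may be any predicate. *)
Definition but_prob (r : R) (G : Omega -> Prop) :=
  exists E, [/\ measurable E, (P E <= r%:E)%E & forall w, ~ E w -> G w].

Lemma but_prob_le r r' (G G' : Omega -> Prop) : r <= r' -> (forall w, G w -> G' w) ->
  but_prob r G -> but_prob r' G'.
Proof.
move=> rr GG [E [mE PE HE]]; exists E; split=> //; last by move=> w /HE/GG.
by apply: le_trans PE _; rewrite lee_fin.
Qed.

Lemma but_prob_all (I : finType) (r : I -> R) (G : I -> Omega -> Prop) :
  (forall i, but_prob (r i) (G i)) -> but_prob (\sum_i r i) (fun w => forall i, G i w).
Proof.
move=> /choice[E HE]; exists (\big[setU/set0]_(i <- index_enum I) E i).
have [mU PU] : measurable (\big[setU/set0]_(i <- index_enum I) E i) /\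
    (P (\big[setU/set0]_(i <- index_enum I) E i) <= (\sum_(i <- index_enum I) r i)%:E)%E.
  elim: (index_enum I) => [|i s [mU PU]]; first by rewrite !big_nil measure0.
  have [mE PE _] := HE i; rewrite !big_cons; split; first exact: measurableU.
  have h := @measureU2 _ _ _ P _ _ mE mU.
  by rewrite EFinD; apply: le_trans h _; exact: leeD.
split=> // w nU i; have [_ _] := HE i; apply=> Ei; apply: nU.
by rewrite -bigcup_seq; exists i => //=; rewrite mem_index_enum.
Qed.

Lemma but_prob_and r1 r2 (G1 G2 : Omega -> Prop) : but_prob r1 G1 -> but_prob r2 G2 ->
  but_prob (r1 + r2) (fun w => G1 w /\ G2 w).
Proof.
move=> h1 h2; have := @but_prob_all bool (fun b => if b then r1 else r2)
  (fun b => if b then G1 else G2).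
case=> [[]//|E [mE PE HE]]; exists E; split=> //; first by rewrite big_bool in PE.
by move=> w nE; split; [exact: (HE w nE true)|exact: (HE w nE false)].
Qed.

Variables (z : nat -> Omega -> Y) (act : nat -> Omega -> 'I_K).
Hypothesis mpol : forall pi a, measurable (pol pi @^-1` [set a]).
Hypothesis K0 : (0 < K)%N.
Hypothesis delta01 : 0 < delta < 1.
Hypothesis mamo : measurable_AMO amo.
Hypothesis amoP : is_AMO pol amo.
Hypothesis inter : interaction pol amo delta pi0 D P z act.
Hypothesis D01 : D [set xr | forall a : 'I_K, 0 <= tnth xr.2 a <= 1] = 1%E.

Notation natR n := (@GRing.natmul R 1 n).
Notation mu m := (@mu_ R K Pi delta m).
Notation Lg m := (@Lg R Pi delta m).
Notation okw w n := (ok pol pi0 delta amo z act n w).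
Notation estw w pi n := (est pol pi0 delta amo z act pi n w (z n w) (act n w)).
Notation sp m := (@sparsity R K Pi delta m).

Let Pi0 : (0 < #|Pi|)%N. Proof. by apply/card_gt0P; exists pi0. Qed.
Let mu0 m : 0 < mu m. Proof. exact: mu_gt0. Qed.

Lemma card_expR_Lg m : (0 < m)%N -> natR #|Pi| * expR (- Lg m) = delta / (16 * natR (tau m) ^+ 2).
Proof.
move=> m0; have t0 : 0 < natR (tau m) by rewrite ltr0n tau_gt0.
have p0 : 0 < natR #|Pi| by rewrite ltr0n.
have /andP[d0 _] := delta01.
rewrite expRN -[Lg m]/(ln (16 * natR (tau m) ^+ 2 * natR #|Pi| / delta)) lnK ?posrE ?divr_gt0 ?mulr_gt0 ?exprn_gt0//.
by field; rewrite !gt_eqF.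
Qed.

Lemma tau_ge_succ n : (n.+2 <= tau n.+1)%N.
Proof. by elim: n => [//|n IH]; apply: leq_ltn_trans IH (tau_lt _). Qed.

(** As [tau (n + 1) >= n + 2], each term is at most [1 / ((n + 1) (n + 2))], which telescopes. *)
Lemma sum_tau_inv N : \sum_(m < N) (natR (tau m.+1) ^+ 2)^-1 <= 1 :> R.
Proof.
suff : \sum_(m < N) (natR (tau m.+1) ^+ 2)^-1 <= 1 - (natR N.+1)^-1 :> R.
  by move/le_trans; apply; rewrite gerBl.
elim: N => [|N IH]; first by rewrite big_ord0 invr1 subrr.
rewrite big_ord_recr/=; apply: le_trans (lerD IH (lexx _)) _.
have h : (natR (tau N.+1) ^+ 2)^-1 <= (natR N.+1 * natR N.+2)^-1 :> R.
  rewrite lef_pV2 ?posrE ?mulr_gt0 ?exprn_gt0 ?ltr0n ?tau_gt0//.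
  rewrite -natrM -natrX ler_nat -mulnn leq_mul ?tau_ge_succ//.
  exact: ltnW (tau_ge_succ N).
apply: le_trans (lerD (lexx _) h) _; rewrite le_eqVlt; apply/orP; left; apply/eqP.
have -> : natR N.+2 = natR N.+1 + 1 :> R by rewrite natr1.
have n0 : 0 < natR N.+1 :> R by rewrite ltr0n.
field; rewrite !gt_eqF//; lra.
Qed.

Lemma rewards_bounded T : but_prob 0 (fun w =>
  forall t, (t < T)%N -> forall a, 0 <= tnth (z t w).2 a <= 1).
Proof.
set G0 := [set xr : Y | forall a : 'I_K, 0 <= tnth xr.2 a <= 1].
have mG : measurable G0.
  rewrite (_ : G0 = ~` [set xr : Y | [exists a, ~~ (0 <= tnth xr.2 a <= 1)]]); last first.
    apply/seteqP; split=> xr /=; first by move=> h /existsP[a]; rewrite h.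
    by move=> h a; apply/negPn/negP => na; apply: h; apply/existsP; exists a.
  apply: measurableC; apply: measurable_exists => a.
  have mt : measurable_fun setT (fun y : Y => tnth y.2 a).
    by apply: (measurableT_comp (measurable_tnth a)); exact: measurable_snd.
  apply: measurable_boolset; apply: measurable_neg.
  by apply: measurable_and; exact: measurable_fun_ler.
have h (t : 'I_T) : but_prob 0 (fun w => forall a, 0 <= tnth (z t w).2 a <= 1).
  have mz : measurable (z t @^-1` G0).
    by rewrite -[X in measurable X]setTI; exact: (ip_meas_pair inter t measurableT mG).
  exists (~` (z t @^-1` G0)); split; first exact: measurableC.
    have ms : <<s past z act t >> setT.
      by have := @measurableT _ (g_sigma_algebraType (past z act t)).
    have := ip_fresh inter ms mG; rewrite setTI D01 mule1 probability_setT.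
    by rewrite probability_setC// => ->; rewrite subee.
  by move=> w /contrapT.
apply: but_prob_le (but_prob_all h); first by rewrite big1.
by move=> w H t tT; exact: (H (Ordinal tT)).
Qed.

Notation v := (@ln R (#|Pi|%:R / delta)).

Definition call_bounds_hold T w : Prop :=
  if run pol amo delta pi0 (z ^~ w) (act ^~ w) T is Some s then
    (st_cd_calls s)%:R <= 354 * Num.sqrt (natR T) /\
    (forall j : nat, v <= K%:R * polylog K T v ^+ j ->
       (st_amo_calls s)%:R <=
       354 * polylog K T v ^+ (2 + j) * Num.sqrt (K%:R * T%:R / v))
  else False.

Definition value_dev m pi (b : bool) w : Prop :=
  (forall n, (n < tau m)%N -> okw w n) ->
  (-1) ^+ b * \sum_(n < tau m) (estw w pi n - Rtrue pol D pi) <=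
    mu m * (\sum_(n < tau m) value_var pol pi0 D delta amo z act pi n w) + 2 * Lg m / mu m.

Definition context_dev m (s : seq Pi) pi w : Prop :=
  (forall n, (n < tau m)%N -> okw w n) ->
  ED D (fun y => inv_smoothed pol (@empirical_weights R Pi (sp m) s) (mu m) pi y.1) <=
    2 * ((tau m)%:R^-1 * \sum_(n < tau m)
      inv_smoothed pol (@empirical_weights R Pi (sp m) s) (mu m) pi (z n w).1) +
    4 * ((sp m).+1%:R * Lg m) / (mu m * (tau m)%:R).

Definition played_dev N w : Prop := forall m0, normal K Pi delta m0 ->
  (forall j, (j < m0)%N -> ~~ normal K Pi delta j) -> (m0 <= N)%N ->
  (forall n, (n < tau N)%N -> okw w n) ->
  \sum_(n < tau N | (tau m0 <= n)%N) (\sum_pi cw pol pi0 delta amo z act n w pi * Rtrue pol D pi) -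
      3 * natR K * (natR (tau N) * mu N) <=
    \sum_(n < tau N | (tau m0 <= n)%N) (\sum_pi cw pol pi0 delta amo z act n w pi * estw w pi n).

(** With [p = |Pi| exp(- Lg m)], both signs of the value deviations cost [2 p]. The contexts are
    tested at level [(M + 1) Lg m] for [|Pi|^(M + 1)] choices, which costs [p^(M + 1) <= p]. *)
Lemma epoch_devs m : (0 < m)%N ->
  but_prob (3 * (delta / (16 * natR (tau m) ^+ 2))) (fun w =>
    (forall pi b, value_dev m pi b w) /\
    (forall s pi, size s = sp m -> context_dev m s pi w)).
Proof.
move=> m0; have pE := card_expR_Lg m0; set p := delta / _ in pE *.
have p0 : 0 < p.
  have /andP[d0 _] := delta01.
  by rewrite divr_gt0// mulr_gt0// exprn_gt0// ltr0n tau_gt0.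
have p1 : p <= 1.
  have /andP[_ d1] := delta01; rewrite ler_pdivrMr ?mul1r; last first.
    by rewrite mulr_gt0// exprn_gt0// ltr0n tau_gt0.
  have : 1 <= natR (tau m) by rewrite ler1n tau_gt0.
  by move=> /(exprn_ege1 2); lra.
have V : but_prob (2 * p) (fun w => forall u : Pi * bool, value_dev m u.1 u.2 w).
  have h (u : Pi * bool) : but_prob (expR (- Lg m)) (value_dev m u.1 u.2).
    have [E [mE PE HE]] := value_tail mpol K0 delta01 mamo inter u.1 m0 (sqrr_sign R u.2).
    by exists E; split=> // w nE okw; exact: HE.
  apply: but_prob_le (but_prob_all h); last by [].
  have -> : \sum_(u : Pi * bool) expR (- Lg m) = natR (#|Pi| * 2) * expR (- Lg m).
    by rewrite sumr_const card_prod card_bool mulr_natl.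
  by rewrite natrM -pE; lra.
have C : but_prob p (fun w => forall u : (sp m).-tuple Pi * Pi, context_dev m u.1 u.2 w).
  have h (u : (sp m).-tuple Pi * Pi) :
      but_prob (expR (- ((sp m).+1%:R * Lg m))) (context_dev m u.1 u.2).
    have [E [mE PE HE]] := context_tail mpol K0 delta01 mamo inter u.2 ((sp m).+1%:R * Lg m) m0
      (@empirical_weights_ge0 R Pi (sp m) u.1).
    by exists E; split=> // w nE okw; exact: HE.
  apply: but_prob_le (but_prob_all h); last by [].
  have sE (x : R) : \sum_(u : (sp m).-tuple Pi * Pi) x = natR (#|Pi| ^ (sp m).+1) * x.
    by rewrite sumr_const card_prod card_tuple -expnSr mulr_natl.
  rewrite sE natrX.
  rewrite -mulrN expRM_natl -exprMn pE -[leRHS]expr1.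
  by apply: (ler_wiXn2l (ltW p0) p1).
apply: but_prob_le (but_prob_and V C); first by lra.
move=> w [hV hC]; split=> [pi b|s pi sz]; first exact: (hV (pi, b)).
by have := hC (tcast sz (in_tuple s), pi); rewrite /= val_tcast.
Qed.

(** The first normal epoch does not depend on the outcome, so the quantifier over [m0] covers a
    single tail event. *)
Lemma played_devs N : (0 < N)%N -> but_prob (delta / 16) (played_dev N).
Proof.
move=> N0; have /andP[d0 _] := delta01.
have [nN|nN] := boolP (normal K Pi delta N); last first.
  exists set0; split; [exact: measurable0|by rewrite measure0 lee_fin divr_ge0// ltW|].
  by move=> w _ m0 nm _ m0N; case/negP: nN; exact: normal_mono K0 Pi0 delta01 _ _ m0N nm.
have [m1 nm1 mmin] := ex_minnP (ex_intro (fun j => normal K Pi delta j) N nN).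
have [E [mE PE HE]] := played_tail mpol K0 delta01 mamo inter m1 nN.
exists E; split=> //.
  apply: le_trans PE _; rewrite lee_fin.
  have h1 : 1 <= natR #|Pi| by rewrite ler1n.
  have h2 : 1 <= natR (tau N) ^+ 2 by rewrite exprn_ege1// ler1n tau_gt0.
  apply: (@le_trans _ _ (natR #|Pi| * expR (- Lg N))).
    by rewrite ler_peMl// expR_ge0.
  rewrite card_expR_Lg// ler_pM2l// lef_pV2 ?posrE ?mulr_gt0 ?ltr0n ?tau_gt0//.
  by lra.
move=> w nE m0 nm m0min m0N okw.
have -> : m0 = m1; last exact: HE.
apply/eqP; rewrite eqn_leq (mmin _ nm) andbT leqNgt; apply/negP => /m0min.
by rewrite nm1.
Qed.

(** The failures sum to at most [3 delta / 16 + delta / 16], within [delta]. Before the first epoch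
    ends no call has been made, and almost sure boundedness of the rewards is enough. *)
Lemma call_bounds_hold_but T : but_prob delta (call_bounds_hold T).
Proof.
have /andP[d0 _] := delta01.
have [N /andP[NT TN]] := epoch_index T.
have rew := rewards_bounded T.
have [N0|N0] := posnP N.
  apply: but_prob_le rew; first exact: ltW.
  move=> w rew01; rewrite N0 in NT TN.
  have iT : epoch_inv pol amo delta pi0 (z ^~ w) (act ^~ w) 0 T.
    by apply: (epoch_at pi0 act K0 delta01 amoP rew01).
  rewrite /call_bounds_hold (ei_run iT) /epoch_state; split.
    exact: mulr_ge0 (ler0n _ _) (sqrtr_ge0 _).
  move=> j _; rewrite [st_amo_calls _]/= big_geq//.
  apply: mulr_ge0; last exact: sqrtr_ge0.
  apply: mulr_ge0; [exact: ler0n|apply: exprn_ge0; rewrite /polylog].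
  have ln0 n : 0 <= 1 + ln (natR n) :> R.
    by case: n => [|n]; [rewrite ln0//; lra|have : 0 <= ln (natR n.+1) :> R by [rewrite ln_ge0// ler1n]; lra].
  have v0 := v_gt0 Pi0 delta01.
  have : 0 <= ln (1 + v) by rewrite ln_ge0// lerDl ltW.
  by move=> h; rewrite !mulr_ge0//; lra.
have devs (m : 'I_N) := @epoch_devs m.+1 (ltn0Sn m).
apply: but_prob_le (but_prob_and rew (but_prob_and (but_prob_all devs) (played_devs N0))).
  rewrite -mulr_sumr.
  have -> : \sum_(m < N) delta / (16 * natR (tau m.+1) ^+ 2) =
      delta / 16 * \sum_(m < N) (natR (tau m.+1) ^+ 2)^-1.
    by rewrite mulr_sumr; apply: eq_bigr => m _; rewrite invfM mulrA.
  have := ler_wpM2l (ltW d0) (sum_tau_inv N).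
  by lra.
move=> w [rew01 [hdev hplayed]].
have okm m : (m <= N)%N -> forall n, (n < tau m)%N -> okw w n.
  move=> mN n nm; apply: (epoch_ok pi0 act K0 delta01 amoP rew01).
  by apply: leq_trans (ltnW nm) (leq_trans _ NT); rewrite tau_mono.
apply: (run_bounds mpol K0 delta01 amoP rew01 N0 NT) => //.
- case=> [//|m] pi b _ mN; have [h _] := hdev (Ordinal mN).
  exact: h pi b (okm _ mN).
- case=> [//|m] s pi _ mN sz; have [_ h] := hdev (Ordinal (ltnW mN)).
  exact: h s pi sz (okm _ (ltnW mN)).
- by move=> m0 nm m0min m0N; exact: hplayed nm m0min m0N (okm _ (leqnn N)).
Qed.

Lemma measurable_call_bounds_hold T : measurable [set w | call_bounds_hold T w].
Proof.
have [A [p [m [cd [W [ldr [k [[mA _ _ _ mk] E]]]]]]]] :=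
  @run_measurable _ Omega R K _ X Pi pol amo mpol mamo delta pi0 z act T
  (fun i _ => ip_meas_pair inter i) (fun i _ a => ip_meas_act inter i a).
pose B := [set n : nat | cd%:R <= 354 * Num.sqrt (natR T) /\
  forall j : nat, v <= K%:R * polylog K T v ^+ j ->
    n%:R <= 354 * polylog K T v ^+ (2 + j) * Num.sqrt (K%:R * T%:R / v)].
rewrite (_ : [set w | _] = A `&` \bigcup_(n in B) (k @^-1` [set n])).
  by apply: measurableI => //; apply: bigcup_measurable => n _; exact: mk.
apply/seteqP; split=> w; rewrite /call_bounds_hold /= E.
  by case: asboolP => // Aw h; split=> //; exists (k w).
by case: asboolP => [_ [_ [n Bn ->]]//|nA []].
Qed.

End failure.

Unset Implicit Arguments.

Theorem lemma3 (R : realType) :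
  (forall m : nat, (0 < m)%N -> (tau m.+1 <= 2 * tau m)%N) /\
  exists (C : R) (k : nat),
    0 < C /\
    forall (K : nat) (dX : measure_display) (X : measurableType dX)
      (Pi : finType) (pol : Pi -> X -> 'I_K) (pi0 : Pi)
      (D : probability (X * K.-tuple R)%type R) (delta : R)
      (amo : seq (X * K.-tuple R) -> Pi)
      (dO : measure_display) (Omega : measurableType dO)
      (P : probability Omega R)
      (z : nat -> Omega -> X * K.-tuple R) (act : nat -> Omega -> 'I_K)
      (T : nat),
      injective pol ->
      (forall (pi : Pi) (a : 'I_K), measurable (pol pi @^-1` [set a])) ->
      D [set xr | forall a : 'I_K, 0 <= tnth xr.2 a <= 1] = 1%E ->
      0 < delta < 1 ->
      is_AMO pol amo ->
      measurable_AMO amo ->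
      interaction pol amo delta pi0 D P z act ->
      let v : R := ln (#|Pi|%:R / delta) in
      let bounds : set Omega :=
        [set w |
          if run pol amo delta pi0 (z ^~ w) (act ^~ w) T is Some s then
            (st_cd_calls s)%:R <= C * Num.sqrt T%:R /\
            (forall j : nat, v <= K%:R * polylog K T v ^+ j ->
               (st_amo_calls s)%:R <=
               C * polylog K T v ^+ (k + j) * Num.sqrt (K%:R * T%:R / v))
          else False] in
      ((1 - delta)%:E <= P bounds)%E.

Proof.
split; first exact: tau_double.
exists 354, 2%N; split=> [|K dX X Pi pol pi0 D delta amo dO Omega P z act T]; first by rewrite ltr0n.
move=> _ mpol D01 delta01 amoP mamo inter; cbv zeta.
(* With no action there is no value for [act], hence no outcome, against [P] having total mass 1. *)
have K0 : (0 < K)%N.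
  case: K pol D amo z act mpol D01 amoP mamo inter => // pol D amo z act _ _ _ _ _.
  have := probability_setT P.
  rewrite (_ : setT = set0); last by apply/seteqP; split=> // w _; case: (act 0%N w).
  by rewrite measure0 => /eqP; rewrite eqe eq_sym oner_eq0.
have mb := measurable_call_bounds_hold mpol mamo inter T.
have [E [mE PE HE]] := call_bounds_hold_but mpol K0 delta01 mamo amoP inter D01 T.
apply: (@le_trans _ _ (P (~` E))).
  by rewrite probability_setC// EFinB leeB.
by apply: le_measure; rewrite ?inE//; exact: measurableC.
Qed.
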